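(* Let $t\in\Delta^+$ be an injective-reachable quantum seed, with $t[1]=\overleftarrow\mu t$, $\overleftarrow\mu=\mu_{k_l}\cdots\mu_{k_2}\mu_{k_1}$, and put $\overleftarrow\mu_{\le s}=\mu_{k_s}\cdots\mu_{k_1}$, $t_s=\overleftarrow\mu_{\le s}t$ for $1\le s\le l$. Assume that a subalgebra $\mathrm A(t)\subset\mathcal U_q(t)$ of the quantum upper cluster algebra has the triangular basis $\mathbf L^t$ with respect to the seed $t$, and that: (1) there exists a twist automorphism $\mathrm{tw}$ of Donaldson-Thomas type on $\mathcal F(t)$ such that $\mathrm{tw}$ permutes $\mathbf L^t$ (i.e. restricts to a permutation of $\mathbf L^t$); (2) the quantum cluster monomials $\overleftarrow\mu_{\le s}^*X_{k_s}(t_s)^d$, $d\in\mathbb N$, $1\le s\le l$, obtained along the mutation sequence $\overleftarrow\mu$ starting from $t$ are contained in $\mathbf L^t$. Then $\mathbf L^t$ is the common triangular basis. In particular, it contains all quantum cluster monomials.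
   Context: **Quantum seeds.** $\Bbbk=\mathbb Z[q^{\pm1/2}]$, $v=q^{1/2}$, $\mathbf m=v^{-1}\mathbb Z[v^{-1}]$, $[x]_+=\max(x,0)$ (componentwise for vectors), $\mathbb N=\{0,1,\dots\}$. $I=I_{uf}\sqcup I_f$ is a finite set (unfrozen/frozen vertices). A quantum seed $t$ consists of an integer matrix $\tilde B(t)=(b_{ij})_{i\in I,j\in I_{uf}}$ of full rank $|I_{uf}|$ whose square part $B(t)=(b_{ij})_{i,j\in I_{uf}}$ is skew-symmetrizable, a skew-symmetric integer matrix $\Lambda(t)=(\Lambda_{ij})_{i,j\in I}$ with $\tilde B(t)^T\Lambda(t)=(D'\ 0)$, $D'=\mathrm{diag}(d'_k)_{k\in I_{uf}}$, $d'_k\in\mathbb Z_{>0}$, and variables $X_i(t)$, $i\in I$. $M^\circ(t)=\bigoplus_{i\in I}\mathbb Zf_i\cong\mathbb Z^I$ carries $\lambda(f_i,f_j)=\Lambda_{ij}$. $\mathcal{LP}(t)=\bigoplus_{m\in M^\circ(t)}\Bbbk X(t)^m$ has commutative product $X^m\cdot X^{m'}=X^{m+m'}$ and twisted product $X^m*X^{m'}=v^{\lambda(m,m')}X^{m+m'}$; $X_i(t)=X(t)^{f_i}$; as an algebra it is taken with $*$, and $\mathcal F(t)$ is its skew-field of fractions. $Y(t)^n=X(t)^{\tilde B(t)n}$ for $n\in\mathbb Z^{I_{uf}}$, and $Y_k(t)=Y(t)^{e_k}$. $\mathcal P=\{X(t)^u:u\in\mathbb Z^{I_f}\}$ is the group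 of frozen factors (frozen variables are the same in all seeds). The bar involution is the $\mathbb Z$-linear anti-automorphism with $v\mapsto v^{-1}$, $X(t)^m\mapsto X(t)^m$. For $k\in I_{uf}$, $t'=\mu_kt$ has $b'_{ij}=-b_{ij}$ if $k\in\{i,j\}$, otherwise $b'_{ij}=b_{ij}+b_{ik}[b_{kj}]_++[-b_{ik}]_+b_{kj}$; $\Lambda(t')_{ij}=\lambda(f'_i,f'_j)$ with $f'_i=f_i$ ($i\ne k$), $f'_k=-f_k+\sum_j[-b_{jk}]_+f_j$; and $\mu_k^*:\mathcal F(t')\cong\mathcal F(t)$ sends $X_i(t')\mapsto X_i(t)$ ($i\ne k$), $X_k(t')\mapsto X(t)^{-f_k+\sum_j[-b_{jk}]_+f_j}+X(t)^{-f_k+\sum_j[b_{jk}]_+f_j}$. $\Delta^+$ is the set of seeds obtained from an initial seed by iterated mutations. A mutation sequence $\overleftarrow\mu$ with $t_2=\overleftarrow\mu t_1$ induces the composite $\overleftarrow\mu^*:\mathcal F(t_2)\cong\mathcal F(t_1)$, which depends only on $t_1,t_2$ and is also written $\mu^*_{t_2,t_1}$. $\mathcal U_q(t)=\bigcap_{t'\in\Delta^+}\mu^*_{t',t}\mathcal{LP}(t')$. Quantum cluster monomials of a seed $s$ are the $\mu^*_{s,t}X(s)^m$, $m\in\mathbb N^I$. **Degrees.** $m'\preceq_tm$ in $M^\circ(t)$ iff $m'=m+\tilde B(t)n$ for some $n\in\mathbb N^{I_{uf}}$. An element is $g$-pointed (pointed at $g$, of degree $g$) if it has the form $X(t)^g\cdot(1+\sum_{0\ne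 n\in\mathbb N^{I_{uf}}}c_nY(t)^n)$, $c_n\in\Bbbk$. If $Z$ has a unique $\prec_t$-maximal Laurent degree, $[Z]^t$ denotes $Z$ divided by the coefficient at that degree. Cluster variables are pointed. **Tropical transformations, compatibility.** For $t'=\mu_kt$, $\phi_{t',t}:M^\circ(t)\to M^\circ(t')$, $g\mapsto g'$, is $g'_k=-g_k$, $g'_i=g_i+[b_{ik}]_+g_k$ if $i\neq k,g_k\ge0$, $g'_i=g_i+[-b_{ik}]_+g_k$ if $i\ne k,g_k<0$; for general $t'\in\Delta^+$, $\phi_{t',t}$ is the composite along a mutation sequence from $t$ to $t'$ (independent of the choice). Pointed sets $\{S_g\}\subset\mathcal{LP}(t)$ and $\{S'_{g'}\}\subset\mathcal{LP}(t')$ are compatible if $\mu^*_{t,t'}S_g=S'_{\phi_{t',t}g}$ for all $g$. **Injective-reachability.** $t$ is injective-reachable if there are $t[1]=\overleftarrow\mu t\in\Delta^+$ and a permutation $\sigma$ of $I_{uf}$ such that for each $k\in I_{uf}$ the $I_{uf}$-part of the degree of $I_k(t):=\overleftarrow\mu^*X_{\sigma k}(t[1])\in\mathcal{LP}(t)$ is $-f_k$; the property then holds for all seeds of $\Delta^+$. **Triangular bases.** A $\Bbbk$-basis $\mathbf L$ of the subalgebra $\mathrm A(t)\subset\mathcal U_q(t)$ is the triangular basis for $t$ if: (1) its elements are bar-invariant; (2) it contains the quantum cluster monomials of $t$ and $t[1]$; (3) $\mathbf L=\{\mathbf L_g\mid g\in M^\circ(t)\}$ with $\mathbf L_g$ $g$-pointed;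 (4) for all $i\in I$, $g$: $[X_i(t)*\mathbf L_g]^t=\mathbf L_{g+f_i}+\sum_{g'\prec_tg+f_i}b_{g'}\mathbf L_{g'}$, $b_{g'}\in\mathbf m$. It is the common triangular basis if $\mu^*_{t,t'}\mathbf L$ is the triangular basis of $\mathrm A(t'):=\mu^*_{t,t'}\mathrm A(t)$ for every $t'\in\Delta^+$ and these bases are pairwise compatible. **Twist automorphisms.** Seeds $t,t'$ are similar up to a permutation $\sigma$ of $I_{uf}$ if $b_{\sigma i,\sigma j}(t')=b_{ij}(t)$ for $i,j\in I_{uf}$ and $d'_{\sigma k}(t')=d'_k(t)$ ($t$ and $t[1]$ are). For such $t'=\overleftarrow\mu t\in\Delta^+$, a variation map is an algebra isomorphism $\mathrm{var}^t:\mathcal F(t)\cong\mathcal F(t')$ (for $*$) such that $\mathrm{var}^t(X_k(t))=p_k\cdot X_{\sigma k}(t')$ with $p_k\in\mathcal P$ and $\mathrm{var}^t(Y_k(t))=Y_{\sigma k}(t')$ for $k\in I_{uf}$, and $\mathrm{var}^t(\mathcal P)=\mathcal P$. The composite $\mathrm{tw}=\overleftarrow\mu^*\mathrm{var}^t:\mathcal F(t)\cong\mathcal F(t)$ is a (cluster) twist automorphism passing through $t'$; it is of Donaldson-Thomas type if $t'=t[1]$. *)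

(* Defs.v *)
From HB Require Import structures.
From mathcomp Require Import all_boot all_order all_algebra.
From mathcomp Require Import perm finmap monalg.
From mathcomp Require Import boolp classical_sets functions.

Set Implicit Arguments.
Unset Strict Implicit.
Unset Printing Implicit Defensive.

Import Order.TTheory GRing.Theory Num.Theory.

Local Open Scope fset_scope.
Local Open Scope ring_scope.

(* Twisted group algebras: the free R-module on G, with product
   [g] [h] = c(g, h) [g + h] for a normalized 2-cocycle c. *)

Section TwistedProduct.
Context {R : comNzRingType} {G : zmodType}.

Definition twmul (c : G -> G -> R) (x y : {malg R[G]}) : {malg R[G]} :=
  \sum_(a <- msupp x) \sum_(b <- msupp y)
     mkmalgU (a + b) (c a b * (x@_a * y@_b)).

Record cocycle := Cocycle {
  cocycle_fun :> G -> G -> R;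
  cocycleA : forall a b d, cocycle_fun a b * cocycle_fun (a + b) d
                         = cocycle_fun b d * cocycle_fun a (b + d);
  cocycle0l : forall a, cocycle_fun 0 a = 1;
  cocycle0r : forall a, cocycle_fun a 0 = 1
}.

Lemma twmul_wide (c : G -> G -> R) (d1 d2 : {fset G}) (x y : {malg R[G]}) :
  msupp x `<=` d1 -> msupp y `<=` d2 ->
  twmul c x y = \sum_(a <- d1) \sum_(b <- d2)
     mkmalgU (a + b) (c a b * (x@_a * y@_b)).
Proof.
move=> le1 le2; rewrite /twmul (big_fset_incl _ le1) /=.
  apply: eq_bigr => a _; apply: big_fset_incl => // b _ /mcoeff_outdom ->.
  by rewrite !mulr0 monalgU0.
move=> a _ /mcoeff_outdom xa.
by rewrite big1 // => b _; rewrite xa mul0r mulr0 monalgU0.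
Qed.

Lemma twmul0g c : left_zero 0 (twmul c).
Proof. by move=> g; rewrite /twmul msupp0 big_seq_fset0. Qed.

Lemma twmulg0 c : right_zero 0 (twmul c).
Proof.
by move=> g; rewrite /twmul big1 // => a _; rewrite msupp0 big_seq_fset0.
Qed.

Lemma twmulDl c : left_distributive (twmul c) +%R.
Proof.
move=> x y z.
rewrite [in RHS](twmul_wide c (fsubsetUl _ (msupp y)) (fsubset_refl (msupp z))).
rewrite [in RHS](twmul_wide c (fsubsetUr (msupp x) _) (fsubset_refl (msupp z))).
rewrite (twmul_wide c (msuppD_le _ _) (fsubset_refl (msupp z))).
rewrite -big_split /=; apply: eq_bigr => a _.
rewrite -big_split /=; apply: eq_bigr => b _.
by rewrite mcoeffD mulrDl mulrDr monalgUD.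
Qed.

Lemma twmulDr c : right_distributive (twmul c) +%R.
Proof.
move=> z x y.
rewrite [in RHS](twmul_wide c (fsubset_refl (msupp z)) (fsubsetUl _ (msupp y))).
rewrite [in RHS](twmul_wide c (fsubset_refl (msupp z)) (fsubsetUr (msupp x) _)).
rewrite (twmul_wide c (fsubset_refl (msupp z)) (msuppD_le _ _)).
rewrite -big_split /=; apply: eq_bigr => a _.
rewrite -big_split /=; apply: eq_bigr => b _.
by rewrite mcoeffD !mulrDr monalgUD.
Qed.

Lemma twmulUU c a b (x y : R) :
  twmul c (mkmalgU a x) (mkmalgU b y) = mkmalgU (a + b) (c a b * (x * y)).
Proof. by rewrite (twmul_wide c msuppU_le msuppU_le) !big_seq_fset1 !mcoeffUU. Qed.

Lemma twmul_sumlr c (x y : {malg R[G]}) :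
  twmul c x y = \sum_(a <- msupp x) \sum_(b <- msupp y)
     twmul c (mkmalgU a x@_a) (mkmalgU b y@_b).
Proof. by apply: eq_bigr => a _; apply: eq_bigr => b _; rewrite twmulUU. Qed.

Lemma twmul_suml c I (r : seq I) (P : pred I) (E : I -> {malg R[G]}) y :
  twmul c (\sum_(i <- r | P i) E i) y = \sum_(i <- r | P i) twmul c (E i) y.
Proof.
exact: (big_morph (twmul c ^~ y) (fun _ _ => twmulDl _ _ _ _) (twmul0g _ _)).
Qed.

Lemma twmul_sumr c I (r : seq I) (P : pred I) (E : I -> {malg R[G]}) x :
  twmul c x (\sum_(i <- r | P i) E i) = \sum_(i <- r | P i) twmul c x (E i).
Proof.
exact: (big_morph (twmul c x) (fun _ _ => twmulDr _ _ _ _) (twmulg0 _ _)).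
Qed.

Lemma twmulA (c : cocycle) : associative (twmul c).
Proof.
move=> x y z; rewrite [x]monalgE !twmul_suml; apply: eq_bigr => a _.
rewrite [y]monalgE twmul_suml !twmul_sumr twmul_suml; apply: eq_bigr => b _.
rewrite [z]monalgE !twmul_sumr; apply: eq_bigr => d _.
rewrite !twmulUU !addrA; congr mkmalgU.
have -> : c a (b + d) * (x@_a * (c b d * (y@_b * z@_d)))
  = (c b d * c a (b + d)) * (x@_a * y@_b * z@_d).
  by rewrite [x@_a * (_ * _)]mulrCA [LHS]mulrCA !mulrA.
by rewrite -cocycleA -!mulrA [RHS]mulrCA.
Qed.

Lemma twmul1l (c : cocycle) : left_id (mkmalgU 0 1) (twmul c).
Proof.
move=> x; rewrite [in RHS](monalgE x) [x in LHS]monalgE twmul_sumr.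
by apply: eq_bigr => a _; rewrite twmulUU add0r cocycle0l !mul1r.
Qed.

Lemma twmul1r (c : cocycle) : right_id (mkmalgU 0 1) (twmul c).
Proof.
move=> x; rewrite [in RHS](monalgE x) [x in LHS]monalgE twmul_suml.
by apply: eq_bigr => a _; rewrite twmulUU addr0 cocycle0r mul1r mulr1.
Qed.

Lemma scale_mkmalgU (k : R) (a : G) (u : R) :
  k *: mkmalgU a u = mkmalgU a (k * u).
Proof. by apply/malgP => b; rewrite mcoeffZ !mcoeffU mulrnAr. Qed.

Lemma twmulZl c (k : R) x y : k *: twmul c x y = twmul c (k *: x) y.
Proof.
rewrite (twmul_wide c (msuppZ_le k x) (fsubset_refl (msupp y))).
rewrite scaler_sumr; apply: eq_bigr => a _.
rewrite scaler_sumr; apply: eq_bigr => b _.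
by rewrite scale_mkmalgU mcoeffZ mulrCA !mulrA.
Qed.

Lemma twmulZr c (k : R) x y : k *: twmul c x y = twmul c x (k *: y).
Proof.
rewrite (twmul_wide c (fsubset_refl (msupp x)) (msuppZ_le k y)).
rewrite scaler_sumr; apply: eq_bigr => a _.
rewrite scaler_sumr; apply: eq_bigr => b _.
by rewrite scale_mkmalgU mcoeffZ mulrCA [x@_a * (k * _)]mulrCA.
Qed.

Lemma mkmalgU_neq0 : mkmalgU 0 1 != 0 :> {malg R[G]}.
Proof. by rewrite monalgU_eq0 oner_eq0. Qed.

End TwistedProduct.
Arguments cocycle : clear implicits.

Definition twalg (R : comNzRingType) (G : zmodType) (c : cocycle R G) : Type :=
  {malg R[G]}.

Section TwistedAlgebra.
Variables (R : comNzRingType) (G : zmodType) (c : cocycle R G).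

HB.instance Definition _ := GRing.Lmodule.copy (twalg c) {malg R[G]}.
HB.instance Definition _ := GRing.Zmodule_isNzRing.Build (twalg c)
  (@twmulA R G c) (@twmul1l R G c) (@twmul1r R G c)
  (@twmulDl R G c) (@twmulDr R G c) (@mkmalgU_neq0 R G).
HB.instance Definition _ := GRing.Lmodule_isLalgebra.Build R (twalg c)
  (@twmulZl R G c).
HB.instance Definition _ := GRing.Lalgebra_isAlgebra.Build R (twalg c)
  (@twmulZr R G c).

End TwistedAlgebra.

Definition trivial_cocycle (R : comNzRingType) (G : zmodType) : cocycle R G :=
  @Cocycle R G (fun _ _ => 1) (fun _ _ _ => erefl) (fun _ => erefl)
    (fun _ => erefl).

(* [kk] is Z[v, v^-1], with v = q^(1/2) = [vpow 1]. *)
Definition kk : Type := twalg (trivial_cocycle int int).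

Lemma kk_mulC (x y : {malg int[int]}) :
  twmul (trivial_cocycle int int) x y = twmul (trivial_cocycle int int) y x.
Proof.
rewrite /twmul exchange_big; apply: eq_bigr => a _; apply: eq_bigr => b _.
by rewrite addrC [x@__ * _]mulrC.
Qed.

HB.instance Definition _ := GRing.NzRing.copy kk (twalg (trivial_cocycle int int)).
HB.instance Definition _ := GRing.PzRing_hasCommutativeMul.Build kk kk_mulC.

Definition vpow (a : int) : kk := mkmalgU a 1.

Lemma vpowD (a b : int) : vpow (a + b) = vpow a * vpow b.
Proof. by rewrite [RHS]twmulUU !mul1r. Qed.

Lemma vpow0 : vpow 0 = 1. Proof. by []. Qed.

(* v^-1 Z[v^-1] *)
Definition in_mm (c : kk) : Prop := forall a : int, a \in msupp c -> a < 0.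

Definition bar_kk (c : kk) : kk := \sum_(a <- msupp c) mkmalgU (- a) c@_a.

(* The indices are I = 'I_(nu + nf), the first nu of them being the unfrozen
   ones.  A [qseed] is the matrix part of a seed; the variables X_i(t) live in
   the algebras [LP t] and [F t] attached to it below. *)

Section QuantumSeeds.
Variables (nu nf : nat).

Record qseed := QSeed {
  Bt : 'M[int]_(nu + nf, nu);
  Lam : 'M[int]_(nu + nf)
}.

Implicit Types (t : qseed) (k : 'I_nu) (g m : 'cV[int]_(nu + nf)).

Definition uf (k : 'I_nu) : 'I_(nu + nf) := lshift nf k.

Definition fb (i : 'I_(nu + nf)) : 'cV[int]_(nu + nf) := delta_mx i 0.

Definition posp (x : int) : int := Num.max x 0.

Definition Bsq t (i j : 'I_nu) : int := Bt t (uf i) j.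

Definition skew_symmetrizable t : Prop :=
  exists d : 'I_nu -> int, (forall i, 0 < d i) /\
    forall i j, d i * Bsq t i j = - (d j * Bsq t j i).

Definition is_quantum_seed t : Prop :=
  [/\ \rank (map_mx (intr : int -> rat) (Bt t)) = nu,
      skew_symmetrizable t,
      (Lam t)^T = - Lam t
    & exists d : 'rV[int]_nu, (forall k, 0 < d 0 k) /\
        (Bt t)^T *m Lam t = row_mx (diag_mx d) 0].

Definition dprime t k : int := ((Bt t)^T *m Lam t) k (uf k).

Definition lam t m m' : int := (m^T *m Lam t *m m') 0 0.

Definition fmut t k (i : 'I_(nu + nf)) : 'cV[int]_(nu + nf) :=
  if i == uf k then - fb (uf k) + \sum_j posp (- Bt t j k) *: fb j else fb i.

Definition mutate t k : qseed := QSeed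
  (\matrix_(i, j)
     if (i == uf k) || (j == k) then - Bt t i j
     else Bt t i j + Bt t i k * posp (Bt t (uf k) j)
          + posp (- Bt t i k) * Bt t (uf k) j)
  (\matrix_(i, j) lam t (fmut t k i) (fmut t k j)).

(* The sequence [:: k_1; ...; k_l] stands for mu_{k_l} ... mu_{k_1}.  Seeds of
   Delta^+ are addressed by mutation sequences, since distinct seeds may have
   the same matrices. *)
Fixpoint mutate_seq t (ks : seq 'I_nu) : qseed :=
  if ks is k :: ks' then mutate_seq (mutate t k) ks' else t.

Lemma lamDl t m1 m2 m : lam t (m1 + m2) m = lam t m1 m + lam t m2 m.
Proof. by rewrite /lam linearD /= !mulmxDl mxE. Qed.

Lemma lamDr t m m1 m2 : lam t m (m1 + m2) = lam t m m1 + lam t m m2.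
Proof. by rewrite /lam mulmxDr mxE. Qed.

Lemma lam0l t m : lam t 0 m = 0.
Proof. by rewrite /lam linear0 !mul0mx mxE. Qed.

Lemma lam0r t m : lam t m 0 = 0.
Proof. by rewrite /lam mulmx0 mxE. Qed.

Lemma vlamA t m1 m2 m3 :
  vpow (lam t m1 m2) * vpow (lam t (m1 + m2) m3)
  = vpow (lam t m2 m3) * vpow (lam t m1 (m2 + m3)).
Proof. by rewrite -!vpowD lamDl lamDr; rewrite [in RHS]addrC -addrA. Qed.

Lemma vlam0l t m : vpow (lam t 0 m) = 1.
Proof. by rewrite lam0l. Qed.

Lemma vlam0r t m : vpow (lam t m 0) = 1.
Proof. by rewrite lam0r. Qed.

Definition qcocycle t : cocycle kk 'cV[int]_(nu + nf) :=
  Cocycle (vlamA t) (vlam0l t) (vlam0r t).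

(* The ring product of [LP t] is the twisted product; [cmul] is the commutative
   one. *)
Definition LP t : Type := twalg (qcocycle t).
HB.instance Definition _ t := GRing.Algebra.on (LP t).

Definition cmul t (x y : LP t) : LP t := twmul (fun _ _ => 1) x y.

Definition Xm t m : LP t := mkmalgU m 1.

Lemma XmM t m m' : Xm t m * Xm t m' = vpow (lam t m m') *: Xm t (m + m').
Proof. by rewrite [LHS]twmulUU scale_mkmalgU !mulr1. Qed.

Lemma cmulX t m m' : cmul (Xm t m) (Xm t m') = Xm t (m + m').
Proof. by rewrite /cmul twmulUU !mulr1. Qed.

Definition Xv t (i : 'I_(nu + nf)) : LP t := Xm t (fb i).

Definition Ym t (n : 'cV[int]_nu) : LP t := Xm t (Bt t *m n).

Definition Yv t k : LP t := Ym t (delta_mx k 0).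

Definition nvec {p} (n : 'cV[nat]_p) : 'cV[int]_p := map_mx Posz n.

(* The Z-linear map sending v^a X^m to v^-a X^m; it reverses the twisted product
   because [Lam t] is skew-symmetric. *)
Definition bar t (x : LP t) : LP t :=
  \sum_(m <- msupp x) mkmalgU m (bar_kk x@_m).

Definition dom_le t m' m : Prop :=
  exists n : 'cV[nat]_nu, m' = m + Bt t *m nvec n.

Definition dom_lt t m' m : Prop := dom_le t m' m /\ m' <> m.

Definition maximal_degree t (x : LP t) g : Prop :=
  g \in msupp x /\ forall g', g' \in msupp x -> ~ dom_lt t g g'.

Definition pointedLP t g (x : LP t) : Prop :=
  exists (s : seq 'cV[nat]_nu) (c : 'cV[nat]_nu -> kk),
    [/\ uniq s, 0 \notin s &
     x = cmul (Xm t g) (1 + \sum_(n <- s) c n *: Ym t (nvec n))].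

Definition trop t k g : 'cV[int]_(nu + nf) :=
  \col_i if i == uf k then - g (uf k) 0
         else if 0 <= g (uf k) 0 then g i 0 + posp (Bt t i k) * g (uf k) 0
         else g i 0 + posp (- Bt t i k) * g (uf k) 0.

Fixpoint trop_seq t (ks : seq 'I_nu) g : 'cV[int]_(nu + nf) :=
  if ks is k :: ks' then trop_seq (mutate t k) ks' (trop t k g) else g.

Definition similar (sigma : {perm 'I_nu}) t t' : Prop :=
  (forall i j, Bsq t' (sigma i) (sigma j) = Bsq t i j) /\
  (forall k, dprime t' (sigma k) = dprime t k).

(* X(t)^u, u in Z^(I_f) *)
Definition Xfr t (u : 'cV[int]_nf) : LP t := Xm t (col_mx 0 u).

End QuantumSeeds.

Definition alg_iso (K K' : unitAlgType kk) (f : K -> K') : Prop :=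
  [/\ linear f, GRing.monoid_morphism f & bijective f].

Definition skew_field_of_fractions (A : algType kk) (K : unitAlgType kk)
    (emb : A -> K) : Prop :=
  [/\ forall z : K, z != 0 -> z \is a GRing.unit,
      injective emb &
      forall z : K, exists a b : A, b != 0 /\ z = emb a / emb b].

(* The skew-fields of fractions F(t) with the isomorphisms
   mu_k^* : F(mu_k t) -> F(t).  All components are determined up to a unique
   isomorphism by the fields below: [LP t] is an Ore domain for every integer
   matrix [Lam t], and a morphism out of F(mu_k t) is determined by its values
   on the variables. *)
Record fraction_fields (nu nf : nat) := FractionFields {
  Fr :> qseed nu nf -> unitAlgType kk;
  emb : forall t, {lrmorphism LP t -> Fr t};
  embP : forall t, skew_field_of_fractions (emb t);
  mustar : forall t k, Fr (mutate t k) -> Fr t;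
  mustar_iso : forall t k, is_quantum_seed t -> alg_iso (@mustar t k);
  mustarX : forall t k i, is_quantum_seed t -> i != uf nf k ->
    mustar (emb (mutate t k) (Xv (mutate t k) i)) = emb t (Xv t i);
  mustarXk : forall t k, is_quantum_seed t ->
    mustar (emb (mutate t k) (Xv (mutate t k) (uf nf k))) =
    emb t (Xm t (- fb (uf nf k) + \sum_j posp (- Bt t j k) *: fb j))
    + emb t (Xm t (- fb (uf nf k) + \sum_j posp (Bt t j k) *: fb j))
}.
Arguments emb {nu nf} F {t} : rename.
Arguments mustar {nu nf} F {t} k z : rename.

Local Close Scope fset_scope.
Local Open Scope classical_set_scope.

Section Bases.
Context {nu nf : nat} (F : fraction_fields nu nf).
Implicit Types (t : qseed nu nf) (ks js : seq 'I_nu).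

Fixpoint mustar_seq t ks : F (mutate_seq t ks) -> F t :=
  if ks is k :: ks' return F (mutate_seq t ks) -> F t
  then fun z => mustar F k (@mustar_seq (mutate t k) ks' z) else id.
Arguments mustar_seq t ks z : clear implicits.

Definition pointed t (g : 'cV[int]_(nu + nf)) (z : F t) : Prop :=
  exists x : LP t, z = emb F x /\ pointedLP g x.

Definition bar_invariant t (z : F t) : Prop :=
  exists x : LP t, z = emb F x /\ bar x = x.

(* U_q(t).  Mutations being involutive, every seed of Delta^+ is reached from t
   by some sequence ks. *)
Definition upper_cluster_algebra t : set (F t) :=
  [set z | forall ks, exists x : LP (mutate_seq t ks),
             z = mustar_seq t ks (emb F x)].
Arguments upper_cluster_algebra t _ : clear implicits.

(* The quantum cluster monomials of mutate_seq t ks, viewed in F(t). *)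
Definition cluster_monomials t ks : set (F t) :=
  [set z | exists m : 'cV[nat]_(nu + nf),
             z = mustar_seq t ks (emb F (Xm (mutate_seq t ks) (nvec m)))].
Arguments cluster_monomials t ks _ : clear implicits.

Definition frozen_factors t : set (F t) :=
  [set z | exists u : 'cV[int]_nf, z = emb F (Xfr t u)].
Arguments frozen_factors t _ : clear implicits.

(* t[1] = mutate_seq t ks, with permutation sigma; [usubmx g] is the
   I_uf-part of g. *)
Definition is_shift t ks (sigma : {perm 'I_nu}) : Prop :=
  forall k, exists g, usubmx g = - delta_mx k 0 /\
    pointed g (mustar_seq t ks (emb F (Xv (mutate_seq t ks) (uf nf (sigma k))))).
Arguments is_shift t ks sigma : clear implicits.

Definition injective_reachable t : Prop := exists ks sigma, is_shift t ks sigma.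

Definition is_subalgebra (K : unitAlgType kk) (A : set K) : Prop :=
  [/\ A 1, forall (c : kk) x y, A x -> A y -> A (c *: x + y)
    & forall x y, A x -> A y -> A (x * y)].

Definition is_basis (K : unitAlgType kk) (A L : set K) : Prop :=
  [/\ L `<=` A,
      forall z, A z -> exists (s : seq K) (c : K -> kk),
        (forall x, x \in s -> L x) /\ z = \sum_(x <- s) c x *: x
    & forall (s : seq K) (c : K -> kk), uniq s -> (forall x, x \in s -> L x) ->
        \sum_(x <- s) c x *: x = 0 -> forall x, x \in s -> c x = 0].

(* L = {Lg g | g}, with Lg g pointed at g *)
Definition pointed_family t (L : set (F t)) (Lg : 'cV[int]_(nu + nf) -> F t)
  : Prop := L = range Lg /\ forall g, pointed g (Lg g).

(* [Z]^t = W *)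
Definition normalizes_to t (Z W : F t) : Prop :=
  exists (x : LP t) g,
    [/\ Z = emb F x, unique (maximal_degree x) g & Z = x@_g *: W].

Definition triangular_products t (Lg : 'cV[int]_(nu + nf) -> F t) : Prop :=
  forall (i : 'I_(nu + nf)) (g : 'cV[int]_(nu + nf)),
  exists (s : seq 'cV[int]_(nu + nf)) (b : 'cV[int]_(nu + nf) -> kk),
    [/\ uniq s,
        forall g', g' \in s -> dom_lt t g' (g + fb i) /\ in_mm (b g')
      & normalizes_to (emb F (Xv t i) * Lg g)
          (Lg (g + fb i) + \sum_(g' <- s) b g' *: Lg g')].

(* L is the triangular basis of A with respect to t, where
   t[1] = mutate_seq t ks. *)
Definition is_triangular_basis t ks (A L : set (F t)) : Prop :=
  [/\ is_subalgebra A /\ A `<=` upper_cluster_algebra t,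
      is_basis A L,
      forall z, L z -> bar_invariant z,
      cluster_monomials t [::] `<=` L /\ cluster_monomials t ks `<=` L
    & exists Lg, pointed_family L Lg /\ triangular_products Lg].
Arguments is_triangular_basis t ks A L : clear implicits.

(* Pointed sets at t and t' = mutate_seq t ks.  The map mu^*_{t,t'} is the
   inverse of mu^*_{t',t} = mustar_seq. *)
Definition compatible t ks (S : set (F t)) (S' : set (F (mutate_seq t ks)))
  : Prop :=
  exists Sg Sg', [/\ pointed_family S Sg, pointed_family S' Sg' &
    forall g, Sg g = mustar_seq t ks (Sg' (trop_seq t ks g))].
Arguments compatible t ks S S' : clear implicits.

(* mu^*_{t,t'} S, where t' = mutate_seq t ks *)
Definition transport t ks (S : set (F t)) : set (F (mutate_seq t ks)) :=
  mustar_seq t ks @^-1` S.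
Arguments transport t ks S _ : clear implicits.

(* Each seed t' is injective-reachable, and the condition at t' is imposed for
   every realization of t'[1] by a mutation sequence.  In the compatibility
   clause, ks and js range over all sequences, so the two seeds are an arbitrary
   pair in Delta^+ and js an arbitrary sequence joining them. *)
Definition is_common_triangular_basis t (A L : set (F t)) : Prop :=
  (forall ks, let t' := mutate_seq t ks in
     injective_reachable t' /\
     forall ks' sigma', is_shift t' ks' sigma' ->
       is_triangular_basis t' ks' (transport t ks A) (transport t ks L)) /\
  (forall ks js,
     let t' := mutate_seq t ks in let L' := transport t ks L in
     compatible t' js L' (transport t' js L')).
Arguments is_common_triangular_basis t A L : clear implicits.

(* Frozen vertices keep their indices, so that the same group of frozen factors
   is spelled [frozen_factors t] in F(t) and [frozen_factors t'] in F(t'). *)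
Definition is_variation_map (sigma : {perm 'I_nu}) t t' (var : F t -> F t')
  : Prop :=
  [/\ similar sigma t t',
      alg_iso var,
      forall k, exists u, var (emb F (Xv t (uf nf k))) =
        emb F (cmul (Xfr t' u) (Xv t' (uf nf (sigma k)))),
      forall k, var (emb F (Yv t k)) = emb F (Yv t' (sigma k))
    & var @` frozen_factors t = frozen_factors t'].
Arguments is_variation_map sigma t t' var : clear implicits.

Definition is_twist t ks (sigma : {perm 'I_nu}) (tw : F t -> F t) : Prop :=
  exists2 var : F t -> F (mutate_seq t ks),
    is_variation_map sigma t (mutate_seq t ks) var & tw = mustar_seq t ks \o var.
Arguments is_twist t ks sigma tw : clear implicits.

Definition is_DT_twist t ks (sigma : {perm 'I_nu}) (tw : F t -> F t) : Prop :=
  is_shift t ks sigma /\ is_twist t ks sigma tw.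
Arguments is_DT_twist t ks sigma tw : clear implicits.

End Bases.

Arguments mustar_seq {nu nf} F t ks z.
Arguments upper_cluster_algebra {nu nf} F t _.
Arguments cluster_monomials {nu nf} F t ks _.
Arguments frozen_factors {nu nf} F t _.
Arguments is_shift {nu nf} F t ks sigma.
Arguments is_triangular_basis {nu nf} F t ks A L.
Arguments compatible {nu nf} F t ks S S'.
Arguments transport {nu nf} F t ks S _.
Arguments is_common_triangular_basis {nu nf} F t A L.
Arguments is_variation_map {nu nf} F sigma t t' var.
Arguments is_twist {nu nf} F t ks sigma tw.
Arguments is_DT_twist {nu nf} F t ks sigma tw.

(* Main.v *)
(* For adjacent seeds t and t' = mu_k t, an element of both Laurent rings expands in
   the basis S of monomials in X_k or X_k'.  In the expansion of L_g, a coefficient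
   at a degree not dominated by trop(g) for t' is bar-invariant and, by comparing L_g
   with products X^a * X(t[1])^b of cluster monomials of t and t[1] (which are
   triangular in L), lies in m; so it vanishes, and every L_g is pointed at trop(g)
   in t'.  The comparison needs the new variable V of mu_(sigma k) t[1] to be pointed
   in t'; this follows from its commutation with the I_j (j <> k).

   When the powers of X_k' belong to L, triangularity passes to t', the twist still
   relates t' to t'[1], and the data at t is reproduced at t'.  Hypothesis (2) lets
   this be iterated along the sequence from t to t[1], and then along its sigma-image.
   For an arbitrary k, the new variable of mu_(sigma k) t[1] is linked to t' by the
   chain t' -> t -> ... -> t[1] -> mu_(sigma k) t[1], on every step of which L is
   pointed compatibly with the tropical maps; since these preserve Lambda on the
   domains of linearity, its powers are forced to belong to L, and tw^-1 carries them
   to the powers of X_k'.  Hence the data propagates to all seeds. *)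
Require Import Defs.
From mathcomp Require Import all_boot all_order all_algebra.
From mathcomp Require Import perm classical_sets functions.
From mathcomp Require Import finmap monalg zify ring boolp.
Set Implicit Arguments.
Unset Strict Implicit.
Unset Printing Implicit Defensive.
Import Order.TTheory GRing.Theory Num.Theory.
Local Open Scope ring_scope.

(** * Finitely supported functions and twisted products *)

(** Several inputs need arguments of their own. That V is Laurent in t and in t' follows from
    mutation invariance of the upper bound of a seed, the intersection of its Laurent ring with
    those of its neighbours. The degree of V in t is read from the exchange relation, which writes V
    * I_k as a combination of two monomials of t[1]: their degrees in t differ by y_k up to a vector
    r in the radical of lambda, and r = 0 is proved by comparing the tops of k-strings. In t' the
    tropical map keeps dominance except in the k-th coordinate of n. A violation there is excluded
    for all variables of mu_(sigma k) t[1] at once: quasi-commutation exponents are the values of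
    lambda on leading degrees, for every choice of order, and two opposite orders on an extremal
    face would give incompatible values. The same principle makes the degree map of t[1] an
    isometry. Finally, triangularity is known for left multiplication by variables of t only; other
    multiplications are tested on the products J_h of monomials of t and t[1] and carried over to
    L_h by a recursion on the height of degree differences. *)

Section Malg.
Context {R : comNzRingType} {G : zmodType}.
Implicit Types (x y : {malg R[G]}) (c : G -> G -> R).

Lemma mem_msupp x a : (a \in msupp x) = (x@_a != 0).
Proof. by rewrite mcoeff_neq0. Qed.

Lemma twmulE c x y w : (twmul c x y)@_w =
  \sum_(a <- msupp x) \sum_(b <- msupp y) (c a b * (x@_a * y@_b)) *+ (a + b == w).
Proof.
rewrite /twmul raddf_sum /=; apply: eq_bigr => a _.
by rewrite raddf_sum /=; apply: eq_bigr => b _; rewrite mcoeffU.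
Qed.

Lemma twmul_supp c x y w : w \in msupp (twmul c x y) ->
  exists a b, [/\ a \in msupp x, b \in msupp y & w = a + b].
Proof.
rewrite mem_msupp; apply: contraNP => H; rewrite twmulE.
rewrite big_seq big1 // => a ha; rewrite big_seq big1 // => b hb.
by case: eqP => // e; case: H; exists a, b.
Qed.

(** The extremal-term principle behind all leading coefficients. The degrees a and b need not lie in
    the supports; if one does not, both sides vanish. *)
Lemma twmul_lead c x y a b :
  (forall a' b', a' \in msupp x -> b' \in msupp y -> a' + b' = a + b -> a' = a) ->
  (twmul c x y)@_(a + b) = c a b * (x@_a * y@_b).
Proof.
move=> H; rewrite twmulE.
have [xa|xa] := boolP (a \in msupp x); last first.
  rewrite (mcoeff_outdom xa) mul0r mulr0 big_seq big1 // => a' ha'.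
  rewrite big_seq big1 // => b' hb'; case: eqP => // e.
  by move: xa; rewrite -(H _ _ ha' hb' e) ha'.
rewrite (bigD1_seq a _ (fset_uniq _)) //= [X in _ + X]big1_seq ?addr0; last first.
  move=> a' /andP[na ha']; rewrite big1_seq // => b' /andP[_ hb'].
  by case: eqP => // e; rewrite (H _ _ ha' hb' e) eqxx in na.
have [yb|yb] := boolP (b \in msupp y); last first.
  rewrite (mcoeff_outdom yb) !mulr0 big1_seq // => b' /andP[_ hb'].
  by case: eqP => // /addrI e; rewrite -e hb' in yb.
rewrite (bigD1_seq b _ (fset_uniq _)) //= eqxx [X in _ + X]big1_seq ?addr0 // => b' /andP[nb hb'].
by case: eqP => // /addrI e; rewrite e eqxx in nb.
Qed.

Lemma mcoeff_sum I (r : seq I) (Q : pred I) (f : I -> {malg R[G]}) a :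
  (\sum_(i <- r | Q i) f i)@_a = \sum_(i <- r | Q i) (f i)@_a.
Proof. by rewrite (big_morph _ (mcoeffD a) (mcoeff0 a)). Qed.

Lemma msupp_ex x : x <> 0 -> exists2 a, a \in msupp x & True.
Proof.
move=> x0; apply: contrapT => h; apply: x0; apply/malgP => a; rewrite mcoeff0.
by apply/eqP; rewrite mcoeff_eq0; apply/negP => ha; apply: h; exists a.
Qed.

Definition mrestr (P : G -> Prop) x : {malg R[G]} :=
  \sum_(a <- msupp x | `[< P a >]) mkmalgU a x@_a.

Lemma mrestrE P x a : (mrestr P x)@_a = if `[< P a >] then x@_a else 0.
Proof.
rewrite /mrestr mcoeff_sum.
have [xa|xa] := boolP (a \in msupp x); last first.
  rewrite (mcoeff_outdom xa) if_same big1_seq // => b /andP[_ hb].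
  by rewrite mcoeffU; case: eqP => // e; rewrite -e hb in xa.
rewrite big_mkcond (bigD1_seq a _ (fset_uniq _)) //= mcoeffUU big1 ?addr0 // => b nb.
by case: ifP => // _; rewrite mcoeffU (negbTE nb).
Qed.

Lemma mrestr_supp P x a : a \in msupp (mrestr P x) -> a \in msupp x /\ P a.
Proof.
by rewrite !mem_msupp mrestrE; case: asboolP => //; rewrite eqxx.
Qed.

Lemma mrestrC P x : x = mrestr P x + mrestr (fun a => ~ P a) x.
Proof.
apply/malgP => a; rewrite mcoeffD !mrestrE asbool_neg.
by case: asboolP => _ /=; rewrite ?addr0 ?add0r.
Qed.

Lemma malg_ind (Q : {malg R[G]} -> Prop) :
  Q 0 -> (forall x y, Q x -> Q y -> Q (x + y)) ->
  (forall a k, Q (mkmalgU a k)) -> forall x, Q x.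
Proof.
by move=> Q0 QD QU x; rewrite [x]monalgE; elim/big_rec: _ => // a y _; apply: QD.
Qed.

End Malg.

Section Scalars.
Implicit Types (c : kk) (a b : int).

Lemma vpow_inj a b : vpow a = vpow b -> a = b.
Proof.
rewrite /vpow => /(congr1 (mcoeff b)); rewrite !mcoeffU eqxx.
by case: eqP => // _ /eqP; rewrite eq_sym oner_eq0.
Qed.

Lemma bar_kkE c a : (bar_kk c)@_a = c@_(- a).
Proof.
rewrite /bar_kk mcoeff_sum.
have [ca|ca] := boolP (- a \in msupp c); last first.
  rewrite (mcoeff_outdom ca) big1_seq // => b /andP[_ hb].
  by rewrite mcoeffU; case: eqP => // e; rewrite -e opprK hb in ca.
rewrite (bigD1_seq (- a) _ (fset_uniq _)) //= opprK mcoeffUU big1 ?addr0 // => b nb.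
by rewrite mcoeffU eqr_oppLR (negbTE nb).
Qed.

Lemma bar_kkD c1 c2 : bar_kk (c1 + c2) = bar_kk c1 + bar_kk c2.
Proof. by apply/malgP => a; rewrite mcoeffD !bar_kkE mcoeffD. Qed.

Lemma bar_kk0 : bar_kk 0 = 0.
Proof. by apply/malgP => a; rewrite !bar_kkE !mcoeff0. Qed.

Lemma bar_kkU a z : bar_kk (mkmalgU a z) = mkmalgU (- a) z.
Proof. by apply/malgP => b; rewrite bar_kkE !mcoeffU eqr_oppLR. Qed.

Lemma bar_kk_vpow a : bar_kk (vpow a) = vpow (- a).
Proof. exact: bar_kkU. Qed.

Lemma bar_kkM c1 c2 : bar_kk (c1 * c2) = bar_kk c1 * bar_kk c2.
Proof.
move: c1; apply: (@malg_ind int int) => [|x y hx hy|a1 z1].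
- by rewrite mul0r bar_kk0 mul0r.
- by rewrite mulrDl !bar_kkD mulrDl hx hy.
move: c2; apply: (@malg_ind int int) => [|x y hx hy|a2 z2].
- by rewrite mulr0 bar_kk0 mulr0.
- by rewrite mulrDr !bar_kkD mulrDr hx hy.
rewrite !bar_kkU.
change (bar_kk (twmul (trivial_cocycle int int) (mkmalgU a1 z1) (mkmalgU a2 z2)) =
 twmul (trivial_cocycle int int) (mkmalgU (- a1) z1) (mkmalgU (- a2) z2)).
by rewrite !twmulUU bar_kkU opprD.
Qed.

Lemma in_mm0 : in_mm 0.
Proof. by move=> a; rewrite msupp0. Qed.

Lemma in_mmD c1 c2 : in_mm c1 -> in_mm c2 -> in_mm (c1 + c2).
Proof.
move=> h1 h2 a /(fsubsetP (msuppD_le _ _)); rewrite inE => /orP[|]; [exact: h1|exact: h2].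
Qed.

Lemma in_mmN c : in_mm c -> in_mm (- c).
Proof. by move=> h a; rewrite msuppN; apply: h. Qed.

Lemma in_mmM c1 c2 : in_mm c1 -> in_mm c2 -> in_mm (c1 * c2).
Proof.
by move=> h1 h2 a /(@twmul_supp _ _ (trivial_cocycle int int)) [b1 [b2 [/h1 + /h2 + ->]]]; lia.
Qed.

Lemma in_mm_vpow a c : a <= 0 -> in_mm c -> in_mm (vpow a * c).
Proof.
move=> ha hc b /(@twmul_supp _ _ (trivial_cocycle int int)) [b1 [b2 [+ /hc + ->]]].
by move=> /(fsubsetP msuppU_le); rewrite inE => /eqP -> ?; lia.
Qed.

Lemma in_mm_vpow1 a : a < 0 -> in_mm (vpow a).
Proof. by move=> ha b /(fsubsetP msuppU_le); rewrite inE => /eqP ->. Qed.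

Lemma in_mm_bar c : in_mm c -> bar_kk c = c -> c = 0.
Proof.
move=> hc hb; apply/malgP => a; rewrite mcoeff0; apply/eqP; rewrite mcoeff_eq0.
apply/negP => ha; have := hc _ ha.
have : - a \in msupp c by rewrite mem_msupp -bar_kkE hb -mem_msupp.
by move/hc; lia.
Qed.

End Scalars.

(* The operations on [kk] that are needed, kept abstract so that conversion never
   unfolds the concrete group algebra. *)
Record vring := VRing {
  vsort :> comNzRingType;
  vp : int -> vsort;
  vbar : vsort -> vsort;
  vmm : vsort -> Prop;
  vpD : forall a b, vp (a + b) = vp a * vp b;
  vp0 : vp 0 = 1;
  vp_inj : forall a b, vp a = vp b -> a = b;
  vbarD : forall x y, vbar (x + y) = vbar x + vbar y;
  vbarM : forall x y, vbar (x * y) = vbar x * vbar y;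
  vbar_vp : forall a, vbar (vp a) = vp (- a);
  vmm0 : vmm 0;
  vmmD : forall x y, vmm x -> vmm y -> vmm (x + y);
  vmmN : forall x, vmm x -> vmm (- x);
  vmmM : forall x y, vmm x -> vmm y -> vmm (x * y);
  vmm_vp : forall a x, a <= 0 -> vmm x -> vmm (vp a * x);
  vmm_vp1 : forall a, a < 0 -> vmm (vp a);
  vmm_bar : forall x, vmm x -> vbar x = x -> x = 0
}.
Arguments vp {_} _.
Arguments vbar {_} _.
Arguments vmm {_} _.

Definition kk_vring : vring := @VRing kk vpow bar_kk in_mm vpowD vpow0 vpow_inj
  bar_kkD bar_kkM bar_kk_vpow in_mm0 in_mmD in_mmN in_mmM in_mm_vpow in_mm_vpow1
  in_mm_bar.

Section VringTheory.
Variable R : vring.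
Implicit Types x y : R.

Lemma vpNK a : vp (- a) * vp a = 1 :> R.
Proof. by rewrite -vpD addNr vp0. Qed.

Lemma vpKN a : vp a * vp (- a) = 1 :> R.
Proof. by rewrite -vpD addrN vp0. Qed.

Lemma vp_neq0 a : vp a != 0 :> R.
Proof. by apply/eqP => e; have := vpNK a; rewrite e mulr0 => /eqP; rewrite eq_sym oner_eq0. Qed.

Lemma vbar0 : vbar 0 = 0 :> R.
Proof. by apply: (addrI (vbar 0)); rewrite -vbarD !addr0. Qed.

Lemma vbar1 : vbar 1 = 1 :> R.
Proof. by rewrite -vp0 vbar_vp oppr0. Qed.

Lemma vbarN x : vbar (- x) = - vbar x.
Proof. by apply/eqP; rewrite -addr_eq0 -vbarD addNr vbar0. Qed.

Lemma vbar_sum I (r : seq I) (f : I -> R) :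
  vbar (\sum_(i <- r) f i) = \sum_(i <- r) vbar (f i).
Proof. by rewrite (big_morph _ (@vbarD R) vbar0). Qed.

Lemma vmm_sum (I : eqType) (r : seq I) (P : pred I) (f : I -> R) :
  (forall i, i \in r -> P i -> vmm (f i)) -> vmm (\sum_(i <- r | P i) f i).
Proof.
rewrite big_seq_cond => H; elim/big_ind: _; [exact: vmm0|exact: vmmD|].
by move=> i /andP[]; apply: H.
Qed.

End VringTheory.

Lemma eq_scale {R : pzRingType} {V : lmodType R} (a b : R) (x y : V) : a = b -> x = y -> a *: x = b *: y.
Proof. by move=> -> ->. Qed.

Section Eval.
Context {R : comNzRingType} {K : unitAlgType R} {G : zmodType}.
Implicit Types (E P : G -> K) (c x y : {malg R[G]}).

Definition ev E c : K := \sum_(a <- msupp c) c@_a *: E a.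

Lemma evw E (d : {fset G}) c : (msupp c `<=` d)%fset -> ev E c = \sum_(a <- d) c@_a *: E a.
Proof.
move=> h; rewrite /ev (big_fset_incl _ h) // => a _ /mcoeff_outdom ->.
by rewrite scale0r.
Qed.

Lemma evD E x y : ev E (x + y) = ev E x + ev E y.
Proof.
rewrite (evw E (msuppD_le x y)) (evw E (fsubsetUl (msupp x) (msupp y))).
rewrite (evw E (fsubsetUr (msupp x) (msupp y))) -big_split /=.
by apply: eq_bigr => a _; rewrite mcoeffD scalerDl.
Qed.

Lemma ev0 E : ev E 0 = 0.
Proof. by rewrite /ev msupp0 big_seq_fset0. Qed.

Lemma evZ E k c : ev E (k *: c) = k *: ev E c.
Proof.
rewrite (evw E (msuppZ_le k c)) /ev scaler_sumr; apply: eq_bigr => a _.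
by rewrite mcoeffZ scalerA.
Qed.

Lemma evN E c : ev E (- c) = - ev E c.
Proof. by apply/eqP; rewrite -addr_eq0 -evD addNr ev0. Qed.

Lemma evB E x y : ev E (x - y) = ev E x - ev E y.
Proof. by rewrite evD evN. Qed.

Lemma evU E a k : ev E (mkmalgU a k) = k *: E a.
Proof. by rewrite (evw E msuppU_le) big_seq_fset1 mcoeffUU. Qed.

Lemma ev_sum E I (r : seq I) (Q : pred I) (f : I -> {malg R[G]}) :
  ev E (\sum_(i <- r | Q i) f i) = \sum_(i <- r | Q i) ev E (f i).
Proof. by rewrite (big_morph _ (evD E) (ev0 E)). Qed.

Lemma eq_ev E P c : (forall a, a \in msupp c -> E a = P a) -> ev E c = ev P c.
Proof. by move=> h; rewrite /ev big_seq [RHS]big_seq; apply: eq_bigr => a /h ->. Qed.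

End Eval.

Lemma ev_lin {R : comNzRingType} {G : zmodType} {K K' : unitAlgType R} (f : K -> K') (E : G -> K) c :
  linear f -> f (ev E c) = ev (f \o E) c.
Proof.
move=> lf; have f0 : f 0 = 0.
  by have := lf (-1) 0 0; rewrite scaler0 addr0 scaleN1r addNr.
have fD : {morph f : x y / x + y} by move=> x y; have := lf 1 x y; rewrite !scale1r.
have fZ k x : f (k *: x) = k *: f x by have := lf k x 0; rewrite !addr0 f0 addr0.
rewrite /ev (big_morph f fD f0); apply: eq_bigr => a _; exact: fZ.
Qed.

Definition altform {G : zmodType} (lm : G -> G -> int) : Prop :=
  (forall a b c, lm (a + b) c = lm a c + lm b c) /\ (forall a b, lm b a = - lm a b).

(* All seeds are compared inside one skew-field K: a seed is recorded by the map
   m |-> X^m, from which Laurent polynomials c are evaluated by [ev]. *)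
Definition frame {R : vring} {K : unitAlgType R} {G : zmodType} (lm : G -> G -> int) (E : G -> K) :=
  [/\ E 0 = 1, forall a b, E a * E b = vp (lm a b) *: E (a + b)
    & forall c, ev E c = 0 -> c = 0].

(** The last condition excludes lines, so that b - a in C is a partial order on degrees and leading
    degrees are unique. *)
Definition pointed_cone {G : zmodType} (C : G -> Prop) : Prop :=
  [/\ C 0, forall a b, C a -> C b -> C (a + b) & forall a, C a -> C (- a) -> a = 0].

(** * Frames and pointed elements *)

Section Pointed.
Context {R : vring} {K : unitAlgType R} {G : zmodType}.
Implicit Types (E P : G -> K) (C : G -> Prop) (x y z : K) (c : {malg R[G]}).

Definition laurent E x : Prop := exists c, x = ev E c.

(* Degrees of x lie in g + C; the leading coefficient is nonzero for [pn], one for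
   [pt].  The dominance order is C = [dom_cone t]; other cones serve to compare
   leading terms for other orders. *)
Definition pn E C g x : Prop :=
  exists c, [/\ x = ev E c, c@_g != 0 & forall a, a \in msupp c -> C (a - g)].

Definition pt E C g x : Prop :=
  exists c, [/\ x = ev E c, c@_g = 1 & forall a, a \in msupp c -> C (a - g)].

Definition barinv E x : Prop :=
  exists c, x = ev E c /\ forall a, vbar c@_a = c@_a.

Lemma pt_lp E C g x : pt E C g x -> laurent E x.
Proof. by case=> c [-> _ _]; exists c. Qed.

Lemma pt_pn E C g x : pt E C g x -> pn E C g x.
Proof. by case=> c [-> c1 h]; exists c; split=> //; rewrite c1 oner_eq0. Qed.

Lemma pt_sub E C C' g x : (forall a, C a -> C' a) -> pt E C g x -> pt E C' g x.
Proof. by move=> s [c [-> c1 h]]; exists c; split=> // a /h/s. Qed.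

Lemma pt_mon E C g : C 0 -> pt E C g (E g).
Proof.
move=> C0; exists (mkmalgU g 1); split; rewrite ?evU ?scale1r ?mcoeffUU //.
by move=> a /(fsubsetP msuppU_le); rewrite inE => /eqP ->; rewrite subrr.
Qed.

Lemma lpU E g : laurent E (E g).
Proof. by exists (mkmalgU g 1); rewrite evU scale1r. Qed.

Lemma lpD E x y : laurent E x -> laurent E y -> laurent E (x + y).
Proof. by move=> [a ->] [b ->]; exists (a + b); rewrite evD. Qed.

Lemma lpZ E k x : laurent E x -> laurent E (k *: x).
Proof. by move=> [a ->]; exists (k *: a); rewrite evZ. Qed.

Lemma lp0 E : laurent E 0. Proof. by exists 0; rewrite ev0. Qed.

Lemma lpN E x : laurent E x -> laurent E (- x).
Proof. by rewrite -scaleN1r; apply: lpZ. Qed.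

Lemma lpB E x y : laurent E x -> laurent E y -> laurent E (x - y).
Proof. by move=> hx /lpN; apply: lpD. Qed.

Lemma lp_ev E P c : (forall a, a \in msupp c -> laurent E (P a)) -> laurent E (ev P c).
Proof.
move=> h; rewrite /ev big_seq; elim/big_ind: _; [exact: lp0|exact: lpD|].
by move=> a /h; apply: lpZ.
Qed.

Lemma maximal_ex (T : eqType) (s : seq T) (Q : T -> Prop) (Rl : T -> T -> Prop) :
  (forall a b d, Rl a b -> Rl b d -> Rl a d) -> (forall a b, Rl a b -> Rl b a -> a = b) ->
  (exists2 a, a \in s & Q a) ->
  exists a, [/\ a \in s, Q a & forall b, b \in s -> Q b -> Rl a b -> b = a].
Proof.
move=> tr asym; elim: s => [[] //|a s IH] ex.
have [[b bs Qb]|nex] := pselect (exists2 b, b \in s & Q b); last first.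
  case: ex => b; rewrite inE => /orP[/eqP -> Qa|bs Qb]; last by case: nex; exists b.
  exists a; split; rewrite ?mem_head // => d; rewrite inE => /orP[/eqP //|ds Qd].
  by case: nex; exists d.
have [|m [ms Qm hm]] := IH; first by exists b.
have [[Qa Rma]|na] := pselect (Q a /\ Rl m a); last first.
  exists m; split=> //; first by rewrite inE ms orbT.
  move=> d; rewrite inE => /orP[/eqP -> Qa Rma|]; [by case: na|exact: hm].
exists a; split; rewrite ?mem_head // => d; rewrite inE => /orP[/eqP //|ds Qd Rad].
by have e := hm _ ds Qd (tr _ _ _ Rma Rad); subst d; apply: asym.
Qed.

Lemma ev_coef E P c (p : G -> {malg R[G]}) :
  (forall a, a \in msupp c -> P a = ev E (p a)) ->
  ev P c = ev E (\sum_(a <- msupp c) c@_a *: p a).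
Proof.
move=> h; rewrite ev_sum {1}/ev big_seq [RHS]big_seq; apply: eq_bigr => a ha.
by rewrite h // evZ.
Qed.

End Pointed.

Section FrameTheory.
Context {R : vring} {K : unitAlgType R} {G : zmodType} (lm : G -> G -> int) (E : G -> K).
Hypothesis Ksf : forall z : K, z != 0 -> z \is a GRing.unit.
Hypothesis lmA : altform lm.
Hypothesis fE : frame lm E.
Implicit Types (C : G -> Prop) (x y z : K) (c b : {malg R[G]}) (a g h : G).

Let E0 : E 0 = 1. Proof. by case: fE. Qed.
Let EM a (b : G) : E a * E b = vp (lm a b) *: E (a + b). Proof. by case: fE. Qed.

Lemma lmDl a (b d : G) : lm (a + b) d = lm a d + lm b d. Proof. by case: lmA. Qed.
Lemma lmC a (b : G) : lm b a = - lm a b. Proof. by case: lmA. Qed.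
Lemma lm0l a : lm 0 a = 0.
Proof. by have := lmDl 0 0 a; rewrite addr0 => /eqP; rewrite -subr_eq0 opprD addNKr oppr_eq0 => /eqP. Qed.
Lemma lmNl a (b : G) : lm (- a) b = - lm a b.
Proof. by apply/eqP; rewrite -addr_eq0 -lmDl addNr lm0l. Qed.
Lemma lmNr a (b : G) : lm a (- b) = - lm a b. Proof. by rewrite lmC lmNl -lmC. Qed.
Lemma lmxx a : lm a a = 0.
Proof. by have := lmC a a; lia. Qed.

Lemma ev_inj c1 c2 : ev E c1 = ev E c2 -> c1 = c2.
Proof.
move=> e; apply/eqP; rewrite -subr_eq0; apply/eqP.
by case: fE => _ _; apply; rewrite evB e subrr.
Qed.

Definition tm c1 c2 : {malg R[G]} := twmul (fun a d => vp (lm a d)) c1 c2.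

Lemma evM c1 c2 : ev E c1 * ev E c2 = ev E (tm c1 c2).
Proof.
rewrite /tm /twmul ev_sum {1}/ev mulr_suml; apply: eq_bigr => a _.
rewrite ev_sum {1}/ev mulr_sumr; apply: eq_bigr => b _.
rewrite (evU E) -(scalerAl c1@_a) -(scalerAr c2@_b) EM.
rewrite (scalerA c2@_b) (scalerA c1@_a); apply: eq_scale => //.
by rewrite mulrA [RHS]mulrC.
Qed.

Lemma lpM x y : laurent E x -> laurent E y -> laurent E (x * y).
Proof. by move=> [c1 ->] [c2 ->]; exists (tm c1 c2); rewrite evM. Qed.

Lemma lp1 : laurent E 1. Proof. by rewrite -E0; apply: lpU. Qed.

Lemma scal_unit (k : R) : k != 0 -> (k *: (1 : K)) \is a GRing.unit.
Proof.
move=> k0; apply: Ksf; apply: contra_neq k0; rewrite -E0 -(evU E).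
by case: fE => _ _ inj /inj /eqP; rewrite monalgU_eq0 => /eqP.
Qed.

Lemma scal_eq0 (k : R) x : k *: x = 0 -> k = 0 \/ x = 0.
Proof.
move=> e; have [->|k0] := eqVneq k 0; [by left|right].
have u := scal_unit k0.
by apply: (mulrI u); rewrite mulr0 -scalerAl mul1r.
Qed.

Lemma scal_inj (k1 k2 : R) x : x != 0 -> k1 *: x = k2 *: x -> k1 = k2.
Proof.
move=> x0 /eqP; rewrite -subr_eq0 -scalerBl => /eqP /scal_eq0 [/eqP|].
  by rewrite subr_eq0 => /eqP.
by move/eqP: x0.
Qed.

(** Nonzero scalars act on the skew-field K through invertible multiples of 1, so R has no zero
    divisors. *)
Lemma kk_domain (k1 k2 : R) : k1 != 0 -> k2 != 0 -> k1 * k2 != 0.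
Proof.
move=> h1 h2; apply/eqP => e.
have : (k1 *: (1 : K)) * (k2 *: 1) \is a GRing.unit.
  by rewrite unitrMl ?scal_unit.
by rewrite -scalerAl -scalerAr mulr1 scalerA e scale0r unitr0.
Qed.

Lemma K_domain x y : x != 0 -> y != 0 -> x * y != 0.
Proof.
move=> hx hy; apply/eqP => e.
have : x * y \is a GRing.unit by rewrite unitrMl ?Ksf.
by rewrite e unitr0.
Qed.

Lemma E_neq0 a : E a != 0.
Proof.
apply/eqP; rewrite -[E a]scale1r -(evU E) => e.
by case: fE => _ _ /(_ _ e) /eqP; rewrite monalgU_eq0 oner_eq0.
Qed.

Lemma E_unit a : E a \is a GRing.unit.
Proof. exact/Ksf/E_neq0. Qed.

Lemma E_comm a (b : G) : E a * E b = vp (2 * lm a b) *: (E b * E a).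
Proof.
rewrite !EM scalerA -vpD [b + a]addrC; apply: eq_scale => //; congr vp.
by rewrite (lmC a b); ring.
Qed.

Lemma E_add a (b : G) : E (a + b) = vp (- lm a b) *: (E a * E b).
Proof. by rewrite EM scalerA -vpD addNr vp0 scale1r. Qed.

Lemma vpow_scale_inj (e1 e2 : int) x : x != 0 -> vp e1 *: x = vp e2 *: x -> e1 = e2.
Proof. by move=> x0 /(scal_inj x0)/vp_inj. Qed.

Lemma pn_neq0 C g x : pn E C g x -> x != 0.
Proof.
case=> c [-> c0 _]; apply/eqP; case: fE => _ _ inj /inj e.
by rewrite e mcoeff0 eqxx in c0.
Qed.

Lemma pn_uniq C g h x : pointed_cone C -> pn E C g x -> pn E C h x -> g = h.
Proof.
case=> _ _ Ca [c1 [-> c1g h1]] [c2 [/ev_inj <- c1h h2]].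
apply/eqP; rewrite -subr_eq0; apply/eqP/Ca; last rewrite opprB.
  by apply: h2; rewrite mem_msupp.
by apply: h1; rewrite mem_msupp.
Qed.

Lemma pt_uniq C g h x : pointed_cone C -> pt E C g x -> pt E C h x -> g = h.
Proof. by move=> hC /pt_pn h1 /pt_pn h2; apply: pn_uniq h1 h2. Qed.

Lemma cone_lead C g h c1 c2 : pointed_cone C ->
  (forall a, a \in msupp c1 -> C (a - g)) -> (forall a, a \in msupp c2 -> C (a - h)) ->
  (tm c1 c2)@_(g + h) = vp (lm g h) * (c1@_g * c2@_h) /\
  forall a, a \in msupp (tm c1 c2) -> C (a - (g + h)).
Proof.
case=> C0 CD Ca h1 h2; split.
  apply: twmul_lead => a b /h1 ca /h2 cb e; apply/eqP; rewrite -subr_eq0.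
  have {}e : b - h = - (a - g).
    by apply/eqP; rewrite -addr_eq0 addrACA -opprD [b + a]addrC e [h + g]addrC subrr.
  by apply/eqP/Ca; rewrite -?e.
move=> w /twmul_supp [a [b [/h1 ca /h2 cb ->]]].
by rewrite opprD addrACA; apply: CD.
Qed.

Lemma pnM C g h x y : pointed_cone C -> pn E C g x -> pn E C h y -> pn E C (g + h) (x * y).
Proof.
move=> hC [c1 [-> n1 h1]] [c2 [-> n2 h2]]; exists (tm c1 c2).
have [e s] := cone_lead hC h1 h2; split=> //; rewrite ?evM // e.
by apply: kk_domain; [exact: vp_neq0|exact: kk_domain].
Qed.

Lemma ptM C g h x y : pointed_cone C -> pt E C g x -> pt E C h y ->
  pt E C (g + h) (vp (- lm g h) *: (x * y)).
Proof.
move=> hC [c1 [-> n1 h1]] [c2 [-> n2 h2]]; exists (vp (- lm g h) *: tm c1 c2).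
have [e s] := cone_lead hC h1 h2; split; rewrite ?evZ ?evM //.
  by rewrite mcoeffZ e n1 n2 !mulr1 vpNK.
by move=> a /(fsubsetP (msuppZ_le _ _)) /s.
Qed.

Lemma pnZ C g k x : k != 0 -> pn E C g x -> pn E C g (k *: x).
Proof.
move=> k0 [c [-> n s]]; exists (k *: c); split; rewrite ?evZ // ?mcoeffZ ?kk_domain //.
by move=> a /(fsubsetP (msuppZ_le _ _)) /s.
Qed.

Lemma ptD C g h x y : pointed_cone C -> g <> h -> C (h - g) -> forall k,
  pt E C g x -> pt E C h y -> pt E C g (x + k *: y).
Proof.
case=> C0 CD Ca ngh Cgh k [c1 [-> n1 h1]] [c2 [-> n2 h2]]; exists (c1 + k *: c2).
split; first by rewrite evD evZ.
  rewrite mcoeffD mcoeffZ n1 [c2@_g]mcoeff_outdom ?mulr0 ?addr0 //.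
  apply/negP => /h2 cg; case: ngh; apply/eqP; rewrite -subr_eq0; apply/eqP.
  by apply: Ca; rewrite // opprB.
move=> a /(fsubsetP (msuppD_le _ _)); rewrite inE => /orP[/h1 //|].
move=> /(fsubsetP (msuppZ_le _ _)) /h2 ca.
by rewrite -[a](subrK h) -addrA; apply: CD.
Qed.

(* A finite combination of pointed elements of distinct degrees: among the
   "bad" degrees (an up-closed family), a maximal one survives. *)
Lemma surviving C (P : G -> K) (dl : G -> G) (Bad : G -> Prop) c : pointed_cone C ->
  (forall m, pt E C (dl m) (P m)) -> injective dl ->
  (forall m m', Bad m -> C (dl m - dl m') -> Bad m') ->
  (exists2 m, m \in msupp c & Bad m) ->
  exists m b, [/\ m \in msupp c, Bad m, ev P c = ev E b & b@_(dl m) = c@_m].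
Proof.
case=> C0 CD Ca hP dli up ex.
have tr a d e : C (dl a - dl d) -> C (dl d - dl e) -> C (dl a - dl e).
  by move=> h1 h2; rewrite -[dl a](subrK (dl d)) -addrA; apply: CD.
have asym a d : C (dl a - dl d) -> C (dl d - dl a) -> a = d.
  move=> h1 h2; apply: dli; apply/eqP; rewrite -subr_eq0; apply/eqP/Ca => //.
  by rewrite opprB.
have [m [ms mb mmax]] := @maximal_ex _ (msupp c) Bad _ tr asym ex.
have /choice [p hp] : forall a, exists b : {malg R[G]}, [/\ P a = ev E b, b@_(dl a) = 1 &
   forall d, d \in msupp b -> C (d - dl a)] by move=> a; apply: hP.
exists m, (\sum_(a <- msupp c) c@_a *: p a); split=> //.
  by apply: ev_coef => a _; case: (hp a).
rewrite mcoeff_sum (bigD1_seq m _ (fset_uniq _)) //= mcoeffZ.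
have [_ -> _] := hp m; rewrite mulr1 big1_seq ?addr0 // => a /andP[nam ac].
rewrite mcoeffZ [_@_(dl m)]mcoeff_outdom ?mulr0 //; apply/negP.
have [_ _ h] := hp a; move=> /h ca.
by case/eqP: nam; apply: mmax => //; apply: up ca.
Qed.

Lemma lin_indep C P dl c : pointed_cone C -> (forall m, pt E C (dl m) (P m)) -> injective dl ->
  ev P c = 0 -> c = 0.
Proof.
move=> hC hP dli e0; apply: contrapT => /msupp_ex ex.
have [m [b [ms _ eb bm]]] := @surviving C P dl (fun => True) c hC hP dli (fun _ _ _ _ => I) ex.
move: ms; rewrite mem_msupp -bm.
rewrite e0 in eb; case: fE => _ _ /(_ b (esym eb)) ->.
by rewrite mcoeff0 eqxx.
Qed.

Lemma ev_inj_pt C P dl c1 c2 : pointed_cone C -> (forall m, pt E C (dl m) (P m)) ->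
  injective dl -> ev P c1 = ev P c2 -> c1 = c2.
Proof.
move=> hC hP dli e; apply/eqP; rewrite -subr_eq0; apply/eqP.
by apply: (lin_indep hC hP dli); rewrite evB e subrr.
Qed.

(** Apply [surviving] to the m with dl m outside g + C: a maximal one would put its own degree into
    the support of b. *)
Lemma triang_supp C P dl c b g : pointed_cone C -> (forall m, pt E C (dl m) (P m)) ->
  injective dl -> ev P c = ev E b -> (forall a, a \in msupp b -> C (a - g)) ->
  forall m, m \in msupp c -> C (dl m - g).
Proof.
move=> hC hP dli e hb m ms; apply: contrapT => nC.
have [] := @surviving C P dl (fun m => ~ C (dl m - g)) c hC hP dli.
- move=> m1 m2 n1 c12 c2; apply: n1; case: hC => _ CD _.
  by rewrite -[dl m1](subrK (dl m2)) -addrA; apply: CD.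
- by exists m.
move=> m1 [b1 [ms1 n1 e1 bm]]; apply: n1; apply: hb.
have <- : b1 = b by apply: ev_inj; rewrite -e1 e.
by rewrite mem_msupp bm -mem_msupp.
Qed.

(** By [triang_supp] and antisymmetry of the order, no P a other than P m reaches the degree dl
    m. *)
Lemma triang_coef C P dl c b m : pointed_cone C -> (forall m, pt E C (dl m) (P m)) ->
  injective dl -> ev P c = ev E b -> (forall a, a \in msupp b -> C (a - dl m)) ->
  b@_(dl m) = c@_m.
Proof.
move=> hC hP dli e hb.
have hs := triang_supp hC hP dli e hb.
have /choice [p hp] : forall a, exists b : {malg R[G]}, [/\ P a = ev E b, b@_(dl a) = 1 &
   forall d, d \in msupp b -> C (d - dl a)] by move=> a; apply: hP.
have eb : b = \sum_(a <- msupp c) c@_a *: p a.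
  apply: ev_inj; rewrite -e; apply: ev_coef => a _; by case: (hp a).
have H a : a \in msupp c -> a != m -> (c@_a *: p a)@_(dl m) = 0.
  move=> ac nam; rewrite mcoeffZ [_@_(dl m)]mcoeff_outdom ?mulr0 //; apply/negP.
  have [_ _ h] := hp a; move=> /h ca.
  case/eqP: nam; apply: dli; apply/eqP; rewrite -subr_eq0; apply/eqP.
  by case: hC => _ _; apply; [exact: hs|rewrite opprB].
rewrite eb mcoeff_sum.
have [mc|mc] := boolP (m \in msupp c).
  rewrite (bigD1_seq m _ (fset_uniq _)) //= mcoeffZ.
  have [_ -> _] := hp m; rewrite mulr1 big1_seq ?addr0 // => a /andP[nam ac].
  exact: H.
rewrite (mcoeff_outdom mc) big1_seq // => a /andP[_ ac]; apply: H => //.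
by apply: contraNneq mc => <-.
Qed.

Lemma lead_ev C P dl c m : pointed_cone C -> (forall m, pt E C (dl m) (P m)) ->
  injective dl -> (forall a, a \in msupp c -> C (dl a - dl m)) ->
  exists b, [/\ ev P c = ev E b, b@_(dl m) = c@_m & forall a, a \in msupp b -> C (a - dl m)].
Proof.
move=> hC hP dli hs.
have /choice [p hp] : forall a, exists b : {malg R[G]}, [/\ P a = ev E b, b@_(dl a) = 1 &
   forall d, d \in msupp b -> C (d - dl a)] by move=> a; apply: hP.
set b := \sum_(a <- msupp c) c@_a *: p a.
have eb : ev P c = ev E b by apply: ev_coef => a _; case: (hp a).
have sb a : a \in msupp b -> C (a - dl m).
  rewrite mem_msupp; apply: contraNP => nC; rewrite /b mcoeff_sum big1_seq //.
  move=> d /andP[_ dc]; rewrite mcoeffZ [_@_a]mcoeff_outdom ?mulr0 //.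
  apply/negP; have [_ _ h] := hp d => /h cad; apply: nC.
  rewrite -[a](subrK (dl d)) -addrA; case: hC => _ CD _; apply: CD => //.
  exact: hs.
by exists b; split=> //; apply: (triang_coef hC hP dli eb sb).
Qed.

Lemma pt_ev C P dl c m : pointed_cone C -> (forall m, pt E C (dl m) (P m)) ->
  injective dl -> c@_m = 1 -> (forall a, a \in msupp c -> C (dl a - dl m)) ->
  pt E C (dl m) (ev P c).
Proof.
by move=> hC hP dli cm hs; have [b [e1 e2 e3]] := lead_ev hC hP dli hs; exists b; rewrite e2.
Qed.

Lemma pn_ev C P dl c m : pointed_cone C -> (forall m, pt E C (dl m) (P m)) ->
  injective dl -> c@_m != 0 -> (forall a, a \in msupp c -> C (dl a - dl m)) ->
  pn E C (dl m) (ev P c).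
Proof.
by move=> hC hP dli cm hs; have [b [e1 e2 e3]] := lead_ev hC hP dli hs; exists b; rewrite e2.
Qed.

(** An offending degree m1 of x that is maximal for the order of C would survive in the product: at
    m1 + g no other pair of degrees contributes, because the partner of any competing degree lies in
    g + C. *)
Lemma pt_divr C g h x y : pointed_cone C -> laurent E x -> pt E C g y -> pn E C h (x * y) ->
  pn E C (h - g) x.
Proof.
move=> hC [c ->] [b [eb b1 sb]] [d [ed d0 sd]].
have ec : tm c b = d by apply: ev_inj; rewrite -evM -eb.
have [C0 CD Ca] := hC.
have tr a1 a2 a3 : C (a1 - a2) -> C (a2 - a3) -> C (a1 - a3).
  by move=> h1 h2; rewrite -[a1](subrK a2) -addrA; apply: CD.
have asym a1 a2 : C (a1 - a2) -> C (a2 - a1) -> a1 = a2.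
  move=> h1 h2; apply/eqP; rewrite -subr_eq0; apply/eqP/Ca => //.
  by rewrite opprB.
have key m : m \in msupp c -> C (m - (h - g)).
  move=> mc; apply: contrapT => nC.
  have [m1 [m1s n1 mx]] := @maximal_ex _ (msupp c) (fun m => ~ C (m - (h - g)))
    (fun a d => C (a - d)) tr asym (ex_intro2 _ _ m mc nC).
  apply: (n1); have <- : m1 + g - h = m1 - (h - g) by rewrite opprB addrA addrAC.
    apply: sd; rewrite -ec mem_msupp /tm twmul_lead.
      by rewrite b1 mulr1 kk_domain ?vp_neq0 // -mem_msupp.
    move=> a' b' a's b's e.
    have e2 : m1 - a' = b' - g.
      by apply/eqP; rewrite subr_eq addrAC -[_ == _]subr_eq opprK -e [b' + a']addrC.
    have Cd : C (m1 - a') by rewrite e2; apply: sb.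
    apply: mx => // ca'; apply: n1.
    by rewrite -[m1](subrK a') -[X in C X]addrA; apply: CD.
exists c; split=> //.
have [+ _] := cone_lead hC key sb.
rewrite subrK ec => e; apply: contraNneq d0 => c0.
by rewrite e c0 mul0r mulr0.
Qed.

Lemma pt_divl C g h x y : pointed_cone C -> laurent E x -> pt E C g y -> pn E C h (y * x) ->
  pn E C (h - g) x.
Proof.
move=> hC [c ->] [b [eb b1 sb]] [d [ed d0 sd]].
have ec : tm b c = d by apply: ev_inj; rewrite -evM -eb.
have [C0 CD Ca] := hC.
have tr a1 a2 a3 : C (a1 - a2) -> C (a2 - a3) -> C (a1 - a3).
  by move=> h1 h2; rewrite -[a1](subrK a2) -addrA; apply: CD.
have asym a1 a2 : C (a1 - a2) -> C (a2 - a1) -> a1 = a2.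
  move=> h1 h2; apply/eqP; rewrite -subr_eq0; apply/eqP/Ca => //.
  by rewrite opprB.
have key m : m \in msupp c -> C (m - (h - g)).
  move=> mc; apply: contrapT => nC.
  have [m1 [m1s n1 mx]] := @maximal_ex _ (msupp c) (fun m => ~ C (m - (h - g)))
    (fun a d => C (a - d)) tr asym (ex_intro2 _ _ m mc nC).
  apply: (n1); have <- : g + m1 - h = m1 - (h - g) by rewrite opprB [g + _]addrC addrA addrAC.
    apply: sd; rewrite -ec mem_msupp /tm twmul_lead.
      by rewrite b1 mul1r kk_domain ?vp_neq0 // -mem_msupp.
    move=> a' b' a's b's e.
    have e2 : m1 - b' = a' - g.
      by apply/eqP; rewrite subr_eq addrAC -[_ == _]subr_eq opprK e [m1 + g]addrC.
    have Cd : C (m1 - b') by rewrite e2; apply: sb.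
    have e3 : b' = m1.
      apply: mx => // ca'; apply: n1.
      by rewrite -[m1](subrK b') -[X in C X]addrA; apply: CD.
    by move: e; rewrite e3 => /addIr.
exists c; split=> //.
have [+ _] := cone_lead hC sb key.
rewrite [g + _]addrC subrK ec => e; apply: contraNneq d0 => c0.
by rewrite e c0 !mulr0.
Qed.

Definition barm c : {malg R[G]} := \sum_(a <- msupp c) mkmalgU a (vbar c@_a).

Lemma barmE c a : (barm c)@_a = vbar c@_a.
Proof.
rewrite /barm mcoeff_sum.
have [ca|ca] := boolP (a \in msupp c); last first.
  rewrite (mcoeff_outdom ca) vbar0 big1_seq // => b /andP[_ hb].
  by rewrite mcoeffU; case: eqP => // e; rewrite -e hb in ca.
rewrite (bigD1_seq a _ (fset_uniq _)) //= mcoeffUU big1 ?addr0 // => b nb.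
by rewrite mcoeffU (negbTE nb).
Qed.

Lemma barmP c : (forall a, vbar c@_a = c@_a) <-> barm c = c.
Proof.
by split=> [h|h a]; [apply/malgP => a; rewrite barmE|rewrite -barmE h].
Qed.

Lemma barm_tm c1 c2 : barm (tm c1 c2) = tm (barm c2) (barm c1).
Proof.
have bD (x y : {malg R[G]}) : barm (x + y) = barm x + barm y.
  by apply/malgP => a; rewrite mcoeffD !barmE mcoeffD vbarD.
have b0 : barm 0 = 0 by apply/malgP => a; rewrite barmE !mcoeff0 vbar0.
have bU a k : barm (mkmalgU a k) = mkmalgU a (vbar k).
  by apply/malgP => b; rewrite barmE !mcoeffU; case: eqP => _; rewrite ?vbar0.
rewrite /tm; move: c1; apply: (@malg_ind R G) => [|x y hx hy|a1 z1].
- by rewrite twmul0g b0 twmulg0.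
- by rewrite twmulDl !bD twmulDr hx hy.
move: c2; apply: (@malg_ind R G) => [|x y hx hy|a2 z2].
- by rewrite twmulg0 b0 twmul0g.
- by rewrite twmulDr !bD twmulDl hx hy.
rewrite twmulUU !bU twmulUU [a1 + a2]addrC !vbarM vbar_vp (lmC a1 a2).
by rewrite [vbar z1 * _]mulrC.
Qed.

(** The bar involution reverses products, so it sends v^-e x y to v^e y x, and quasi-commutation
    identifies the two. *)
Lemma barinvM (e : int) x y : barinv E x -> barinv E y ->
  x * y = vp (2 * e) *: (y * x) -> barinv E (vp (- e) *: (x * y)).
Proof.
move=> [c1 [-> /barmP b1]] [c2 [-> /barmP b2]]; rewrite !evM -!evZ => /ev_inj h.
exists (vp (- e) *: tm c1 c2); split=> // a.
rewrite mcoeffZ vbarM vbar_vp opprK -barmE barm_tm b1 b2 h mcoeffZ mulrA -vpD.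
by congr (_ * _); congr vp; ring.
Qed.

Lemma barinvX x n : barinv E x -> barinv E (x ^+ n).
Proof.
move=> bx; elim: n => [|n IH].
  exists (mkmalgU 0 1); split; first by rewrite evU E0 scale1r.
  by move=> a; rewrite mcoeffU; case: eqP => _; rewrite ?vbar1 ?vbar0.
have := @barinvM 0 x (x ^+ n) bx IH.
rewrite oppr0 mulr0 !vp0 !scale1r -exprS; apply.
by rewrite -exprSr.
Qed.

Lemma barinvU a : barinv E (E a).
Proof.
exists (mkmalgU a 1); split; first by rewrite evU scale1r.
by move=> b; rewrite mcoeffU; case: eqP => _; rewrite ?vbar1 ?vbar0.
Qed.

Lemma barinvD x y : barinv E x -> barinv E y -> barinv E (x + y).
Proof.
move=> [c1 [-> b1]] [c2 [-> b2]]; exists (c1 + c2); split; first by rewrite evD.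
by move=> a; rewrite mcoeffD vbarD b1 b2.
Qed.

(** Conjugating the coefficients of an expansion in bar-invariant pointed elements conjugates its
    value, and such expansions are unique. Bar-invariance can thus be read in any such basis. *)
Lemma barinv_coord C P dl c : pointed_cone C -> (forall m, pt E C (dl m) (P m)) ->
  injective dl -> (forall m, barinv E (P m)) ->
  (barinv E (ev P c) <-> forall a, vbar c@_a = c@_a).
Proof.
move=> hC hP dli bP.
have /choice [p hp] : forall m, exists b, P m = ev E b /\ forall a, vbar b@_a = b@_a.
  by move=> m; apply: bP.
have e1 c' : ev P c' = ev E (\sum_(a <- msupp c') c'@_a *: p a).
  by apply: ev_coef => a _; case: (hp a).
have sub : (msupp (barm c) `<=` msupp c)%fset.
  apply/fsubsetP => a; rewrite !mem_msupp barmE; apply: contraNneq => ->.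
  by rewrite vbar0.
split=> [[b [eb bb]]|bc].
  apply/barmP; apply: (ev_inj_pt hC hP dli).
  have eb2 : b = \sum_(a <- msupp c) c@_a *: p a by apply: ev_inj; rewrite -eb e1.
  have -> : ev P (barm c) = ev E (\sum_(a <- msupp c) (barm c)@_a *: p a).
    rewrite (evw _ sub) ev_sum; apply: eq_bigr => a _.
    by rewrite evZ; case: (hp a) => ->.
  rewrite eb; congr ev; apply/malgP => m.
  rewrite -(bb m) eb2 !mcoeff_sum vbar_sum; apply: eq_bigr => a _.
  by rewrite !mcoeffZ vbarM barmE; case: (hp a) => _ ->.
exists (\sum_(a <- msupp c) c@_a *: p a); split; first exact: e1.
move=> m; rewrite !mcoeff_sum vbar_sum; apply: eq_bigr => a _.
by rewrite !mcoeffZ vbarM bc; case: (hp a) => _ ->.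
Qed.

End FrameTheory.

Lemma posp_ge0 x : 0 <= posp x. Proof. by rewrite /posp; lia. Qed.
Lemma pospN x : posp (- x) = posp x - x. Proof. by rewrite /posp; lia. Qed.
Lemma posp0 : posp 0 = 0. Proof. by []. Qed.
Lemma posp_pmul (a b x y : int) : 0 < a -> 0 < b -> a * x = - (b * y) ->
  a * posp (- x) = b * posp y.
Proof.
move=> ha hb e; rewrite /posp !maxr_pMr ?mulr0 ?ltW //.
by rewrite mulrN e opprK.
Qed.

(** * Seeds, tropical maps and their isometry properties *)

Section Seeds.
Context {nu nf : nat}.
Notation G := 'cV[int]_(nu + nf).
Implicit Types (t : qseed nu nf) (k : 'I_nu) (g m : G) (n : 'cV[int]_nu).

Lemma fbE (i j : 'I_(nu + nf)) : (fb i : G) j 0 = (j == i)%:R.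
Proof. by rewrite /fb mxE eqxx andbT. Qed.

Lemma cvD {p} (a b : 'cV[int]_p) i : (a + b) i 0 = a i 0 + b i 0. Proof. by rewrite mxE. Qed.
Lemma cvN {p} (a : 'cV[int]_p) i : (- a) i 0 = - a i 0. Proof. by rewrite mxE. Qed.
Lemma cvZ {p} c (a : 'cV[int]_p) i : (c *: a) i 0 = c * a i 0. Proof. by rewrite mxE. Qed.

Lemma uf_inj : injective (@uf nu nf).
Proof. exact: lshift_inj. Qed.

Lemma uf_eq k j : (uf nf k == uf nf j) = (k == j).
Proof. exact: (inj_eq uf_inj). Qed.

Lemma sum_fb m : m = \sum_i m i 0 *: fb i.
Proof.
apply/colP => i; rewrite summxE (bigD1 i) //= mxE fbE eqxx mulr1 big1 ?addr0 //.
by move=> j nj; rewrite mxE fbE eq_sym (negbTE nj) mulr0.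
Qed.

Lemma cV_ind (S : G -> Prop) (Q : pred 'I_(nu + nf)) :
  S 0 -> (forall a b, S a -> S b -> S (a + b)) -> (forall a, S a -> S (- a)) ->
  (forall i, Q i -> S (fb i)) -> forall m, (forall i, ~~ Q i -> m i 0 = 0) -> S m.
Proof.
move=> S0 SD SN SF m hm; rewrite [m]sum_fb; elim/big_ind: _ => // i _.
have [Qi|nQ] := boolP (Q i); last by rewrite hm // scale0r.
have H (p : nat) : S (p%:Z *: fb i).
  elim: p => [|p IH]; first by rewrite scale0r.
  by rewrite intS scalerDl scale1r; apply: SD => //; apply: SF.
case: (m i 0) => p; first exact: H.
by rewrite NegzE scaleNr; apply/SN/H.
Qed.

Lemma lamZl t (a : int) m m' : lam t (a *: m) m' = a * lam t m m'.
Proof. by rewrite /lam linearZ -!scalemxAl mxE. Qed.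

Lemma lamZr t (a : int) m m' : lam t m (a *: m') = a * lam t m m'.
Proof. by rewrite /lam -scalemxAr mxE. Qed.

Lemma lam_sumr t I (r : seq I) (f : I -> G) m :
  lam t m (\sum_(i <- r) f i) = \sum_(i <- r) lam t m (f i).
Proof. by rewrite (big_morph _ (lamDr t m) (lam0r t m)). Qed.

Lemma lam_suml t I (r : seq I) (f : I -> G) m :
  lam t (\sum_(i <- r) f i) m = \sum_(i <- r) lam t (f i) m.
Proof. by rewrite (big_morph (fun x => lam t x m) (fun a b => lamDl t a b m) (lam0l t m)). Qed.

Lemma lam_fb t i j : lam t (fb i) (fb j) = Lam t i j.
Proof. by rewrite /lam /fb trmx_delta -rowE -colE !mxE. Qed.

Lemma sum_delta (f : 'I_nu -> int) k : \sum_j f j * (j == k)%:R = f k.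
Proof.
rewrite (bigD1 k) //= eqxx mulr1 big1 ?addr0 // => j nj.
by rewrite (negbTE nj) mulr0.
Qed.

Definition yk t k : G := Bt t *m delta_mx k 0.
(* Pm is the linear isometry of Lambda-forms from mu_k t to t sending f'_i to
   [fmut t k i], and Fm the corresponding map of Y-degrees. *)
Definition Pm t k m : G := m + m (uf nf k) 0 *: (fmut t k (uf nf k) - fb (uf nf k)).
Definition Fm t k n : 'cV[int]_nu :=
  n + (\sum_j posp (Bt t (uf nf k) j) * n j 0 - 2 * n k 0) *: delta_mx k 0.

Lemma ykE t k i : yk t k i 0 = Bt t i k.
Proof. by rewrite /yk -colE mxE. Qed.

Lemma BmE t n i : (Bt t *m n) i 0 = \sum_j Bt t i j * n j 0.
Proof. by rewrite mxE. Qed.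

Lemma lam_mutate t k m m' : lam (mutate t k) m m' = lam t (Pm t k m) (Pm t k m').
Proof.
have PE x : Pm t k x = \sum_i x i 0 *: fmut t k i.
  rewrite (bigD1 (uf nf k)) //= (eq_bigr (fun i => x i 0 *: fb i)); last first.
    by move=> i ni; rewrite /fmut (negbTE ni).
  rewrite /Pm [X in X + _]sum_fb (bigD1 (uf nf k)) //= scalerBr.
  set s := \sum_(i | _) _; set a := _ *: fb _; set b := _ *: fmut _ _ _.
  by rewrite [a + s]addrC -addrA [a + _]addrC subrK addrC.
rewrite !PE [m in LHS]sum_fb !lam_suml; apply: eq_bigr => i _.
rewrite [m' in LHS]sum_fb !lam_sumr; apply: eq_bigr => j _.
by rewrite !lamZl !lamZr lam_fb mxE.
Qed.

Lemma fmutE t k i : fmut t k (uf nf k) i 0 = - (i == uf nf k)%:R + posp (- Bt t i k).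
Proof.
rewrite /fmut eqxx 2!mxE fbE summxE (bigD1 i) //= mxE fbE eqxx mulr1 big1 ?addr0 //.
by move=> j nj; rewrite mxE fbE eq_sym (negbTE nj) mulr0.
Qed.

Lemma BtmE t k i j : Bt (mutate t k) i j =
  if (i == uf nf k) || (j == k) then - Bt t i j
  else Bt t i j + Bt t i k * posp (Bt t (uf nf k) j) + posp (- Bt t i k) * Bt t (uf nf k) j.
Proof. by rewrite mxE. Qed.

Definition same_side k (g h : G) : Prop :=
  (0 <= g (uf nf k) 0 /\ 0 <= h (uf nf k) 0) \/ (g (uf nf k) 0 <= 0 /\ h (uf nf k) 0 <= 0).

Section Quantum.
Variable t : qseed nu nf.
Hypothesis qt : is_quantum_seed t.

Lemma lam_alt : altform (lam t).
Proof.
split=> [a b c|a b]; first exact: lamDl.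
have [_ _ e _] := qt; rewrite /lam.
have -> : b^T *m Lam t *m a = (a^T *m (Lam t)^T *m b)^T.
  by rewrite !trmx_mul !trmxK mulmxA.
by rewrite mxE e mulmxN mulNmx mxE.
Qed.

Lemma dprime_gt0 k : 0 < dprime t k.
Proof.
have [_ _ _ [d [d0 e]]] := qt; rewrite /dprime e /uf row_mxEl mxE eqxx mulr1n.
exact: d0.
Qed.

(** The compatibility condition in the form used throughout: against B n, the form lambda sees only
    unfrozen coordinates, with positive weights. *)
Lemma lamB n m : lam t (Bt t *m n) m =
  \sum_j dprime t j * n j 0 * m (uf nf j) 0.
Proof.
have [_ _ _ [d [d0 e]]] := qt.
rewrite /lam trmx_mul -!mulmxA [_ *m (_ *m m)]mulmxA e -{1}[m]vsubmxK.
rewrite mul_row_col mul0mx addr0 mul_diag_mx mxE; apply: eq_bigr => j _.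
by rewrite /dprime e /uf row_mxEl !mxE eqxx mulr1n; ring.
Qed.

Lemma lamBr n m : lam t m (Bt t *m n) = - \sum_j dprime t j * n j 0 * m (uf nf j) 0.
Proof. by case: lam_alt => _ ->; rewrite lamB. Qed.

Lemma lam_yk k m : lam t (yk t k) m = dprime t k * m (uf nf k) 0.
Proof.
rewrite lamB (bigD1 k) //= mxE !eqxx mulr1 big1 ?addr0 // => j nj.
by rewrite mxE (negbTE nj) mulr0 mul0r.
Qed.

Lemma lamr_yk k m : lam t m (yk t k) = - (dprime t k * m (uf nf k) 0).
Proof. by case: lam_alt => _ ->; rewrite lam_yk. Qed.

Lemma dB_skew i j : dprime t i * Bt t (uf nf i) j = - (dprime t j * Bt t (uf nf j) i).
Proof. by rewrite -(ykE t j) -lam_yk -(ykE t i) -lam_yk; case: lam_alt => _ ->. Qed.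

Lemma Bkk k : Bt t (uf nf k) k = 0.
Proof.
have := dB_skew k k; set p := _ * _ => e.
have : p = 0 by lia.
by move/eqP; rewrite mulf_eq0 gt_eqF ?dprime_gt0 // => /eqP.
Qed.

Lemma B_inj n : Bt t *m n = 0 -> n = 0.
Proof.
move=> e; apply/colP => j; rewrite mxE.
have := lamB n (fb (uf nf j)); rewrite e lam0l (bigD1 j) //= big1 => [|i ni].
  rewrite fbE eqxx mulr1 addr0 => /esym/eqP.
    by rewrite mulf_eq0 gt_eqF ?dprime_gt0 // => /eqP.
by rewrite fbE uf_eq (negbTE ni) mulr0.
Qed.

Lemma B_inj2 n n' : Bt t *m n = Bt t *m n' -> n = n'.
Proof.
by move=> e; apply/eqP; rewrite -subr_eq0; apply/eqP/B_inj; rewrite mulmxBr e subrr.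
Qed.

Lemma PmE k m i : Pm t k m i 0 =
  if i == uf nf k then - m (uf nf k) 0 else m i 0 + m (uf nf k) 0 * posp (- Bt t i k).
Proof.
rewrite 3!mxE fmutE 2!mxE eqxx andbT; case: eqP => [->|_] /=.
  by rewrite Bkk oppr0 posp0; ring.
by ring.
Qed.

Lemma FmE k n j : Fm t k n j 0 =
  if j == k then \sum_j posp (Bt t (uf nf k) j) * n j 0 - n k 0 else n j 0.
Proof.
rewrite !mxE eqxx andbT; case: eqP => [->|_] /=; last by rewrite mulr0 addr0.
by ring.
Qed.

Lemma PmK k m : Pm t k (Pm t k m) = m.
Proof. by apply/colP => i; rewrite !PmE eqxx; case: eqP => [->|_]; ring. Qed.

Lemma PmD k m m' : Pm t k (m + m') = Pm t k m + Pm t k m'.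
Proof. by apply/colP => i; rewrite [RHS]mxE !PmE !mxE; case: eqP => _; ring. Qed.

Lemma PmZ k (a : int) m : Pm t k (a *: m) = a *: Pm t k m.
Proof. by apply/colP => i; rewrite [RHS]mxE !PmE !mxE; case: eqP => _; ring. Qed.

Lemma Pm_id k m : m (uf nf k) 0 = 0 -> Pm t k m = m.
Proof. by move=> e; rewrite /Pm e scale0r addr0. Qed.

Lemma FmK k n : Fm t k (Fm t k n) = n.
Proof.
apply/colP => j; rewrite !FmE eqxx; case: eqP => [->|//].
have -> : \sum_j posp (Bt t (uf nf k) j) * Fm t k n j 0 = \sum_j posp (Bt t (uf nf k) j) * n j 0.
  apply: eq_bigr => i _; rewrite FmE; case: eqP => // ->.
  by rewrite Bkk posp0 !mul0r.
by ring.
Qed.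

Lemma Pm_Bt k n : Pm t k (Bt (mutate t k) *m n) = Bt t *m Fm t k n.
Proof.
apply/colP => i; rewrite PmE !BmE.
have eF (p : 'I_(nu + nf)) : \sum_j Bt t p j * Fm t k n j 0 =
   \sum_j (Bt t p j + Bt t p k * (posp (Bt t (uf nf k) j) - 2 * (j == k)%:R)) * n j 0.
  set c := \sum_j posp (Bt t (uf nf k) j) * n j 0.
  rewrite (eq_bigr (fun j => Bt t p j * n j 0 + Bt t p j * (c - 2 * n k 0) * (j == k)%:R)); last first.
    by move=> j _; rewrite !mxE eqxx andbT -/c; ring.
  rewrite [RHS](eq_bigr (fun j => Bt t p j * n j 0 + (Bt t p k * (posp (Bt t (uf nf k) j) * n j 0)
     - 2 * Bt t p k * n j 0 * (j == k)%:R))); last by move=> j _; ring.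
  rewrite !big_split /= sumrN -mulr_sumr -/c !sum_delta; ring.
rewrite eF; case: eqP => [->|/eqP nik].
  rewrite -sumrN; apply: eq_bigr => j _.
  by rewrite BtmE eqxx Bkk /=; ring.
rewrite mulr_suml -big_split /=; apply: eq_bigr => j _.
rewrite !BtmE eqxx (negbTE nik) /=; have [->|nj] := eqVneq j k.
  by rewrite Bkk posp0 /=; ring.
by rewrite /=; ring.
Qed.

Lemma dposp k j : dprime t j * posp (- Bt t (uf nf j) k) = dprime t k * posp (Bt t (uf nf k) j).
Proof. by apply: posp_pmul; [exact: dprime_gt0|exact: dprime_gt0|exact: dB_skew]. Qed.

Lemma lamB_mutate k n m : lam (mutate t k) (Bt (mutate t k) *m n) m =
  \sum_j dprime t j * n j 0 * m (uf nf j) 0.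
Proof.
rewrite lam_mutate Pm_Bt lamB (bigD1 k) //= FmE PmE !eqxx.
rewrite [RHS](bigD1 k) //=.
rewrite [X in _ + X = _](eq_bigr (fun j => dprime t j * n j 0 * m (uf nf j) 0 +
   dprime t k * m (uf nf k) 0 * (posp (Bt t (uf nf k) j) * n j 0))); last first.
  move=> j nj; rewrite FmE PmE uf_eq (negbTE nj).
  rewrite mulrDr; congr (_ + _).
  transitivity (dprime t j * posp (- Bt t (uf nf j) k) * (n j 0 * m (uf nf k) 0)).
    by ring.
  by rewrite dposp; ring.
rewrite big_split /= -mulr_sumr [X in _ * (X - _)](bigD1 k) //= Bkk posp0 mul0r add0r.
by ring.
Qed.

(** The compatibility identity implies the other axioms: Lambda followed by D'^-1 is a right inverse
    of B^T over the rationals, and D' B is the matrix of lambda on the columns of B, hence skew. *)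
Lemma quantum_seedI t' (d : 'rV[int]_nu) : (Lam t')^T = - Lam t' ->
  (forall k, 0 < d 0 k) ->
  (forall n m, lam t' (Bt t' *m n) m = \sum_j d 0 j * n j 0 * m (uf nf j) 0) ->
  is_quantum_seed t' /\ forall k, dprime t' k = d 0 k.
Proof.
move=> ls d0 h.
have e : (Bt t')^T *m Lam t' = row_mx (diag_mx d) 0.
  apply/matrixP => j i.
  have -> : ((Bt t')^T *m Lam t') j i = lam t' (Bt t' *m delta_mx j 0) (fb i).
    by rewrite /lam trmx_mul trmx_delta -!mulmxA -rowE -colE !mxE; apply: eq_bigr => p _; rewrite !mxE.
  rewrite h (bigD1 j) //= big1 ?addr0 => [|p np]; last first.
    by rewrite mxE (negbTE np) mulr0 mul0r.
  rewrite mxE !eqxx mulr1 fbE mxE; case: (splitP i) => q eq.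
    rewrite mxE; have -> : i = uf nf q by apply: val_inj.
    by rewrite uf_eq; case: eqP => _; rewrite ?mulr1 ?mulr0 ?mulr1n ?mulr0n.
  have /negbTE -> : uf nf j != i.
    apply/eqP => /(congr1 val) /=; rewrite eq => e2.
    by have := ltn_ord j; rewrite e2; lia.
  by rewrite mulr0 mxE.
have dp k : dprime t' k = d 0 k.
  by rewrite /dprime e /uf row_mxEl mxE eqxx mulr1n.
split=> //; split=> //; last by exists d.
  rewrite -mxrank_tr; apply/eqP; apply/row_freeP.
  exists (map_mx (intr : int -> rat) (Lam t') *m col_mx (diag_mx (\row_j ((d 0 j)%:~R)^-1)) 0).
  have -> : (map_mx (intr : int -> rat) (Bt t'))^T = map_mx intr (Bt t')^T.
    by apply/matrixP => i j; rewrite !mxE.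
  rewrite mulmxA -map_mxM e map_row_mx mul_row_col mulmx0 addr0.
  apply/matrixP => i j; rewrite mul_mx_diag !mxE.
  case: eqP => [->|_]; last by rewrite mulr0n mul0r.
  by rewrite mulr1n mulfV // intr_eq0 gt_eqF.
exists (fun i => d 0 i); split=> // i j.
have E p q : d 0 p * Bsq t' p q = lam t' (Bt t' *m delta_mx p 0) (Bt t' *m delta_mx q 0).
  rewrite h (bigD1 p) //= mxE !eqxx mulr1 big1 ?addr0 => [|s ns]; last first.
    by rewrite mxE (negbTE ns) mulr0 mul0r.
  by rewrite -/(yk t' q) ykE.
rewrite !E /lam.
set u := Bt t' *m _; set w := Bt t' *m _.
have -> : u^T *m Lam t' *m w = (w^T *m (Lam t')^T *m u)^T.
  by rewrite !trmx_mul !trmxK mulmxA.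
by rewrite mxE ls mulmxN mulNmx mxE.
Qed.

Lemma Lam_skew_alt t' : (forall m m', lam t' m m' = - lam t' m' m) -> (Lam t')^T = - Lam t'.
Proof. by move=> h; apply/matrixP => i j; rewrite 2!mxE -!lam_fb h. Qed.

Lemma mutate_quantum k : is_quantum_seed (mutate t k) /\
  forall j, dprime (mutate t k) j = dprime t j.
Proof.
have h1 : (Lam (mutate t k))^T = - Lam (mutate t k).
  by apply: Lam_skew_alt => m m'; rewrite !lam_mutate; case: lam_alt => _ ->.
have h2 j : 0 < (\row_j dprime t j) 0 j by rewrite mxE dprime_gt0.
have [|q e] := @quantum_seedI (mutate t k) (\row_j dprime t j) h1 h2.
  by move=> n m; rewrite lamB_mutate; apply: eq_bigr => j _; rewrite mxE.
by split=> // j; rewrite e mxE.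
Qed.

Lemma mutateK k : mutate (mutate t k) k = t.
Proof.
have B2 : Bt (mutate (mutate t k) k) = Bt t.
  apply/matrixP => i j; rewrite mxE.
  have [->|ni] := eqVneq i (uf nf k); first by rewrite BtmE !eqxx /= opprK.
  have [->|nj] := eqVneq j k; first by rewrite BtmE !eqxx !orbT /= opprK.
  rewrite !BtmE !eqxx (negbTE ni) (negbTE nj) /= opprK !pospN; ring.
have P2 m : Pm (mutate t k) k m = m + m (uf nf k) 0 *: (fmut t k (uf nf k) - fb (uf nf k) + yk t k).
  apply/colP => i; rewrite /Pm.
  have -> : fmut (mutate t k) k (uf nf k) = fmut t k (uf nf k) + yk t k.
    by apply/colP => p; rewrite [RHS]mxE !fmutE ykE BtmE eqxx orbT opprK pospN; ring.
  by rewrite addrAC.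
have yk0 : yk t k (uf nf k) 0 = 0 by rewrite ykE Bkk.
(* The composite of the two linear maps is not the identity but the transvection m + m_k y_k, which
   preserves lambda. *)
have P3 m : Pm t k (Pm (mutate t k) k m) = m + m (uf nf k) 0 *: yk t k.
  by rewrite P2 scalerDr addrA -/(Pm t k m) PmD PmK PmZ (Pm_id yk0).
have L2 m m' : lam (mutate (mutate t k) k) m m' = lam t m m'.
  rewrite !lam_mutate !P3 !(lamDl, lamDr, lamZl, lamZr) !lam_yk !lamr_yk yk0; ring.
have : Lam (mutate (mutate t k) k) = Lam t.
  by apply/matrixP => i j; rewrite -!lam_fb L2.
by move: B2; case: (mutate _ _) => b l /= -> ->; case: t.
Qed.

Lemma Pm_def k m : Pm t k m = m + m (uf nf k) 0 *: (fmut t k (uf nf k) - fb (uf nf k)).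
Proof. by []. Qed.

Opaque Pm Fm.

Lemma yk_k k : yk t k (uf nf k) 0 = 0.
Proof. by rewrite ykE Bkk. Qed.

Lemma yk_mutate k : yk (mutate t k) k = - yk t k.
Proof. by apply/colP => i; rewrite [RHS]mxE !ykE BtmE eqxx orbT. Qed.

Lemma tropE k g : trop t k g = Pm t k g + posp (g (uf nf k) 0) *: yk t k.
Proof.
apply/colP => i; rewrite mxE cvD PmE cvZ ykE.
case: eqP => [->|_]; first by rewrite Bkk; ring.
rewrite -{1}[Bt t i k]opprK (pospN (- _)).
by case: ifP; rewrite /posp; lia.
Qed.

Lemma trop_k k g : trop t k g (uf nf k) 0 = - g (uf nf k) 0.
Proof. by rewrite mxE eqxx. Qed.

Lemma trop_ge0 k g : 0 <= g (uf nf k) 0 -> trop t k g = Pm t k g + g (uf nf k) 0 *: yk t k.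
Proof. by move=> h; rewrite tropE /posp; congr (_ + _ *: _); lia. Qed.

Lemma trop_le0 k g : g (uf nf k) 0 <= 0 -> trop t k g = Pm t k g.
Proof.
move=> h; rewrite tropE (_ : posp _ = 0) ?scale0r ?addr0 //.
by rewrite /posp; lia.
Qed.

Lemma trop_0 k g : g (uf nf k) 0 = 0 -> trop t k g = g.
Proof. by move=> h; rewrite trop_le0 ?h // Pm_id. Qed.

Lemma trop_add k g h : same_side k g h -> trop t k (g + h) = trop t k g + trop t k h.
Proof.
case=> [[h1 h2]|[h1 h2]].
  rewrite !trop_ge0 //; last by rewrite cvD addr_ge0.
  by rewrite PmD cvD scalerDl addrACA.
rewrite !trop_le0 ?PmD //; rewrite cvD; lia.
Qed.

Lemma trop_scale k (a : int) g : 0 <= a -> trop t k (a *: g) = a *: trop t k g.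
Proof.
move=> ha; rewrite !tropE PmZ cvZ [RHS]scalerDr scalerA. congr (_ + _ *: _).
by rewrite /posp maxr_pMr // mulr0.
Qed.

(** Each linear branch is an isometry: one is [Pm], the other [Pm] followed by a transvection along
    y_k. *)
Lemma trop_lam k g h : same_side k g h ->
  lam (mutate t k) (trop t k g) (trop t k h) = lam t g h.
Proof.
have P1 x y : lam (mutate t k) (Pm t k x) (Pm t k y) = lam t x y.
  by rewrite lam_mutate !PmK.
have Y0 x : lam (mutate t k) (yk t k) x = dprime t k * - x (uf nf k) 0.
  by rewrite lam_mutate (Pm_id (yk_k k)) lam_yk PmE eqxx.
have Y1 x : lam (mutate t k) x (yk t k) = - (dprime t k * - x (uf nf k) 0).
  by rewrite lam_mutate (Pm_id (yk_k k)) lamr_yk PmE eqxx.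
case=> [[h1 h2]|[h1 h2]]; last by rewrite !trop_le0.
rewrite !trop_ge0 //; have := P1 g h.
have := PmE k g (uf nf k); have := PmE k h (uf nf k); rewrite eqxx.
move: (Pm t k g) (Pm t k h) => x y ey ex exy.
by rewrite !(lamDl, lamDr, lamZl, lamZr) exy !Y0 !Y1 yk_k ex ey; ring.
Qed.

Lemma Pm_B k n : Pm t k (Bt t *m n) = Bt (mutate t k) *m Fm t k n.
Proof. by rewrite -{1}[n](FmK k) -Pm_Bt PmK. Qed.

(** Dominance survives the tropical map except in the k-th coordinate of n. That coordinate is the
    one left free by [slope_cone] and controlled later by [wall]. *)
Lemma trop_B k g n : exists n' : 'cV[int]_nu,
  trop t k (g + Bt t *m n) = trop t k g + Bt (mutate t k) *m n' /\
  forall j, j != k -> n' j 0 = n j 0.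
Proof.
exists (Fm t k n - (posp ((g + Bt t *m n) (uf nf k) 0) - posp (g (uf nf k) 0)) *: delta_mx k 0).
split.
  rewrite !tropE PmD Pm_B mulmxBr -scalemxAr -/(yk (mutate t k) k) yk_mutate.
  rewrite scalerN opprK scalerBl; set a := _ *: _; set b := _ *: _; set c := _ *m _.
  move: a b c (Pm t k g) => a b c x.
  by rewrite -!addrA; congr (_ + _); rewrite [RHS]addrCA; congr (_ + _); rewrite [RHS]addrC subrK.
by move=> j nj; rewrite [LHS]cvD FmE cvN cvZ [delta_mx _ _ _ _]mxE (negbTE nj) mulr0 subr0.
Qed.

End Quantum.

Lemma trop_mutateK t k g : is_quantum_seed t -> trop (mutate t k) k (trop t k g) = g.
Proof.
move=> qt; have [qt' _] := mutate_quantum qt k.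
have yk0 := yk_k qt k.
rewrite (tropE qt') trop_k (tropE qt) yk_mutate // scalerN.
have P2 m : Pm (mutate t k) k m = Pm t k m + m (uf nf k) 0 *: yk t k.
  apply/colP => i; rewrite (PmE qt') cvD (PmE qt) cvZ ykE BtmE eqxx orbT.
  case: eqP => [->|_]; first by rewrite Bkk //; ring.
  by rewrite opprK -{1}[Bt t i k]opprK (pospN (- _)); ring.
rewrite P2 (PmD qt) (PmZ qt) (PmK qt) (Pm_id t yk0) cvD (PmE qt) cvZ eqxx.
rewrite -[X in X - _]addrA -scalerDl -addrA -scalerBl [X in _ + X *: _](_ : _ = 0) ?scale0r ?addr0 //.
by rewrite yk0 pospN; ring.
Qed.

End Seeds.

Lemma mcoeff_shift {R : comNzRingType} {G : zmodType} (c : {malg R[G]}) (f : G) (l : G -> R) m :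
  (\sum_(a <- msupp c) mkmalgU (a + f) (l a * c@_a))@_(m + f) = l m * c@_m.
Proof.
rewrite mcoeff_sum; have [mc|mc] := boolP (m \in msupp c).
  rewrite (bigD1_seq m mc (fset_uniq _)) /= mcoeffUU big1 ?addr0 // => b nb.
  by rewrite mcoeffU (inj_eq (addIr _)) (negbTE nb).
rewrite (mcoeff_outdom mc) mulr0 big1_seq // => b /andP[_ bc].
by rewrite mcoeffU (inj_eq (addIr _)); case: eqP => // e; rewrite -e bc in mc.
Qed.

(** * Dominance cones and k-strings *)

Section Cones.
Context {nu nf : nat}.
Notation G := 'cV[int]_(nu + nf).
Implicit Types (t : qseed nu nf) (k : 'I_nu) (a g m : G).

Definition dom_cone t a : Prop := exists n : 'cV[nat]_nu, a = Bt t *m nvec n.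
Definition string_cone t k a : Prop := exists n : nat, a = n%:Z *: yk t k.

Lemma nvecE {p} (n : 'cV[nat]_p) i : nvec n i 0 = (n i 0)%:Z.
Proof. by rewrite mxE. Qed.

Lemma domcP t a (n : 'cV[int]_nu) : a = Bt t *m n -> (forall j, 0 <= n j 0) -> dom_cone t a.
Proof.
move=> -> h; exists (\col_j absz (n j 0)); congr (_ *m _); apply/colP => j.
by rewrite nvecE mxE gez0_abs.
Qed.

Lemma domcE t a : dom_cone t a -> exists n : 'cV[int]_nu, a = Bt t *m n /\ forall j, 0 <= n j 0.
Proof. by case=> n ->; exists (nvec n); split=> // j; rewrite nvecE. Qed.

Lemma yk_neq0 t k : is_quantum_seed t -> yk t k <> 0.
Proof.
move=> qt /(B_inj qt) /(congr1 (fun x : 'cV[int]_nu => x k 0)).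
by rewrite !mxE !eqxx.
Qed.

Lemma pcone_dom t : is_quantum_seed t -> pointed_cone (dom_cone t).
Proof.
move=> qt; split.
- by apply: (@domcP _ _ 0) => [|j]; rewrite ?mulmx0 ?mxE.
- move=> a b /domcE [n [-> hn]] /domcE [m [-> hm]].
  by apply: (@domcP _ _ (n + m)) => [|j]; rewrite ?mulmxDr // cvD addr_ge0.
move=> a /domcE [n [-> hn]] /domcE [m []] /eqP; rewrite eqr_oppLR -mulmxN => /eqP /(B_inj2 qt) e hm.
rewrite (_ : n = 0) ?mulmx0 //; apply/colP => j; rewrite mxE.
by have := hn j; have := hm j; rewrite e cvN; lia.
Qed.

Lemma strc_dom t k a : string_cone t k a -> dom_cone t a.
Proof.
case=> n ->; apply: (@domcP _ _ (n%:Z *: delta_mx k 0)); first by rewrite -scalemxAr.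
by move=> j; rewrite cvZ mxE; case: (_ && _).
Qed.

Lemma pcone_str t k : is_quantum_seed t -> pointed_cone (string_cone t k).
Proof.
move=> qt; split.
- by exists 0%N; rewrite scale0r.
- by move=> a b [n ->] [m ->]; exists (n + m)%N; rewrite -scalerDl.
by move=> a /strc_dom h1 /strc_dom h2; case: (pcone_dom qt) => _ _; apply.
Qed.

Lemma pcone_op (C : G -> Prop) : pointed_cone C -> pointed_cone (fun a => C (- a)).
Proof.
case=> C0 CD Ca; split; first by rewrite oppr0.
  by move=> a b h1 h2; rewrite opprD; apply: CD.
by move=> a h1 h2; apply: (oppr_inj); rewrite oppr0; apply: Ca => //; rewrite opprK.
Qed.

Lemma strc_yk t k : string_cone t k (yk t k).
Proof. by exists 1%N; rewrite scale1r. Qed.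

End Cones.

(** * Mutation of frames *)

Section Exchange.
Context {R : vring} {K : unitAlgType R}.
Implicit Types x y : K.

Lemma commX x y (e : int) (a : int) : y \is a GRing.unit ->
  x * y = vp e *: (y * x) -> x * y ^ a = vp (a * e) *: (y ^ a * x).
Proof.
move=> uy h.
have hn (n : nat) : x * y ^+ n = vp (n%:Z * e) *: (y ^+ n * x).
  elim: n => [|n IH]; first by rewrite mul0r vp0 scale1r mulr1 mul1r.
  rewrite exprS mulrA h -scalerAl -(mulrA y x) IH -scalerAr scalerA -vpD -!(mulrA y).
  by apply: eq_scale => //; congr vp; rewrite intS; ring.
case: a => n; first exact: hn.
rewrite NegzE -exprnN; have un : y ^+ n.+1 \is a GRing.unit by rewrite unitrX.
apply: (mulIr un); rewrite mulrVK // -scalerAl -mulrA hn -scalerAr mulKr //.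
by rewrite scalerA -vpD mulNr addNr vp0 scale1r.
Qed.

End Exchange.

Section MutatedFrame.
Context {R : vring} {K : unitAlgType R} {nu nf : nat}.
Hypothesis Ksf : forall z : K, z != 0 -> z \is a GRing.unit.
Notation G := 'cV[int]_(nu + nf).
Implicit Types (t : qseed nu nf) (k : 'I_nu) (E : G -> K) (g m : G).

Definition gm t k : G := fmut t k (uf nf k).
Definition mutW t k E : K := E (gm t k) + E (gm t k + yk t k).
Definition m0 k m : G := m - m (uf nf k) 0 *: fb (uf nf k).
(* X(mu_k t)^m, written in the frame E of t: the binomial [mutW] is X_k(mu_k t). *)
Definition mutf t k E m : K :=
  vp (- lam t (m0 k m) (m (uf nf k) 0 *: gm t k)) *: (E (m0 k m) * mutW t k E ^ (m (uf nf k) 0)).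

Fixpoint mutf_seq t E (ks : seq 'I_nu) : G -> K :=
  if ks is k :: ks' then mutf_seq (mutate t k) (mutf t k E) ks' else E.

Lemma mutate_seq_cat t ks js : mutate_seq t (ks ++ js) = mutate_seq (mutate_seq t ks) js.
Proof. by elim: ks t => //= k ks IH t; rewrite IH. Qed.

Lemma mutf_seq_cat t E ks js :
  mutf_seq t E (ks ++ js) = mutf_seq (mutate_seq t ks) (mutf_seq t E ks) js.
Proof. by elim: ks t E => //= k ks IH t E; rewrite IH. Qed.

Lemma m0_def k m : m0 k m = m - m (uf nf k) 0 *: fb (uf nf k).
Proof. by []. Qed.

Lemma m0_k k m : m0 k m (uf nf k) 0 = 0.
Proof. by rewrite cvD cvN cvZ fbE eqxx mulr1 subrr. Qed.

Lemma m0_id k m : m (uf nf k) 0 = 0 -> m0 k m = m.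
Proof. by move=> e; rewrite /m0 e scale0r subr0. Qed.

Lemma m0D k m m' : m0 k (m + m') = m0 k m + m0 k m'.
Proof. by rewrite /m0 cvD scalerDl opprD addrACA. Qed.

Lemma mutf_id t k E m : m (uf nf k) 0 = 0 -> mutf t k E m = E m.
Proof.
by move=> e; rewrite /mutf e scale0r lam0r oppr0 vp0 scale1r m0_id // expr0z mulr1.
Qed.

Lemma gm_k t k : is_quantum_seed t -> gm t k (uf nf k) 0 = -1.
Proof. by move=> qt; rewrite /gm fmutE eqxx Bkk // oppr0 posp0 addr0. Qed.

Lemma m0_Pm t k m : Pm t k m = m0 k m + m (uf nf k) 0 *: gm t k.
Proof.
by rewrite Pm_def /m0 scalerBr addrA addrAC.
Qed.

Lemma Pm_fb t k : Pm t k (fb (uf nf k)) = gm t k.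
Proof. by rewrite m0_Pm /m0 fbE eqxx !scale1r subrr add0r. Qed.

Lemma gm_mutate t k : is_quantum_seed t -> gm (mutate t k) k = gm t k + yk t k.
Proof.
move=> qt; apply/colP => i; rewrite cvD /gm !fmutE ykE BtmE eqxx orbT opprK pospN; ring.
Qed.

Opaque m0.

Section OneSeed.
Variables (t : qseed nu nf) (k : 'I_nu) (E : G -> K).
Hypothesis qt : is_quantum_seed t.
Hypothesis fE : frame (lam t) E.
Let la := lam_alt qt.
Let W := mutW t k E.

Lemma pt_W : pt E (string_cone t k) (gm t k) W.
Proof.
rewrite /W /mutW -[E (_ + _)]scale1r; apply: (ptD (pcone_str k qt) (h := gm t k + yk t k)).
- by move/eqP; rewrite -subr_eq0 opprD addNKr oppr_eq0 => /eqP /(yk_neq0 qt).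
- by rewrite addrC addKr; apply: strc_yk.
- by apply: pt_mon; case: (pcone_str k qt).
by apply: pt_mon; case: (pcone_str k qt).
Qed.

(** The exchange binomial read from its other end, for the orders that run down the k-strings. *)
Lemma pt_W_op : pt E (fun a => string_cone t k (- a)) (gm t k + yk t k) W.
Proof.
have C0 : string_cone t k (- 0) by rewrite oppr0; case: (pcone_str k qt).
rewrite /W /mutW [E (gm t k) + _]addrC -[E (gm t k)]scale1r.
apply: (ptD (pcone_op (pcone_str k qt)) (h := gm t k)).
- by move/eqP; rewrite -subr_eq0 addrC addKr => /eqP /(yk_neq0 qt).
- by rewrite opprB addrC addKr; apply: strc_yk.
- exact: pt_mon.
exact: pt_mon.
Qed.

Lemma W_unit : W \is a GRing.unit.
Proof. by apply/Ksf/(pn_neq0 fE)/pt_pn/pt_W. Qed.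

Lemma comm_W m a : m (uf nf k) 0 = 0 ->
  E m * W ^ a = vp (2 * lam t m (a *: gm t k)) *: (W ^ a * E m).
Proof.
move=> e; rewrite lamZr mulrCA; apply: commX W_unit _.
have l0 : lam t m (yk t k) = 0 by rewrite lamr_yk // e mulr0 oppr0.
rewrite /W /mutW mulrDr (E_comm la fE m (gm t k)) (E_comm la fE m (_ + _)) lamDr l0 addr0.
by rewrite -scalerDr -mulrDl.
Qed.

Lemma mutfM m m' : mutf t k E m * mutf t k E m' =
  vp (lam (mutate t k) m m') *: mutf t k E (m + m').
Proof.
have [_ EM _] := fE.
rewrite /mutf -/W -scalerAl -scalerAr !scalerA.
set p := m _ 0; set q := m' _ 0.
have c : W ^ p * E (m0 k m') = vp (- (2 * lam t (m0 k m') (p *: gm t k))) *: (E (m0 k m') * W ^ p).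
  by rewrite comm_W ?m0_k // scalerA -vpD addNr vp0 scale1r.
have -> : E (m0 k m) * W ^ p * (E (m0 k m') * W ^ q) =
   vp (- (2 * lam t (m0 k m') (p *: gm t k)) + lam t (m0 k m) (m0 k m')) *:
    (E (m0 k (m + m')) * W ^ (p + q)).
  rewrite -mulrA (mulrA (W ^ p)) c -scalerAl -scalerAr -mulrA -(exprzDr W_unit).
  by rewrite mulrA EM -scalerAl scalerA -vpD m0D.
rewrite scalerA -!vpD; apply: eq_scale; last by rewrite cvD.
congr vp; rewrite lam_mutate !m0_Pm cvD -/p -/q m0D.
move: (m0 k m) (m0 k m') (gm t k) => x y z.
rewrite !(lamDl, lamDr, lamZl, lamZr) (lmxx la).
by rewrite (lmC la y z); ring.
Qed.

Lemma mutf0 : mutf t k E 0 = 1.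
Proof. by rewrite mutf_id ?mxE //; case: fE. Qed.

Lemma pt_exp C g (x : K) n : pointed_cone C -> pt E C g x -> pt E C (n%:Z *: g) (x ^+ n).
Proof.
move=> hC hx; elim: n => [|n IH].
  by rewrite scale0r expr0; case: fE => <- _ _; apply: pt_mon; case: hC.
have := ptM fE hC hx IH.
rewrite (_ : lam t g (n%:Z *: g) = 0); last by rewrite lamZr (lmxx la) mulr0.
by rewrite oppr0 vp0 scale1r -exprS intS scalerDl scale1r.
Qed.

Lemma pt_mutf m : 0 <= m (uf nf k) 0 -> pt E (string_cone t k) (Pm t k m) (mutf t k E m).
Proof.
move=> hm; rewrite m0_Pm /mutf -/W -(gez0_abs hm); apply: (ptM fE (pcone_str k qt)).
  by apply: pt_mon; case: (pcone_str k qt).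
by apply: pt_exp (pcone_str k qt) pt_W.
Qed.

Lemma pt_mutf_op m : 0 <= m (uf nf k) 0 ->
  pt E (fun a => string_cone t k (- a)) (Pm t k m + m (uf nf k) 0 *: yk t k) (mutf t k E m).
Proof.
move=> hm; have hC := pcone_op (pcone_str k qt).
rewrite m0_Pm -addrA -scalerDr /mutf -/W.
have -> : lam t (m0 k m) (m (uf nf k) 0 *: gm t k) =
   lam t (m0 k m) (m (uf nf k) 0 *: (gm t k + yk t k)).
  by rewrite !lamZr lamDr lamr_yk // m0_k mulr0 oppr0 addr0.
rewrite -(gez0_abs hm); apply: (ptM fE hC).
  by apply: pt_mon; case: hC.
by apply: pt_exp hC pt_W_op.
Qed.

Lemma barinv_mutf m : 0 <= m (uf nf k) 0 -> barinv E (mutf t k E m).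
Proof.
move=> hm; rewrite /mutf; apply: (barinvM la fE); first exact: barinvU.
  rewrite -(gez0_abs hm); apply: (barinvX la fE).
  by apply: barinvD; apply: barinvU.
by rewrite comm_W ?m0_k.
Qed.

Lemma Pm_inj : injective (Pm t k).
Proof. exact: (can_inj (PmK qt k)). Qed.

(** A power of the new variable clears its negative exponents; the remaining monomials are pointed
    in t at the distinct degrees [Pm t k m], hence independent. *)
Lemma mutf_inj c : ev (mutf t k E) c = 0 -> c = 0.
Proof.
move=> e0.
have [N hN] : exists N : nat, forall m, m \in msupp c -> 0 <= m (uf nf k) 0 + N%:Z.
  exists (\sum_(m <- msupp c) absz (m (uf nf k) 0%R))%N => m mc.
  rewrite (big_rem _ mc) /=; lia.
set f := N%:Z *: fb (uf nf k) : G.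
have fk : f (uf nf k) 0 = N%:Z by rewrite cvZ fbE eqxx mulr1.
set l := fun m => lam (mutate t k) m f.
set c' : {malg R[G]} := \sum_(m <- msupp c) mkmalgU (m + f) (vp (l m) * c@_m).
(* On negative k-exponents, which do not occur in c', P is an arbitrary element of the right degree,
   so that pointedness holds for every m. *)
pose P m := if 0 <= m (uf nf k) 0 then mutf t k E m else E (Pm t k m).
have c'E m : c'@_(m + f) = vp (l m) * c@_m.
  exact: mcoeff_shift.
have c's m : m \in msupp c' -> 0 <= m (uf nf k) 0.
  rewrite -[m](subrK f) mem_msupp c'E => h; rewrite cvD fk hN //.
  by rewrite mem_msupp; apply: contraNneq h => ->; rewrite mulr0.
have c'0 : c' = 0.
  clear c'E; apply: (lin_indep fE (pcone_str k qt) (P := P) (dl := Pm t k)) => //; first 1 last.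
  - exact: Pm_inj.
  - rewrite (eq_ev (P := mutf t k E)) => [|m /c's h]; last by rewrite /P h.
    rewrite -[RHS](mul0r (mutf t k E f)) -e0 ev_sum [in RHS]/ev mulr_suml.
    apply: eq_bigr => m _; rewrite evU -scalerAl mutfM (scalerA c@_m).
    by apply: eq_scale => //; exact: mulrC.
  move=> m; rewrite /P; case: ifP => h; first exact: pt_mutf.
  by apply: pt_mon; case: (pcone_str k qt).
apply/malgP => m; rewrite mcoeff0; have := c'E m; rewrite c'0 mcoeff0 => /esym e.
by have := congr1 (fun x => vp (- l m) * x) e; rewrite mulrA vpNK mul1r mulr0.
Qed.

Lemma frame_mutf : frame (lam (mutate t k)) (mutf t k E).
Proof. by split; [exact: mutf0|exact: mutfM|exact: mutf_inj]. Qed.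

Lemma mutf_fb : mutf t k E (fb (uf nf k)) = W.
Proof.
rewrite /mutf fbE eqxx expr1z scale1r.
have -> : m0 k (fb (uf nf k)) = 0 by rewrite m0_def fbE eqxx scale1r subrr.
by rewrite lam0l oppr0 vp0 scale1r; case: fE => -> _ _; rewrite mul1r.
Qed.

End OneSeed.

Lemma frame_ext t E1 E2 : is_quantum_seed t -> frame (lam t) E1 ->
  E2 0 = 1 -> (forall a b, E2 a * E2 b = vp (lam t a b) *: E2 (a + b)) ->
  (forall i, E1 (fb i) = E2 (fb i)) -> E1 = E2.
Proof.
move=> qt f1 E20 E2M h; have la := lam_alt qt; have [E10 E1M _] := f1.
apply/funext => m; apply: (@cV_ind _ _ (fun m => E1 m = E2 m) xpredT) => //.
- by rewrite E10 E20.
- by move=> a b ea eb; rewrite (E_add f1) ea eb E2M scalerA -vpD addNr vp0 scale1r.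
move=> a ea; have u := E_unit Ksf f1 a.
apply: (mulrI u); rewrite E1M addrN ea E2M addrN E10 E20.
by rewrite (lmNr la).
Qed.

(** Only the k-th variable is in question, and after multiplication by X_k(mu_k t) the claim is the
    exchange relation. *)
Lemma mutf_mutfK t k E : is_quantum_seed t -> frame (lam t) E ->
  mutf (mutate t k) k (mutf t k E) = E.
Proof.
move=> qt fE; have la := lam_alt qt; have [qt' _] := mutate_quantum qt k.
have f1 := frame_mutf k qt fE.
have := frame_mutf k qt' f1; rewrite mutateK // => f2.
have [E0 EM _] := fE; apply: (frame_ext qt f2 E0 EM) => i.
have [->|ni] := eqVneq i (uf nf k); last first.
  have e : (fb i : G) (uf nf k) 0 = 0 by rewrite fbE eq_sym (negbTE ni).
  by rewrite !mutf_id.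
rewrite mutf_fb // /mutW gm_mutate // yk_mutate // addrK.
have [g1 y0] := (gm_k k qt, yk_k qt k).
have u := W_unit k qt fE; apply: (mulIr u).
have e1 : m0 k (gm t k) = fb (uf nf k) + gm t k by rewrite m0_def g1 scaleN1r opprK addrC.
have e2 : m0 k (gm t k + yk t k) = fb (uf nf k) + (gm t k + yk t k).
  by rewrite m0D (m0_id y0) e1 addrA.
rewrite /mutf cvD y0 addr0 g1 e1 e2 mulrDl -!scalerAl !exprN1 !mulrVK //.
rewrite /mutW mulrDr !EM addrC; congr (_ + _); apply: eq_scale => //; congr vp.
  rewrite !scaleN1r (lmNr la) opprK !lamDl (lmxx la) addr0; ring.
rewrite !scaleN1r (lmNr la) opprK !(lamDl, lamDr) (lmxx la) lam_yk // lamr_yk // g1 fbE eqxx /= mulr1n; ring.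
Qed.

Lemma mutate_seq_quantum t ks : is_quantum_seed t -> is_quantum_seed (mutate_seq t ks).
Proof. by elim: ks t => //= k ks IH t qt; apply: IH; case: (mutate_quantum qt k). Qed.

Lemma frame_mutf_seq t E ks : is_quantum_seed t -> frame (lam t) E ->
  frame (lam (mutate_seq t ks)) (mutf_seq t E ks).
Proof.
elim: ks t E => //= k ks IH t E qt fE; apply: IH; last exact: frame_mutf.
by case: (mutate_quantum qt k).
Qed.

End MutatedFrame.

Lemma seq_min (T : eqType) (f : T -> int) (s : seq T) a0 : a0 \in s ->
  exists a, a \in s /\ forall b, b \in s -> f a <= f b.
Proof.
elim: s a0 => // x s IH a0 _; have [->|] := eqVneq s [::].
  by exists x; split; rewrite ?mem_head // => b; rewrite inE => /eqP ->.
case: s IH => // y s IH _; have [a [as_ ha]] := IH _ (mem_head y s).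
have [h|h] := leP (f x) (f a).
  exists x; split; rewrite ?mem_head // => b; rewrite inE => /orP[/eqP ->//|/ha]; exact: le_trans.
exists a; split; first by rewrite inE as_ orbT.
by move=> b; rewrite inE => /orP[/eqP ->|/ha //]; apply: ltW.
Qed.

Lemma malg_bound {R : comNzRingType} {G : zmodType} (c : {malg R[G]}) (f : G -> int) :
  exists N : nat, forall m, m \in msupp c -> 0 <= f m + N%:Z.
Proof.
exists (\sum_(m <- msupp c) absz (f m))%N => m mc.
by rewrite (big_rem _ mc) /=; lia.
Qed.

Lemma msplit {R : comNzRingType} {G : zmodType} (P : G -> Prop) (c : {malg R[G]}) :
  exists c1 c2, [/\ c = c1 + c2, forall m, m \in msupp c1 -> m \in msupp c /\ P m
    & forall m, m \in msupp c2 -> m \in msupp c /\ ~ P m].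
Proof.
by exists (mrestr P c), (mrestr (fun a => ~ P a) c); split=> [|m|m];
  [exact: mrestrC|exact: mrestr_supp|exact: mrestr_supp].
Qed.

Section Supports.
Context {R : vring} {K : unitAlgType R} {G : zmodType}.
Implicit Types (E P : G -> K) (Q : G -> Prop) (x y : K).

Definition laurent_on E Q x : Prop := exists c, x = ev E c /\ forall m, m \in msupp c -> Q m.

Lemma lpl_sub E Q Q' x : (forall m, Q m -> Q' m) -> laurent_on E Q x -> laurent_on E Q' x.
Proof. by move=> h [c [-> s]]; exists c; split=> // m /s/h. Qed.

Lemma lplD E Q x y : laurent_on E Q x -> laurent_on E Q y -> laurent_on E Q (x + y).
Proof.
move=> [a [-> ha]] [b [-> hb]]; exists (a + b); rewrite evD; split=> // m.
by move=> /(fsubsetP (msuppD_le _ _)); rewrite inE => /orP[/ha|/hb].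
Qed.

Lemma lplZ E Q k x : laurent_on E Q x -> laurent_on E Q (k *: x).
Proof.
move=> [a [-> ha]]; exists (k *: a); rewrite evZ; split=> // m.
by move=> /(fsubsetP (msuppZ_le _ _)) /ha.
Qed.

Lemma lplN E Q x : laurent_on E Q x -> laurent_on E Q (- x).
Proof. by rewrite -scaleN1r; apply: lplZ. Qed.

Lemma lplB E Q x y : laurent_on E Q x -> laurent_on E Q y -> laurent_on E Q (x - y).
Proof. by move=> hx /lplN; apply: lplD. Qed.

Lemma lpl0 E Q : laurent_on E Q 0.
Proof. by exists 0; rewrite ev0; split=> // m; rewrite msupp0. Qed.

Lemma lplU E Q m : Q m -> laurent_on E Q (E m).
Proof.
exists (mkmalgU m 1); rewrite evU scale1r; split=> // a.
by move=> /(fsubsetP msuppU_le); rewrite inE => /eqP ->.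
Qed.

Lemma lpl_ev E P Q c : (forall a, a \in msupp c -> laurent_on E Q (P a)) -> laurent_on E Q (ev P c).
Proof.
move=> h; rewrite /ev big_seq; elim/big_ind: _; [exact: lpl0|exact: lplD|].
by move=> a /h; apply: lplZ.
Qed.

Lemma pt_lpl E C g x : pt E C g x -> laurent_on E (fun m => C (m - g)) x.
Proof. by case=> c [-> _ h]; exists c. Qed.

Lemma ev_comm P c z : (forall a, a \in msupp c -> z * P a = P a * z) -> z * ev P c = ev P c * z.
Proof.
move=> h; rewrite /ev mulr_sumr mulr_suml big_seq [RHS]big_seq; apply: eq_bigr => a /h e.
by rewrite -scalerAl -scalerAr e.
Qed.

Section Frame.
Variables (lm : G -> G -> int) (E : G -> K).
Hypothesis fE : frame lm E.

Lemma lplM (Q1 Q2 Q : G -> Prop) x y : (forall a b, Q1 a -> Q2 b -> Q (a + b)) ->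
  laurent_on E Q1 x -> laurent_on E Q2 y -> laurent_on E Q (x * y).
Proof.
move=> h [a [-> ha]] [b [-> hb]]; exists (tm lm a b); rewrite (evM fE); split=> // m.
by move=> /twmul_supp [a1 [b1 [/ha h1 /hb h2 ->]]]; apply: h.
Qed.

Lemma lpl_disj (Q1 Q2 : G -> Prop) x : (forall m, Q1 m -> Q2 m -> False) ->
  laurent_on E Q1 x -> laurent_on E Q2 x -> x = 0.
Proof.
move=> h [a [-> ha]] [b [/(ev_inj fE) eab hb]]; rewrite (_ : a = 0) ?ev0 //.
apply/malgP => m; rewrite mcoeff0; apply/eqP; rewrite mcoeff_eq0; apply/negP => ma.
by apply: (h m); [exact: ha|apply: hb; rewrite -eab].
Qed.

Lemma pt_tail C g x : pt E C g x -> laurent_on E (fun m => C (m - g) /\ m <> g) (x - E g).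
Proof.
case=> c [-> c1 h]; exists (c - mkmalgU g 1); rewrite evB evU scale1r; split=> // m.
move=> hs; have := hs; rewrite mem_msupp mcoeffB mcoeffU; case: (eqVneq g m) => [<-|nm] hm.
  by rewrite c1 mulr1n subrr eqxx in hm.
split; last by move=> e; rewrite e eqxx in nm.
by apply: h; rewrite mem_msupp; move: hm; rewrite mulr0n subr0.
Qed.

End Frame.
End Supports.

(** * The basis of the intersection of two adjacent Laurent rings *)

Section Sbasis.
Context {R : vring} {K : unitAlgType R} {nu nf : nat}.
Hypothesis Ksf : forall z : K, z != 0 -> z \is a GRing.unit.
Notation G := 'cV[int]_(nu + nf).
Implicit Types (t : qseed nu nf) (k : 'I_nu) (E : G -> K) (g m : G).

(* The cluster monomials in X_k and X_k' with Laurent coefficients in the other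
   variables form a basis of the intersection of the Laurent rings of t and mu_k t. *)
Definition sbasis t k E m : K :=
  if 0 <= m (uf nf k) 0 then E m else mutf t k E (trop t k m).

Lemma trop_inj t k : is_quantum_seed t -> injective (trop t k).
Proof. by move=> qt; apply: (can_inj (g := trop (mutate t k) k)) => g; apply: trop_mutateK. Qed.

Lemma Pm_mutate t k m : is_quantum_seed t ->
  Pm (mutate t k) k m = Pm t k m + m (uf nf k) 0 *: yk t k.
Proof.
move=> qt; have [qt' _] := mutate_quantum qt k.
apply/colP => i; rewrite (PmE qt') cvD (PmE qt) cvZ ykE BtmE eqxx orbT.
case: eqP => [->|_]; first by rewrite Bkk //; ring.
by rewrite opprK -{1}[Bt t i k]opprK (pospN (- _)); ring.
Qed.

Section One.
Variables (t : qseed nu nf) (k : 'I_nu) (E : G -> K).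
Hypothesis qt : is_quantum_seed t.
Hypothesis fE : frame (lam t) E.
Let t' := mutate t k.
Let E' := mutf t k E.
Let fE' : frame (lam t') E' := frame_mutf Ksf k qt fE.

Lemma Sb_ge0 m : 0 <= m (uf nf k) 0 -> sbasis t k E m = E m.
Proof. by rewrite /sbasis => ->. Qed.

Lemma Sb_le0 m : m (uf nf k) 0 <= 0 -> sbasis t k E m = E' (trop t k m).
Proof.
rewrite /sbasis; case: ifP => // h1 h2; have e : m (uf nf k) 0 = 0 by lia.
by rewrite trop_0 // /E' mutf_id.
Qed.

Lemma pt_Sb m : pt E (string_cone t k) m (sbasis t k E m).
Proof.
have [h|h] := leP 0 (m (uf nf k) 0).
  by rewrite Sb_ge0 //; apply: pt_mon; case: (pcone_str k qt).
rewrite Sb_le0 ?ltW // trop_le0 ?ltW // -{1}[m](PmK qt k).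
by apply: (pt_mutf qt fE); rewrite (PmE qt) eqxx; lia.
Qed.

(** The two adjacent seeds share this basis: exchanging their roles only re-indexes it by the
    tropical map. *)
Lemma Sb_mutate m : sbasis t' k E' (trop t k m) = sbasis t k E m.
Proof.
have K2 := mutf_mutfK Ksf k qt fE; rewrite -/t' -/E' in K2.
have [h|h] := leP 0 (m (uf nf k) 0).
  rewrite [RHS]Sb_ge0 // /sbasis trop_k; case: ifP => h2.
    have e : m (uf nf k) 0 = 0 by lia.
    by rewrite trop_0 // /E' mutf_id.
  by rewrite K2 trop_mutateK.
by rewrite Sb_le0 ?ltW // /sbasis trop_k (_ : 0 <= _) //; lia.
Qed.

Lemma barinv_Sb m : barinv E (sbasis t k E m).
Proof.
have [h|h] := leP 0 (m (uf nf k) 0); first by rewrite Sb_ge0 //; apply: barinvU.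
by rewrite Sb_le0 ?ltW //; apply: (barinv_mutf Ksf qt fE); rewrite trop_k; lia.
Qed.

Lemma Sb_mul (a m : G) : a (uf nf k) 0 = 0 -> E a * sbasis t k E m = vp (lam t a m) *: sbasis t k E (a + m).
Proof.
move=> a0; have e : (a + m) (uf nf k) 0 = m (uf nf k) 0 by rewrite cvD a0 add0r.
have [h|h] := leP 0 (m (uf nf k) 0); first by rewrite !Sb_ge0 ?e //; case: fE.
rewrite !Sb_le0 ?e ?ltW // -(mutf_id t E a0) -/E'; case: fE' => _ -> _.
rewrite !trop_le0 ?e ?ltW // PmD // (Pm_id t a0); apply: eq_scale => //; congr vp.
by rewrite -{1}(Pm_id t a0) lam_mutate !PmK.
Qed.

Lemma lpl_mutf m : 0 <= m (uf nf k) 0 ->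
  laurent_on E (fun a => a (uf nf k) 0 = - m (uf nf k) 0) (E' m).
Proof.
move=> h; apply: lpl_sub (pt_lpl (pt_mutf qt fE h)) => a [n].
move=> /eqP; rewrite subr_eq => /eqP ->.
by rewrite cvD cvZ yk_k // mulr0 add0r (PmE qt) eqxx.
Qed.

End One.

Section Two.
Variables (t : qseed nu nf) (k : 'I_nu) (E : G -> K).
Hypothesis qt : is_quantum_seed t.
Hypothesis fE : frame (lam t) E.
Let t' := mutate t k.
Let E' := mutf t k E.
Let qt' : is_quantum_seed t' := (mutate_quantum qt k).1.
Let fE' : frame (lam t') E' := frame_mutf Ksf k qt fE.

Lemma pt_Sb' m : pt E' (string_cone t' k) (trop t k m) (sbasis t k E m).
Proof. by rewrite -Sb_mutate //; apply: pt_Sb. Qed.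

Lemma barinv_Sb' m : barinv E' (sbasis t k E m).
Proof. by rewrite -Sb_mutate //; apply: barinv_Sb. Qed.

Lemma lp_mutf_ge0 m : 0 <= m (uf nf k) 0 -> laurent E' (E m).
Proof. by move=> h; rewrite -(Sb_ge0 t E h); apply: pt_lp (pt_Sb' m). Qed.

(** The part of x with negative X_k-exponents is re-expanded in mu_k t. Its terms with negative
    X_k'-exponents, multiplied by X_k'^N with N large, would have X_k-exponents that are at most -N
    and also greater than -N, so they vanish. *)
Lemma Sb_span x : laurent E x -> laurent E' x -> laurent (sbasis t k E) x.
Proof.
pose u := uf nf k.
move=> [c ec] hx; have [c1 [c2 [ecc hc1 hc2]]] := msplit (fun m : G => 0 <= m u 0) c.
have ex : x = ev E c1 + ev E c2 by rewrite -evD -ecc.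
have e1 : laurent (sbasis t k E) (ev E c1).
  by apply: lp_ev => m /hc1 [_ h]; rewrite -(Sb_ge0 t E h); apply: lpU.
have [d ed] : laurent E' (ev E c2).
  rewrite (_ : ev E c2 = x - ev E c1); last by rewrite ex addrC addKr.
  by apply: lpB => //; apply: lp_ev => m /hc1 [_ h]; apply: lp_mutf_ge0.
have [d1 [d2 [edd hd1 hd2]]] := msplit (fun m : G => 0 <= m u 0) d.
have e2 : laurent (sbasis t k E) (ev E' d1).
  apply: lp_ev => m /hd1 [_ h].
  have -> : E' m = sbasis t k E (trop t' k m); last exact: lpU.
  have tk : trop t k (trop t' k m) = m by have := trop_mutateK k m qt'; rewrite mutateK.
  by rewrite Sb_le0 ?tk // trop_k oppr_le0.
have ed2 : ev E c2 = ev E' d1 + ev E' d2 by rewrite -evD -edd.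
suff z0 : ev E' d2 = 0.
  by move: ex; rewrite ed2 z0 (addr0 (ev E' d1)) => ->; exact: (lpD e1 e2).
have [N hN] := malg_bound d2 (fun m => m u 0).
pose f : G := N%:Z *: fb u.
have fk : f u 0 = N%:Z by rewrite cvZ fbE eqxx mulr1.
have fN : laurent_on E (fun a => a u 0 = - N%:Z) (E' f).
  by rewrite -fk; apply: (lpl_mutf qt fE); rewrite -/u fk.
have l1 : laurent_on E (fun a => a u 0 <= - N%:Z) (ev E' d2 * E' f).
  apply: (lplM fE (Q1 := fun a => a u 0 <= 0) _ _ fN).
    by move=> a b h1 h2; rewrite cvD h2 gerDr.
  rewrite (_ : ev E' d2 = ev E c2 - ev E' d1); last by rewrite ed2 addrC addKr.
  apply: lplB; apply: lpl_ev => m.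
    by move=> /hc2 [_ /negP]; rewrite -ltNge => h; apply/lplU/ltW.
  move=> /hd1 [_ h]; apply: lpl_sub (lpl_mutf qt fE h) => a; rewrite -/u => ->.
  by rewrite oppr_le0.
have l2 : laurent_on E (fun a => a u 0 > - N%:Z) (ev E' d2 * E' f).
  rewrite {1}/ev mulr_suml big_seq; elim/big_ind: _; [exact: lpl0|by move=> a b; apply: lplD|].
  move=> m md; have [_ /negP h] := hd2 m md; rewrite -scalerAl; apply: lplZ.
  case: fE' => _ -> _; apply: lplZ.
  have hm : (m + f) u 0 = m u 0 + N%:Z by rewrite cvD fk.
  have h0 : 0 <= (m + f) u 0 by rewrite hm hN.
  apply: lpl_sub (lpl_mutf qt fE h0) => a; rewrite -/u hm => ->.
  by rewrite opprD -[X in X < _]add0r ltrD2r oppr_gt0 ltNge.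
have z : ev E' d2 * E' f = 0.
  by apply: (lpl_disj fE _ l1 l2) => m h1 h2; move: (lt_le_trans h2 h1); rewrite ltxx.
apply/eqP; apply: contraT => nz; have := K_domain Ksf nz (E_neq0 fE' f).
by rewrite z eqxx.
Qed.

(** The elements of [sbasis] are bar-invariant and pointed in both seeds, so in either seed
    bar-invariance of x means bar-invariance of the same coefficients. *)
Lemma barinv_transfer x : barinv E x -> laurent E' x -> barinv E' x.
Proof.
move=> bx hx; have [a ea] : laurent (sbasis t k E) x.
  by apply: Sb_span => //; case: bx => c [-> _]; exists c.
have h1 := barinv_coord fE a (pcone_str k qt) (pt_Sb k qt fE) (@inj_id G) (barinv_Sb k qt fE).
have h2 := barinv_coord fE' a (pcone_str k qt') pt_Sb' (@trop_inj t k qt) barinv_Sb'.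
by rewrite ea; apply/h2/h1; rewrite -ea.
Qed.

Lemma mutf_1 m : m (uf nf k) 0 = 1 -> E' m = E (Pm t k m) + E (Pm t k m + yk t k).
Proof.
move=> m1; rewrite m0_Pm /E' /mutf m1 expr1z scale1r /mutW mulrDr scalerDr -(addrA (m0 k m)).
have [_ EM _] := fE; rewrite !EM !scalerA -!vpD lamDr lamr_yk // m0_k mulr0 oppr0 addr0.
by rewrite addNr vp0 2!scale1r.
Qed.

End Two.
End Sbasis.

(** * Mutation invariance of the upper bound *)

Section UpperBound.
Context {R : vring} {K : unitAlgType R} {nu nf : nat}.
Hypothesis Ksf : forall z : K, z != 0 -> z \is a GRing.unit.
Notation G := 'cV[int]_(nu + nf).
Implicit Types (t : qseed nu nf) (k j : 'I_nu) (E : G -> K) (g m : G).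

Section Ray.
Variables (t : qseed nu nf) (E : G -> K) (y : G).
Hypothesis qt : is_quantum_seed t.
Hypothesis fE : frame (lam t) E.
Hypothesis y0 : y <> 0.
Let la := lam_alt qt.

(** Elements pointed at 0 for this cone are polynomials in X^y with constant term 1. They commute
    with one another and serve as denominators. *)
Definition ray (a : G) : Prop := exists n : nat, a = n%:Z *: y.

Lemma pcone_ray : pointed_cone ray.
Proof.
split; first by exists 0%N; rewrite scale0r.
  by move=> a b [n ->] [m ->]; exists (n + m)%N; rewrite -scalerDl.
move=> a [n ->] [m] /eqP; rewrite eqr_oppLR -scaleNr -subr_eq0 -scalerBl => /eqP e.
have [->|nz] := eqVneq n%:Z 0; first by rewrite scale0r.
case: y0; apply/colP => i; move/colP: e => /(_ i); rewrite cvZ mxE => /eqP.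
by rewrite mulf_eq0 => /orP[/eqP|/eqP //]; lia.
Qed.

Lemma ray_one : pt E ray 0 1.
Proof. by have [e _ _] := fE; rewrite -e; apply: pt_mon; case: pcone_ray. Qed.

Lemma ray_mul p q : pt E ray 0 p -> pt E ray 0 q -> pt E ray 0 (p * q).
Proof.
by move=> hp hq; have := ptM fE pcone_ray hp hq; rewrite lam0l oppr0 vp0 scale1r addr0.
Qed.

Lemma ray_conj (a : G) p : pt E ray 0 p -> pt E ray 0 (E (- a) * p * E a).
Proof.
move=> hp; have C0 : ray 0 by case: pcone_ray.
have := ptM fE pcone_ray (pt_mon E (- a) C0) hp.
rewrite lam0r oppr0 vp0 scale1r addr0 => h; have := ptM fE pcone_ray h (pt_mon E a C0).
by rewrite (lmNl la) (lmxx la) !oppr0 vp0 scale1r addNr.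
Qed.

Lemma ray_comm p q : pt E ray 0 p -> pt E ray 0 q -> p * q = q * p.
Proof.
case=> [c [-> _ hc]] [d [-> _ hd]]; apply: ev_comm => a /hd ra; symmetry.
apply: ev_comm => b /hc rb; rewrite (E_comm la fE) (_ : lam t a b = 0).
  by rewrite mulr0 vp0 scale1r.
move: ra rb; rewrite !subr0 => -[n ->] [m ->].
by rewrite lamZl lamZr (lmxx la) !mulr0.
Qed.

End Ray.

Section Peel.
Variables (t : qseed nu nf) (j : 'I_nu) (E : G -> K) (l : G -> int) (q : K).
Hypothesis qt : is_quantum_seed t.
Hypothesis fE : frame (lam t) E.
Hypothesis lD : forall a b, l (a + b) = l a + l b.
Hypothesis lZ : forall (a : int) b, l (a *: b) = a * l b.
Hypothesis lj : l (yk t j) = 0.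
Hypothesis hq : laurent_on E (fun a => 0 < l a) (q - 1).
Hypothesis hq' : laurent (mutf t j E) q.
Let E' := mutf t j E.
Let fE' : frame (lam (mutate t j)) E' := frame_mutf Ksf j qt fE.

(* The lowest l-part of x is the lowest l-part of the S-expansion of q * x. *)
Lemma peel x : laurent E x -> laurent E' (q * x) -> laurent E' x.
Proof.
case=> c ->; move: {2}#|`msupp c|.+1 (ltnSn #|`msupp c|) => n.
elim: n c => // n IH c; rewrite ltnS => hn hqc.
have [->|/eqP/msupp_ex [m0 hm0 _]] := eqVneq c 0; first by rewrite ev0; exists 0; rewrite ev0.
have [m [mc hm]] := seq_min l hm0.
have [c1 [c2 [ec hc1 hc2]]] := msplit (fun a => l a = l m) c.
have Eq : laurent E q.
  rewrite -[q](subrK 1); apply: lpD; last exact: lp1 fE.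
  by case: hq => d [-> _]; exists d.
have [a ea] : laurent (sbasis t j E) (q * ev E c).
  by apply: (Sb_span Ksf qt fE) => //; apply: (lpM fE) => //; exists c.
have [a1 [a2 [eaa ha1 ha2]]] := msplit (fun b => l b = l m) a.
have Sl b : laurent_on E (fun d => l d = l b) (sbasis t j E b).
  apply: lpl_sub (pt_lpl (pt_Sb j qt fE b)) => d [p] /eqP.
  by rewrite subr_eq => /eqP ->; rewrite lD lZ lj mulr0 add0r.
(* Since q is 1 up to higher l-parts and the elements of [sbasis] are homogeneous for l, the
   difference is concentrated in l-degree l m and also has no term there. *)
have e1 : ev E c1 = ev (sbasis t j E) a1.
  apply/eqP; rewrite -subr_eq0; apply/eqP.
  apply: (lpl_disj fE (Q1 := fun d => l d = l m) (Q2 := fun d => l d <> l m)) => //.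
    apply: lplB; apply: lpl_ev => b; first by move=> /hc1 [_ h]; apply: lplU.
    by move=> /ha1 [_ <-]; apply: Sl.
  have -> : ev E c1 - ev (sbasis t j E) a1 =
      ev (sbasis t j E) a2 - (q - 1) * ev E c1 - q * ev E c2.
    move: ea; rewrite ec eaa !evD mulrDr mulrBl mul1r.
    move: (ev E c1) (q * ev E c1) (q * ev E c2) (ev (sbasis t j E) a1) (ev (sbasis t j E) a2) => z1 x1 x2 y1 y2 e.
    by rewrite opprB (addrA y2) -(addrA (y2 + z1)) -opprD e opprD (addrC y2) addrACA subrr addr0.
  have l1 : laurent_on E (fun d => l d = l m) (ev E c1).
    by apply: lpl_ev => b /hc1 [_ h]; apply: lplU.
  have l2 : laurent_on E (fun d => l m < l d) (ev E c2).
    apply: lpl_ev => b /hc2 [bc h]; apply: lplU; rewrite lt_neqAle hm // andbT.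
    by apply/eqP => e; apply: h.
  have gt (z : K) : laurent_on E (fun d => l m < l d) z -> laurent_on E (fun d => l d <> l m) z.
    by apply: lpl_sub => d h e; rewrite e ltxx in h.
  apply: lplB; [apply: lplB|].
  - by apply: lpl_ev => b /ha2 [_ h]; apply: lpl_sub (Sl b) => d ->.
  - apply/gt/(lplM fE _ hq l1) => d1 d2 h1 h2; by rewrite lD h2 ltrDr.
  apply: gt; rewrite -[q](subrK 1) mulrDl mul1r; apply: lplD => //.
  apply: (lplM fE _ hq l2) => d1 d2 h1 h2; rewrite lD; exact: ltr_wpDl (ltW h1) h2.
have h1 : laurent E' (ev E c1).
  rewrite e1; apply: lp_ev => b _; exact: pt_lp (pt_Sb' Ksf j qt fE b).
rewrite ec evD; apply: lpD => //; apply: IH.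
  apply: leq_trans hn; apply: fproper_ltn_card; rewrite fproperE; apply/andP; split.
    by apply/fsubsetP => b /hc2 [].
  by apply/fsubsetPn; exists m => //; apply/negP => /hc2 [_]; apply.
rewrite (_ : q * ev E c2 = q * ev E c - q * ev E c1).
  by apply: lpB => //; apply: (lpM fE').
by rewrite ec evD mulrDr addrC addKr.
Qed.

End Peel.

Section TwoDirections.
Variables (t : qseed nu nf) (k j : 'I_nu) (E : G -> K).
Hypothesis qt : is_quantum_seed t.
Hypothesis fE : frame (lam t) E.
Hypothesis njk : j != k.
Let tk := mutate t k.
Let Ek := mutf t k E.
Let qtk : is_quantum_seed tk := (mutate_quantum qt k).1.
Let fEk : frame (lam tk) Ek := frame_mutf Ksf k qt fE.
Let Ekj := mutf tk j Ek.
Let fEkj : frame (lam (mutate tk j)) Ekj := frame_mutf Ksf j qtk fEk.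
Let uj := uf nf j.
Let uk := uf nf k.

(** The exchange binomial of X_k is read from the end that makes j-exponents grow: y is plus or
    minus y_k with j-coordinate |b_jk|, and the leading exponent nn does not involve j. *)
Let sg := 0 <= Bt t uj k.
Let nn : G := if sg then gm t k else gm tk k.
Let y : G := if sg then yk t k else - yk t k.
Let ps m : G := m0 k m + m uk 0 *: nn.

Let njk' : uj != uk. Proof. by rewrite uf_eq. Qed.

Let gmj : gm t k uj 0 = posp (- Bt t uj k).
Proof. by rewrite /gm fmutE (negbTE njk') oppr0 add0r. Qed.

Let nn_j : nn uj 0 = 0.
Proof.
rewrite /nn; case: ifP; rewrite /sg => h; first by rewrite gmj /posp; lia.
by rewrite gm_mutate // cvD ykE gmj /posp; lia.
Qed.

Let y_j : y uj 0 = `|Bt t uj k|.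
Proof. by rewrite /y; case: ifP; rewrite /sg ?cvN ykE; lia. Qed.

Let y_0 : y <> 0.
Proof.
rewrite /y; case: ifP => _ //; first exact: yk_neq0.
by move=> /eqP; rewrite oppr_eq0 => /eqP; apply: yk_neq0.
Qed.

Let ps_j m : ps m uj 0 = m uj 0.
Proof. by rewrite /ps cvD cvZ nn_j mulr0 addr0 m0_def cvD cvN cvZ fbE (negbTE njk') mulr0 subr0. Qed.

Let psP m : ps m = if sg then Pm t k m else Pm tk k m.
Proof. by rewrite /ps /nn; case: ifP => _; rewrite m0_Pm. Qed.

Let EkK : mutf tk k Ek = E.
Proof. exact: mutf_mutfK. Qed.

Let ptE m : 0 <= m uk 0 -> pt Ek (ray y) (ps m) (E m).
Proof.
move=> h; rewrite psP /y -EkK; case: ifP => _.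
  have -> : Pm t k m = Pm tk k m + m uk 0 *: yk tk k.
    by rewrite -(Pm_mutate _ _ qtk) mutateK.
  apply: pt_sub (pt_mutf_op qtk fEk h) => a [n e]; exists n.
  by rewrite -[a]opprK e yk_mutate // scalerN opprK.
by apply: pt_sub (pt_mutf qtk fEk h) => a [n ->]; exists n; rewrite yk_mutate.
Qed.

Let lev0 x : laurent_on Ek (fun a => 0 <= a uj 0) x -> laurent Ekj x.
Proof.
by case=> c [-> hc]; apply: lp_ev => m /hc h; apply: (lp_mutf_ge0 Ksf qtk fEk).
Qed.

Let rayq q : pt Ek (ray y) 0 q -> laurent Ekj q.
Proof.
move=> hq; apply: lev0; apply: lpl_sub (pt_lpl hq) => a [n]; rewrite subr0 => ->.
by rewrite cvZ y_j mulr_ge0.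
Qed.

(** Negative powers of X_k are not Laurent in mu_k t, but each factor X_k^-1 is cleared by the
    normalized binomial p. Conjugation by X^nn keeps the denominator pointed at 0 on the left. *)
Let exq d m : m uk 0 = - d%:Z -> exists q, pt Ek (ray y) 0 q /\
  laurent_on Ek (fun a => m uj 0 <= a uj 0) (q * E m).
Proof.
elim: d m => [|d IH] m hm.
  exists 1; split; last first.
    by rewrite mul1r -(mutf_id t E (k := k)) ?hm ?oppr0 //; apply: lplU.
  exact: (ray_one fEk y_0).
pose m1 := m + fb uk.
have [|q [hq lq]] := IH m1; first by rewrite cvD hm fbE eqxx mulr1n intS; ring.
have m1j : m1 uj 0 = m uj 0 by rewrite cvD fbE (negbTE njk') addr0.
have hf : pt Ek (ray y) nn (E (fb uk)).
  have := @ptE (fb uk); rewrite /ps fbE eqxx m0_def fbE eqxx !scale1r subrr add0r; exact.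
pose p := E (fb uk) * Ek (- nn).
have hp : pt Ek (ray y) 0 p.
  have := ptM fEk (pcone_ray y_0) hf (pt_mon Ek (- nn) _); rewrite (lmNr (lam_alt qtk)) (lmxx (lam_alt qtk)).
  by rewrite !oppr0 vp0 scale1r addrN; apply; case: (pcone_ray y_0).
exists (Ek (- nn) * (q * p) * Ek nn); split.
  by apply: (ray_conj qtk fEk y_0); apply: (ray_mul fEk y_0).
have -> : Ek (- nn) * (q * p) * Ek nn * E m =
   vp (lam t (fb uk) m) *: (Ek (- nn) * (q * E m1)).
  have e : Ek (- nn) * Ek nn = 1.
    by have [E0 EM _] := fEk; rewrite EM addNr E0 (lmNl (lam_alt qtk)) (lmxx (lam_alt qtk)) oppr0 vp0 scale1r.
  rewrite /p -!mulrA (mulrA (Ek (- nn)) (Ek nn)) e mul1r; case: fE => _ -> _.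
  by rewrite addrC -!scalerAr.
apply: lplZ; rewrite -m1j.
apply: (lplM fEk (Q1 := fun a => a uj 0 = 0) _ _ lq).
  by move=> a b h1 h2; rewrite (cvD a b) h1 add0r.
by apply: lplU; rewrite cvN nn_j oppr0.
Qed.

Let tail m : m uj 0 = -1 -> 0 <= m uk 0 -> (0 < y uj 0 \/ m uk 0 = 0) ->
  laurent Ekj (E m - Ek (ps m)).
Proof.
move=> h1 h2 [h3|h3].
  apply: lev0; apply: lpl_sub (pt_tail (ptE h2)) => a [[n] /eqP].
  rewrite subr_eq => /eqP -> ne; rewrite cvD cvZ ps_j h1.
  case: n ne => [|n] ne; first by rewrite scale0r add0r in ne.
  by rewrite intS; nia.
have -> : Ek (ps m) = E m by rewrite /ps h3 scale0r addr0 m0_id // /Ek mutf_id.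
by rewrite subrr; exists 0; rewrite ev0.
Qed.

Let Fm_delta (s : qseed nu nf) : is_quantum_seed s -> Bt s uk j <= 0 ->
  Fm s k (delta_mx j 0) = delta_mx j 0.
Proof.
move=> qs h; apply/colP => i; rewrite FmE; case: eqP => [->|//].
rewrite (bigD1 j) //= big1 => [|l nl]; last by rewrite mxE (negbTE nl) mulr0.
rewrite mxE !eqxx mulr1 mxE eq_sym (negbTE njk) subr0 addr0.
by move: h; rewrite -/uk /posp /= mulr0n; lia.
Qed.

Let sgn_kj : (0 < Bt t uj k -> Bt t uk j < 0) /\ (Bt t uj k < 0 -> 0 < Bt t uk j) /\
   (Bt t uj k = 0 -> Bt t uk j = 0).
Proof.
have := dB_skew qt j k; have := dprime_gt0 qt j; have := dprime_gt0 qt k.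
rewrite -/uj -/uk; move: (dprime t j) (dprime t k) (Bt t uj k) (Bt t uk j) => a b x z.
by move=> ? ?; nia.
Qed.

Let ps_y : ps (yk t j) = yk tk j.
Proof.
have [s1 [s2 s3]] := sgn_kj.
rewrite psP /sg; case: ifP => h.
  rewrite /yk (Pm_B qt) (Fm_delta qt) //.
  by have [h2|h2] := eqVneq (Bt t uj k) 0; [rewrite s3|apply/ltW/s1; lia].
have := Pm_Bt qtk k (delta_mx j 0); rewrite -/tk mutateK //.
rewrite Fm_delta //; rewrite BtmE eqxx /=; have := s2; lia.
Qed.

(** The leading terms of the two exchange monomials form the exchange binomial of mu_j at mu_k t,
    because [ps] sends y_j to its mutated counterpart; the tails have nonnegative j-exponents. *)
Let W_in : laurent Ekj (mutf t j E (fb uj)).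
Proof.
have [s1 [s2 s3]] := sgn_kj.
rewrite (mutf_fb _ fE) /mutW.
have g_j : gm t j uj 0 = -1 := gm_k j qt.
have gk : gm t j uk 0 = posp (- Bt t uk j).
  by rewrite /gm fmutE uf_eq eq_sym (negbTE njk) oppr0 add0r.
have psD a b : ps (a + b) = ps a + ps b.
  by rewrite /ps m0D cvD scalerDl addrACA.
have t1 : laurent Ekj (E (gm t j) - Ek (ps (gm t j))).
  apply: tail; rewrite ?gk ?posp_ge0 // y_j.
  by have [e|e] := eqVneq (Bt t uj k) 0; [right; rewrite s3|left; rewrite normr_gt0].
have t2 : laurent Ekj (E (gm t j + yk t j) - Ek (ps (gm t j + yk t j))).
  have ek : (gm t j + yk t j) uk 0 = posp (Bt t uk j) by rewrite cvD gk ykE pospN subrK.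
  apply: tail; rewrite ?ek ?posp_ge0 //; first by rewrite cvD g_j yk_k // addr0.
  rewrite y_j.
  by have [e|e] := eqVneq (Bt t uj k) 0; [right; rewrite s3|left; rewrite normr_gt0].
have t3 : laurent Ekj (Ek (ps (gm t j)) + Ek (ps (gm t j + yk t j))).
  rewrite psD ps_y; pose M := Pm tk j (ps (gm t j)).
  have e : ps (gm t j) = Pm tk j M by rewrite /M PmK.
  rewrite e -(mutf_1 qtk fEk); first exact: lpU.
  by rewrite /M (PmE qtk) eqxx -/uj ps_j g_j opprK.
have := lpD (lpD t1 t2) t3; move: (Ek _) (Ek _) (E _) (E _) => a b c d.
by rewrite [d - b + _]addrACA -opprD subrK.
Qed.

Let exS m : exists q, pt Ek (ray y) 0 q /\ laurent Ekj (q * sbasis t j E m).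
Proof.
have pos m' : 0 <= m' uj 0 -> exists q, pt Ek (ray y) 0 q /\ laurent Ekj (q * E m').
  move=> h; have [h2|h2] := leP 0 (m' uk 0).
    exists 1; split.
      exact: (ray_one fEk y_0).
    rewrite mul1r; apply: lev0; apply: lpl_sub (pt_lpl (ptE h2)) => a [n] /eqP.
    rewrite subr_eq => /eqP ->; rewrite cvD cvZ ps_j y_j; by rewrite addr_ge0 // mulr_ge0.
  have [|q [hq lq]] := @exq (absz (m' uk 0)) m'; first by lia.
  exists q; split=> //; apply: lev0; apply: lpl_sub lq => a; exact: le_trans.
have [h|h] := leP 0 (m uj 0); first by rewrite Sb_ge0 //; apply: pos.
rewrite Sb_le0 ?ltW //; set m' := trop t j m.
have hm' : 0 <= m' uj 0 by rewrite /m' trop_k oppr_ge0 ltW.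
have [|q [hq lq]] := pos (m0 j m'); first by rewrite m0_k.
exists q; split=> //; rewrite /mutf -scalerAr mulrA; apply/lpZ/(lpM fEkj) => //.
rewrite -(mutf_fb _ fE) -(gez0_abs hm') /= ; elim: (absz _) => [|n IH].
  by rewrite expr0z; apply: lp1 fEkj.
by rewrite exprSz; apply: (lpM fEkj W_in).
Qed.

(** Each of the finitely many [sbasis] terms of x, for direction j, has a denominator on the ray;
    these commute, so their product q works for x, and [peel] removes it. *)
Lemma upper_bound x : laurent E x -> laurent (mutf t j E) x -> laurent Ek x -> laurent Ekj x.
Proof.
move=> h1 h2 h3; have [a ea] := Sb_span Ksf qt fE h1 h2.
have [q [hq lq]] : exists q, pt Ek (ray y) 0 q /\ laurent Ekj (q * x).
  have [q [hq lq]] : exists q, pt Ek (ray y) 0 q /\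
     forall m, m \in (msupp a : seq G) -> laurent Ekj (q * sbasis t j E m).
    elim: (msupp a : seq G) => [|m s [q [hq lq]]].
      exists 1; split=> //.
      exact: (ray_one fEk y_0).
    have [q' [hq' lq']] := exS m; exists (q * q'); split; first exact: (ray_mul fEk y_0).
    move=> m'; rewrite inE => /orP[/eqP ->|/lq h].
      by rewrite -mulrA; apply: (lpM fEkj) => //; apply: rayq.
    by rewrite (ray_comm qtk fEk hq hq') -mulrA; apply: (lpM fEkj) => //; apply: rayq.
  exists q; split=> //; rewrite ea /ev mulr_sumr big_seq.
  elim/big_ind: _; [exact: lp0|exact: lpD|] => m /lq h.
  by rewrite -scalerAr; apply: lpZ.
(* This sign makes lambda against f_k positive along the ray. The same form vanishes on y_j, as
   [peel] requires. *)
pose s : int := if sg then -1 else 1.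
apply: (@peel tk j Ek (fun m => s * lam tk m (fb uk)) q qtk fEk) => //.
- by move=> a1 b1; rewrite lamDl mulrDr.
- by move=> a1 b1; rewrite lamZl mulrCA.
- by rewrite lam_yk // fbE -/uj (negbTE njk') !mulr0.
- have [e0 _ _] := fEk; rewrite -e0; apply: lpl_sub (pt_tail hq) => b [[n]].
  rewrite subr0 => -> nz; rewrite lamZl mulrCA.
  apply: mulr_gt0; first by case: n nz => //; rewrite scale0r.
  have yt : y = s *: yk tk k.
    by rewrite yk_mutate // /y /s; case: ifP => _; rewrite ?scale1r ?scaleN1r ?opprK.
  rewrite yt lamZl lam_yk // fbE eqxx mulr1 mulrA.
  have : 0 < dprime tk k by apply: dprime_gt0.
  by rewrite /s; case: ifP => _; lia.
exact: rayq.
Qed.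

End TwoDirections.

Definition in_upper_bound t E x : Prop := laurent E x /\ forall j, laurent (mutf t j E) x.

Lemma uca_mutf t E k x : is_quantum_seed t -> frame (lam t) E ->
  in_upper_bound t E x -> in_upper_bound (mutate t k) (mutf t k E) x.
Proof.
move=> qt fE [h1 h2]; split=> // j; have [->|njk] := eqVneq j k.
  by rewrite mutf_mutfK.
exact: upper_bound.
Qed.

Lemma uca_mutf_seq t E ks x : is_quantum_seed t -> frame (lam t) E ->
  in_upper_bound t E x -> in_upper_bound (mutate_seq t ks) (mutf_seq t E ks) x.
Proof.
elim: ks t E => //= k ks IH t E qt fE h; apply: IH; last exact: uca_mutf.
  by case: (mutate_quantum qt k).
exact: frame_mutf.
Qed.

End UpperBound.

Lemma mcoeff_sumZ {R : comNzRingType} {G : zmodType} (b : {malg R[G]}) (f : G -> R)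
    (p : G -> {malg R[G]}) m h : h \in msupp b -> f h = 1 ->
  (\sum_(i <- msupp b) f i *: p i)@_m =
  (p h)@_m + \sum_(i <- msupp b | i != h) f i * (p i)@_m.
Proof.
move=> hh fh; rewrite mcoeff_sum (bigD1_seq h hh (fset_uniq _)) /= mcoeffZ fh mul1r.
by congr (_ + _); apply: eq_bigr => i _; rewrite mcoeffZ.
Qed.

(** * Heights in the dominance order *)

Section Height.
Context {nu nf : nat}.
Notation G := 'cV[int]_(nu + nf).
Implicit Types (t : qseed nu nf) (a b : G).

Definition height t a (p : nat) : Prop :=
  exists n : 'cV[int]_nu, [/\ a = Bt t *m n, forall j, 0 <= n j 0 & \sum_j n j 0 = p%:Z].

Lemma hgt_ex t a : dom_cone t a -> exists p, height t a p.
Proof.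
case/domcE => n [-> hn]; exists (absz (\sum_j n j 0)); exists n; split=> //.
by rewrite gez0_abs // sumr_ge0.
Qed.

Lemma hgtD t a b p q r : is_quantum_seed t -> height t a p -> height t b q -> height t (a + b) r ->
  r = (p + q)%N.
Proof.
move=> qt [n [-> _ hp]] [m [-> _ hq]] [k [e _ hr]].
have {}e : k = n + m by apply: (B_inj2 qt); rewrite mulmxDr.
move: hr; rewrite e (eq_bigr (fun j => n j 0 + m j 0)); last by move=> j _; rewrite cvD.
by rewrite big_split /= hp hq; lia.
Qed.

Lemma hgt_gt0 t a p : height t a p -> a <> 0 -> (0 < p)%N.
Proof.
case=> n [-> hn hp] nz; rewrite lt0n; apply/eqP => p0; apply: nz.
rewrite (_ : n = 0) ?mulmx0 //; apply/colP => j; rewrite mxE; apply/eqP.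
have := hp; rewrite p0 => /eqP; rewrite psumr_eq0 => [/allP /(_ j)|i _]; last exact: hn.
by apply; rewrite mem_index_enum.
Qed.

(** This sign makes the v-exponents produced by multiplication nonpositive below the leading degree,
    so that coefficients in m stay there. *)
Lemma lam_domc t a b : is_quantum_seed t -> dom_cone t b -> (forall j, 0 <= a (uf nf j) 0) ->
  lam t a b <= 0.
Proof.
move=> qt /domcE [n [-> hn]] ha; rewrite lamBr // oppr_le0; apply: sumr_ge0 => j _.
by apply: mulr_ge0 => //; apply: mulr_ge0 => //; apply/ltW/dprime_gt0.
Qed.

Lemma lam_dom0 t a b : is_quantum_seed t -> dom_cone t b -> (forall j, a (uf nf j) 0 = 0) ->
  lam t a b = 0.
Proof.
move=> qt /domcE [n [-> _]] ha; rewrite lamBr // big1 ?oppr0 // => j _.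
by rewrite ha mulr0.
Qed.

Lemma domc0 t : is_quantum_seed t -> dom_cone t 0.
Proof. by move=> qt; case: (pcone_dom qt). Qed.

Lemma domcD t a b : is_quantum_seed t -> dom_cone t a -> dom_cone t b -> dom_cone t (a + b).
Proof. by move=> qt; case: (pcone_dom qt) => _ h _; apply: h. Qed.

End Height.

(** * Triangular families *)

Section Family.
Context {R : vring} {K : unitAlgType R} {nu nf : nat}.
Notation G := 'cV[int]_(nu + nf).
Implicit Types (E Lg : G -> K) (g h a m : G) (z : K).

(* The shape of the right-hand side in the triangularity axiom (4). *)
Definition Tri (t : qseed nu nf) E Lg g z : Prop :=
  pt E (dom_cone t) g z /\ exists b, z = ev Lg b /\ forall h, h != g -> vmm b@_h.

(** Kept apart from [tfam] because at mu_k t these properties are available before triangularity. *)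
Record pfam (t : qseed nu nf) E Lg : Prop := PFam {
  pf_qt : is_quantum_seed t;
  pf_fr : frame (lam t) E;
  pf_pt : forall g, pt E (dom_cone t) g (Lg g);
  pf_bar : forall g, barinv E (Lg g)
}.

(** [tf_T3] is axiom (4) with the v-power that makes the product pointed. Of the subalgebra only
    closure of the span under products is kept, as [tf_mul]. *)
Record tfam (t : qseed nu nf) E Lg : Prop := TFam {
  tf_p :> pfam t E Lg;
  tf_T3 : forall i g, Tri t E Lg (fb i + g) (vp (- lam t (fb i) g) *: (E (fb i) * Lg g));
  tf_T4 : forall m, (forall i, 0 <= m i 0) -> E m = Lg m;
  tf_mul : forall g h, laurent Lg (Lg g * Lg h)
}.

Hypothesis Ksf : forall z : K, z != 0 -> z \is a GRing.unit.
Section PFamily.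
Variables (t : qseed nu nf) (E Lg : G -> K).
Hypothesis pf : pfam t E Lg.
Let qt : is_quantum_seed t := pf_qt pf.
Let fE : frame (lam t) E := pf_fr pf.
Let hC := pcone_dom qt.
Let Lpt := pf_pt pf.
Let C0 : dom_cone t 0 := domc0 qt.

Lemma L_inj b1 b2 : ev Lg b1 = ev Lg b2 -> b1 = b2.
Proof. exact: (ev_inj_pt fE hC Lpt (@inj_id G)). Qed.

Lemma Tri_L g : Tri t E Lg g (Lg g).
Proof.
split; first exact: Lpt.
exists (mkmalgU g 1); split; first by rewrite evU scale1r.
by move=> h nh; rewrite mcoeffU eq_sym (negbTE nh) mulr0n; apply: vmm0.
Qed.

Lemma Tri_supp g z : Tri t E Lg g z -> exists b, [/\ z = ev Lg b, b@_g = 1,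
  forall h, h != g -> vmm b@_h & forall h, h \in msupp b -> dom_cone t (h - g)].
Proof.
case=> [[c [-> c1 hc]] [b [e hb]]]; exists b; split=> //.
  by rewrite -(triang_coef fE hC Lpt (@inj_id G) (esym e) hc).
by apply: (triang_supp fE hC Lpt (@inj_id G) (esym e) hc).
Qed.

(** The lower coefficients lie in m and are bar-invariant, hence zero. This is how products of
    monomials are recognized as members of L. *)
Lemma Tri_bar g z : Tri t E Lg g z -> barinv E z -> z = Lg g.
Proof.
case/Tri_supp => b [-> b1 hb _] bz.
have h := (barinv_coord fE b hC Lpt (@inj_id G) (pf_bar pf)).1 bz.
rewrite (_ : b = mkmalgU g 1) ?evU ?scale1r //; apply/malgP => a.
rewrite mcoeffU; have [<-|na] := eqVneq g a; first by rewrite b1 mulr1n.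
by apply: vmm_bar; [apply: hb; rewrite eq_sym|exact: h].
Qed.

Lemma L_eq g h k z : pt E (dom_cone t) g z -> z = k *: Lg h -> z = Lg g.
Proof.
move=> hz e; have [k0|nk] := eqVneq k 0.
  by have := pn_neq0 fE (pt_pn hz); rewrite e k0 scale0r eqxx.
have gh := pn_uniq fE hC (pt_pn hz); rewrite e in gh.
have {gh} gh := gh _ (pnZ Ksf fE nk (pt_pn (Lpt h))); subst h.
have [c [e1 c1 _]] := hz; have [d [e2 d1 _]] := Lpt g.
have ecd : c = k *: d by apply: (ev_inj fE); rewrite evZ -e1 -e2.
by rewrite e (_ : k = 1) ?scale1r //; rewrite -c1 ecd mcoeffZ d1 mulr1.
Qed.

(** A lower coefficient in m is multiplied by v^(e h - e g) with e h <= e g, then by a coefficient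
    that is 1 or in m; it stays in m throughout. *)
Lemma Tri_map (Phi : K -> K) c (e : G -> int) g z : linear Phi -> Tri t E Lg g z ->
  (forall h, dom_cone t (h - g) -> e h <= e g /\ Tri t E Lg (c + h) (vp (- e h) *: Phi (Lg h))) ->
  pt E (dom_cone t) (c + g) (vp (- e g) *: Phi z) -> Tri t E Lg (c + g) (vp (- e g) *: Phi z).
Proof.
move=> lP hz hP hpt; split=> //; have [b [-> b1 hb sb]] := Tri_supp hz.
have /choice [p hp] h : exists d, dom_cone t (h - g) -> [/\ vp (- e h) *: Phi (Lg h) = ev Lg d,
   d@_(c + h) = 1 & forall m, m != c + h -> vmm d@_m].
  have [dh|ndh] := pselect (dom_cone t (h - g)); last by exists 0.
  by have [_ /Tri_supp [d [e1 e2 e3 _]]] := hP h dh; exists d.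
exists (\sum_(h <- msupp b) (b@_h * vp (e h - e g)) *: p h); split.
  rewrite (ev_lin _ _ lP) ev_sum {1}/ev scaler_sumr big_seq [RHS]big_seq; apply: eq_bigr => h hs.
  rewrite evZ; have [<- _ _] := hp h (sb h hs); rewrite /= !scalerA; apply: eq_scale => //.
  by rewrite -mulrA -vpD addrAC subrr add0r mulrC.
move=> m nm; rewrite mcoeff_sum; apply: vmm_sum => h hs _; rewrite mcoeffZ.
have [_ p1 hm] := hp h (sb h hs); have [le _] := hP h (sb h hs).
have [eh|nh] := eqVneq h g.
  by rewrite eh b1 subrr vp0 !mul1r -eh; apply: hm; rewrite eh.
have hbh : vmm (b@_h * vp (e h - e g)).
  by rewrite mulrC; apply: vmm_vp (hb h nh); rewrite subr_le0.
have [->|nm2] := eqVneq m (c + h); first by rewrite p1 mulr1.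
by apply: vmmM => //; apply: hm.
Qed.

(* Phi is controlled on the elements J h, from which the Lg h are recovered by an
   unitriangular, possibly infinite, recursion; the recursion is finite in each
   degree. *)
Lemma Tri_ind (Phi : K -> K) c (e : G -> int) (J : G -> K) : linear Phi ->
  (forall h, Tri t E Lg h (J h)) ->
  (forall h h', dom_cone t (h' - h) -> e h' <= e h) ->
  (forall h, pt E (dom_cone t) (c + h) (vp (- e h) *: Phi (Lg h)) /\ laurent Lg (Phi (Lg h))) ->
  (forall h, Tri t E Lg (c + h) (vp (- e h) *: Phi (J h))) ->
  forall h, Tri t E Lg (c + h) (vp (- e h) *: Phi (Lg h)).
Proof.
move=> lP hJ he hL hPJ.
have /choice [p hp] h : exists d, [/\ vp (- e h) *: Phi (Lg h) = ev Lg d, d@_(c + h) = 1 &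
    forall m, m \in msupp d -> dom_cone t (m - (c + h))].
  have [h1 [d ed]] := hL h; exists (vp (- e h) *: d).
  have {}ed : vp (- e h) *: Phi (Lg h) = ev Lg (vp (- e h) *: d) by rewrite evZ -ed.
  split=> //; have [x [ex x1 hx]] := h1; rewrite ex in ed.
    by rewrite -(triang_coef fE hC Lpt (@inj_id G) (esym ed) hx).
  exact: (triang_supp fE hC Lpt (@inj_id G) (esym ed) hx).
suff key n h m : height t (m - (c + h)) n -> m != c + h -> vmm (p h)@_m.
  move=> h; split; first by case: (hL h).
  have [e1 e2 e3] := hp h; exists (p h); split=> // m nm.
  have [ms|ms] := boolP (m \in msupp (p h)); last by rewrite (mcoeff_outdom ms); apply: vmm0.
  by have [n hn] := hgt_ex (e3 m ms); apply: key hn nm.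
elim: n {-2}n (leqnn n) h m => [|N IH] n hn h m hm nm.
  have := hgt_gt0 hm; have : (m - (c + h)) <> 0 by move/eqP; rewrite subr_eq0; apply/negP.
  by move=> h1 /(_ h1); lia.
have [b [eb b1 hb sb]] := Tri_supp (hJ h); have [_ [d [ed hd]]] := hPJ h.
have ed0 : d = \sum_(h' <- msupp b) (b@_h' * vp (e h' - e h)) *: p h'.
  apply: L_inj; rewrite -ed eb (ev_lin _ _ lP) ev_sum {1}/ev scaler_sumr big_seq [RHS]big_seq.
  apply: eq_bigr => h' hs; rewrite evZ; have [<- _ _] := hp h'.
  by rewrite /= !scalerA; apply: eq_scale => //; rewrite -mulrA -vpD addrAC subrr add0r mulrC.
have hh : h \in msupp b.
  by rewrite mem_msupp b1 oner_eq0.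
have e1 : b@_h * vp (e h - e h) = 1 by rewrite b1 subrr vp0 mulr1.
have {}ed := @mcoeff_sumZ _ _ b (fun i => b@_i * vp (e i - e h)) p m h hh e1; rewrite -ed0 in ed.
(* The coefficient for [Lg h] is that for J h, corrected by terms of degrees h' strictly dominated
   by h; their distance to m has smaller height. *)
have -> : (p h)@_m = d@_m - \sum_(i <- msupp b | i != h) b@_i * vp (e i - e h) * (p i)@_m.
  by rewrite ed addrK.
apply: vmmD; first exact: hd.
apply/vmmN/vmm_sum => h' hs nh; have [_ p1 sp] := hp h'.
have hbh : vmm (b@_h' * vp (e h' - e h)).
  by rewrite mulrC; apply: vmm_vp (hb h' nh); rewrite subr_le0; apply/he/sb.
have [->|nm2] := eqVneq m (c + h'); first by rewrite p1 mulr1.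
apply: vmmM => //.
have [ms|ms] := boolP (m \in msupp (p h')); last by rewrite (mcoeff_outdom ms); apply: vmm0.
have [q hq] := hgt_ex (sp m ms); have [r hr] := hgt_ex (sb h' hs).
have r0 : (0 < r)%N by apply: hgt_gt0 hr _; move/eqP; rewrite subr_eq0; apply/negP.
have eqn : n = (q + r)%N.
  apply: (hgtD qt hq hr); rewrite (_ : _ + _ = m - (c + h)) //.
  by rewrite -addrA; congr (_ + _); rewrite !opprD -addrA; congr (_ + _); rewrite addKr.
by apply: (IH q) => //; lia.
Qed.

Lemma lin_mull (x : K) : linear (fun z => x * z).
Proof. by move=> k y z; rewrite mulrDr -scalerAr. Qed.

Lemma lin_mulr (x : K) : linear (fun z => z * x).
Proof. by move=> k y z; rewrite mulrDl -scalerAl. Qed.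

Lemma pt_mulE a g z : pt E (dom_cone t) g z -> pt E (dom_cone t) (a + g) (vp (- lam t a g) *: (E a * z)).
Proof. by move=> h; apply: (ptM fE hC) => //; apply: pt_mon. Qed.

End PFamily.

Section TFamily.
Variables (t : qseed nu nf) (E Lg : G -> K).
Hypothesis tf : tfam t E Lg.
Let qt : is_quantum_seed t := pf_qt tf.
Let fE : frame (lam t) E := pf_fr tf.
Let la := lam_alt qt.
Let Lpt := pf_pt tf.
Let C0 : dom_cone t 0 := domc0 qt.

Lemma Tri_mulE1 (a : G) : (forall j, 0 <= a (uf nf j) 0) ->
  (forall g, Tri t E Lg (a + g) (vp (- lam t a g) *: (E a * Lg g))) ->
  forall g z, Tri t E Lg g z -> Tri t E Lg (a + g) (vp (- lam t a g) *: (E a * z)).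
Proof.
move=> ha hL g z hz.
apply: (Tri_map (e := fun h => lam t a h) tf (lin_mull (E a)) hz).
  move=> h dh; split; last exact: hL.
  by rewrite -[h](subrK g) lamDr -subr_le0 addrK; apply: lam_domc.
by apply: (pt_mulE tf); case: hz.
Qed.

Lemma frozen_comm (u g : G) x : (forall j, u (uf nf j) 0 = 0) -> pt E (dom_cone t) g x ->
  E u * x = vp (2 * lam t u g) *: (x * E u).
Proof.
move=> hu [c [-> _ hc]]; rewrite /ev mulr_sumr mulr_suml scaler_sumr big_seq [RHS]big_seq.
apply: eq_bigr => a /hc da; rewrite -scalerAr -scalerAl (E_comm la fE) !(scalerA _ c@_a, scalerA c@_a).
apply: eq_scale => //; rewrite mulrC; congr (vp (2 * _) * _).
by rewrite -[a](subrK g) lamDr (lam_dom0 qt da hu) add0r.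
Qed.

Lemma barinv_frozen (u g : G) x : (forall j, u (uf nf j) 0 = 0) -> pt E (dom_cone t) g x ->
  barinv E x -> barinv E (vp (- lam t u g) *: (E u * x)).
Proof.
by move=> hu px bx; apply: (barinvM la fE) => //; [exact: barinvU|exact: frozen_comm].
Qed.

(** Frozen variables quasi-commute with pointed elements, since lambda(u, B n) = 0. The normalized
    product with one frozen variable is therefore bar-invariant as well as triangular, hence in L;
    inverses follow because [X^u] is invertible. *)
Lemma frozen_shift (u g : G) : (forall j, u (uf nf j) 0 = 0) ->
  E u * Lg g = vp (lam t u g) *: Lg (u + g).
Proof.
move=> hu; pose Q (i : 'I_(nu + nf)) := [forall j, i != uf nf j].
have hQ i : ~~ Q i -> u i 0 = 0.
  by rewrite negb_forall => /existsP [j]; rewrite negbK => /eqP ->.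
move: u hu hQ g; move=> u _ hQ; move: u hQ.
have [E0 EM _] := fE.
apply: (@cV_ind _ _ (fun u => forall g, E u * Lg g = vp (lam t u g) *: Lg (u + g)) Q).
- by move=> g; rewrite E0 mul1r lam0l vp0 scale1r add0r.
- move=> a b ha hb g; rewrite (E_add fE) -scalerAl -mulrA hb -scalerAr ha !scalerA -!vpD addrA.
  by apply: eq_scale => //; congr vp; rewrite lamDl lamDr; ring.
- move=> a ha g; apply: (mulrI (E_unit Ksf fE a)); rewrite mulrA EM addrN E0 -scalerAl mul1r.
  rewrite -scalerAr ha addrA addrN add0r scalerA -vpD; apply: eq_scale => //; congr vp.
  by rewrite lamDr (lmNr la) !(lmNl la) (lmxx la); ring.
move=> i /forallP hi g.
have hfi j : (fb i : G) (uf nf j) 0 = 0 by rewrite fbE eq_sym (negbTE (hi j)).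
rewrite -(Tri_bar tf (tf_T3 tf i g)) ?scalerA ?vpKN ?scale1r //.
exact: (barinv_frozen hfi (Lpt g) (pf_bar tf g)).
Qed.

(** Nonnegativity is required in unfrozen directions only, because frozen factors merely shift the
    index by [frozen_shift]. *)
Lemma Tri_mulE (a g : G) z : (forall j, 0 <= a (uf nf j) 0) -> Tri t E Lg g z ->
  Tri t E Lg (a + g) (vp (- lam t a g) *: (E a * z)).
Proof.
pose P a := forall g z, Tri t E Lg g z -> Tri t E Lg (a + g) (vp (- lam t a g) *: (E a * z)).
have [E0 EM _] := fE.
have P0 : P 0 by move=> g' z' h; rewrite add0r lam0l oppr0 vp0 scale1r E0 mul1r.
have PD a1 a2 : P a1 -> P a2 -> P (a1 + a2).
  move=> h1 h2 g' z' h; have := h1 _ _ (h2 _ _ h); rewrite addrA (E_add fE) -scalerAr -scalerAl !scalerA -!vpD mulrA.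
  by congr (Tri t E Lg _ (vp _ *: _)); rewrite lamDl lamDr; ring.
have Pf i : P (fb i).
  move=> g' z'; apply: Tri_mulE1; last by move=> h; apply: tf_T3.
  by move=> j; rewrite fbE.
have Pfr (u : G) : (forall j, u (uf nf j) 0 = 0) -> P u.
  move=> hu g' z'; apply: Tri_mulE1 => [j|h]; first by rewrite hu.
  by rewrite frozen_shift // scalerA vpNK scale1r; apply: (Tri_L tf).
have Pn i (n : nat) : P (n%:Z *: fb i).
  by elim: n => [|n IH]; [rewrite scale0r|rewrite intS scalerDl scale1r; apply: PD].
move=> ha; move: g z; rewrite -/(P a).
rewrite -[a](subrK (\sum_j a (uf nf j) 0 *: fb (uf nf j))); apply: (PD).
  apply: Pfr => j; rewrite cvD cvN summxE (bigD1 j) //= cvZ fbE eqxx mulr1 big1 ?addr0 ?subrr //.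
  by move=> i ni; rewrite cvZ fbE uf_eq eq_sym (negbTE ni) mulr0.
by apply: (big_ind P P0 (PD)) => j _; rewrite -(gez0_abs (ha j)).
Qed.

End TFamily.

End Family.

(** * The shifted seed and the twist *)

Section Connected.
Context {R : vring} {K : unitAlgType R} {nu nf : nat}.
Hypothesis Ksf : forall z : K, z != 0 -> z \is a GRing.unit.
Notation G := 'cV[int]_(nu + nf).
Implicit Types (t : qseed nu nf) (E : G -> K) (u : G).

Lemma mutf_seq_frozen t E ks u : (forall j, u (uf nf j) 0 = 0) -> mutf_seq t E ks u = E u.
Proof. by move=> hu; elim: ks t E => //= k ks IH t E; rewrite IH mutf_id. Qed.

Lemma mutate_seq_rev t ks : is_quantum_seed t -> mutate_seq (mutate_seq t ks) (rev ks) = t.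
Proof.
elim: ks t => //= k ks IH t qt; have [qt' _] := mutate_quantum qt k.
by rewrite rev_cons -cats1 mutate_seq_cat IH //= mutateK.
Qed.

Lemma mutf_seq_rev t E ks : is_quantum_seed t -> frame (lam t) E ->
  mutf_seq (mutate_seq t ks) (mutf_seq t E ks) (rev ks) = E.
Proof.
elim: ks t E => //= k ks IH t E qt fE; have [qt' _] := mutate_quantum qt k.
rewrite rev_cons -cats1 mutf_seq_cat mutate_seq_rev //= IH //; last exact: frame_mutf.
exact: mutf_mutfK.
Qed.

Lemma E_exp t E a n : is_quantum_seed t -> frame (lam t) E -> E a ^+ n = E (n%:Z *: a).
Proof.
move=> qt fE; have [E0 EM _] := fE; elim: n => [|n IH]; first by rewrite expr0 scale0r E0.
by rewrite exprS IH EM lamZr (lmxx (lam_alt qt)) mulr0 vp0 scale1r intS scalerDl scale1r.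
Qed.

(** Comparison of leading coefficients in a domain. Since the cone is arbitrary, one relation
    constrains the leading degrees for every order. *)
Lemma pn_comm_lam (C : G -> Prop) t E g h x y (e : int) : is_quantum_seed t ->
  frame (lam t) E -> pointed_cone C -> pn E C g x -> pn E C h y ->
  x * y = vp (2 * e) *: (y * x) -> lam t g h = e.
Proof.
move=> qt fE hC [c [ec c0 hc]] [d [ed d0 hd]] exy.
have [l1 _] := cone_lead (lam t) hC hc hd; have [l2 _] := cone_lead (lam t) hC hd hc.
have e2 : tm (lam t) c d = vp (2 * e) *: tm (lam t) d c.
  apply: (ev_inj fE); rewrite [RHS]evZ; apply: etrans (esym (evM fE c d)) _.
  by apply: etrans (eq_scale erefl (evM fE d c)); rewrite -ec -ed.
have P0 : c@_g * d@_h != 0 by apply: (kk_domain Ksf fE).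
have e3 : vp (lam t g h) * (c@_g * d@_h) = vp (2 * e - lam t g h) * (c@_g * d@_h).
  apply: etrans (esym l1) _; apply: etrans (congr1 (fun x => x@_(g + h)) e2) _.
  apply: etrans (mcoeffZ _ _ _) _; rewrite (addrC g h).
  apply: etrans (congr1 (fun z => vp (2 * e) * z) l2) _.
  by rewrite mulrA -vpD (lmC (lam_alt qt) g h) (mulrC d@_h).
apply: contrapT => ne; have nz : vp (lam t g h) - vp (2 * e - lam t g h) != 0 :> R.
  by rewrite subr_eq0; apply/eqP => /vp_inj; lia.
by have := kk_domain Ksf fE nz P0; rewrite mulrBl e3 subrr eqxx.
Qed.

End Connected.

Section Shift.
Context {R : vring} {K : unitAlgType R} {nu nf : nat}.
Notation G := 'cV[int]_(nu + nf).
Implicit Types (g h a m : G) (z : K).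

(* gd j is the degree of I_j(t). *)
Record shiftd (t : qseed nu nf) (E : G -> K) (t1 : qseed nu nf) (E1 : G -> K)
    (sg : {perm 'I_nu}) (gd : 'I_nu -> G) : Prop := Shiftd {
  sh_qt : is_quantum_seed t;
  sh_fr : frame (lam t) E;
  sh_conn : exists ks, t1 = mutate_seq t ks /\ E1 = mutf_seq t E ks;
  sh_pt : forall j, pt E (dom_cone t) (gd j) (E1 (fb (uf nf (sg j))));
  sh_uf : forall i j, gd j (uf nf i) 0 = - (i == j)%:R
}.

Hypothesis Ksf : forall z : K, z != 0 -> z \is a GRing.unit.
Variables (t : qseed nu nf) (E : G -> K) (t1 : qseed nu nf) (E1 : G -> K)
  (sg : {perm 'I_nu}) (gd : 'I_nu -> G).
Hypothesis sh : shiftd t E t1 E1 sg gd.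
Let qt : is_quantum_seed t := sh_qt sh.
Let fE : frame (lam t) E := sh_fr sh.
Let la := lam_alt qt.
Let hC := pcone_dom qt.

Lemma sh_qt1 : is_quantum_seed t1.
Proof. by have [ks [-> _]] := sh_conn sh; apply: mutate_seq_quantum. Qed.

Lemma sh_fE1 : frame (lam t1) E1.
Proof. by have [ks [-> ->]] := sh_conn sh; apply: frame_mutf_seq. Qed.

Let qt1 := sh_qt1.
Let fE1 := sh_fE1.
Let la1 := lam_alt qt1.

Lemma E1_frozen (u : G) : (forall j, u (uf nf j) 0 = 0) -> E1 u = E u.
Proof. by have [ks [_ ->]] := sh_conn sh; apply: mutf_seq_frozen. Qed.

Definition ufp m : G := \sum_j m (uf nf j) 0 *: fb (uf nf j).
(* The degree in t of X(t1)^m. *)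
Definition shift_deg m : G := locked (\sum_j m (uf nf (sg j)) 0 *: gd j + (m - ufp m)).
Notation Gm := shift_deg.

Lemma GmE m : Gm m = \sum_j m (uf nf (sg j)) 0 *: gd j + (m - ufp m).
Proof. by rewrite /shift_deg -lock. Qed.

Lemma ufp_uf m j : ufp m (uf nf j) 0 = m (uf nf j) 0.
Proof.
rewrite summxE (bigD1 j) //= cvZ fbE eqxx mulr1 big1 ?addr0 // => i ni.
by rewrite cvZ fbE uf_eq eq_sym (negbTE ni) mulr0.
Qed.

Lemma ufpD a b : ufp (a + b) = ufp a + ufp b.
Proof. by rewrite -big_split; apply: eq_bigr => j _; rewrite cvD scalerDl. Qed.

Lemma GmD a b : Gm (a + b) = Gm a + Gm b.
Proof.
rewrite !GmE ufpD opprD [a + b + _]addrACA [RHS]addrACA; congr (_ + _).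
by rewrite -big_split; apply: eq_bigr => j _; rewrite cvD scalerDl.
Qed.

Lemma Gm0 : Gm 0 = 0.
Proof. by apply: (addrI (Gm 0)); rewrite -GmD !addr0. Qed.

Lemma GmN a : Gm (- a) = - Gm a.
Proof. by apply/eqP; rewrite -addr_eq0 -GmD addNr Gm0. Qed.

Lemma GmZ (n : nat) a : Gm (n%:Z *: a) = n%:Z *: Gm a.
Proof.
elim: n => [|n IH]; first by rewrite !scale0r Gm0.
by rewrite intS !scalerDl !scale1r GmD IH.
Qed.

Lemma Gm_uf m j : Gm m (uf nf j) 0 = - m (uf nf (sg j)) 0.
Proof.
rewrite GmE cvD cvD cvN ufp_uf subrr addr0 summxE (bigD1 j) //= big1 => [|i ni].
  by rewrite cvZ (sh_uf sh) eqxx addr0 mulrN mulr1.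
by rewrite cvZ (sh_uf sh) eq_sym (negbTE ni) oppr0 mulr0.
Qed.

Lemma Gm_frozen (u : G) : (forall j, u (uf nf j) 0 = 0) -> Gm u = u.
Proof.
by move=> hu; rewrite GmE /ufp !big1 ?subr0 ?add0r // => j _; rewrite hu scale0r.
Qed.

Lemma Gm_fb j : Gm (fb (uf nf (sg j))) = gd j.
Proof.
have -> : Gm (fb (uf nf (sg j))) = gd j + (fb (uf nf (sg j)) - ufp (fb (uf nf (sg j)))).
  rewrite GmE; congr (_ + _); rewrite (bigD1 j) //= fbE eqxx scale1r big1 ?addr0 // => i ni.
  by rewrite fbE uf_eq (inj_eq perm_inj) (negbTE ni) scale0r.
rewrite /ufp (bigD1 (sg j)) //= fbE eqxx scale1r big1 ?addr0 ?subrr ?addr0 // => i ni.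
by rewrite fbE uf_eq (negbTE ni) scale0r.
Qed.

Lemma Gm_surj x : exists m, Gm m = x.
Proof.
exists (- (\sum_j x (uf nf j) 0 *: fb (uf nf (sg j))) + (x + \sum_j x (uf nf j) 0 *: gd j)).
rewrite GmD GmN [X in _ + X]Gm_frozen => [|j]; last first.
  rewrite cvD summxE (bigD1 j) //= cvZ (sh_uf sh) eqxx big1 ?addr0 ?mulrN1 ?subrr // => i ni.
  by rewrite cvZ (sh_uf sh) eq_sym (negbTE ni) oppr0 mulr0.
rewrite (big_morph Gm GmD Gm0) addrC -addrA -[RHS]addr0; congr (_ + _).
apply/eqP; rewrite subr_eq0; apply/eqP/eq_bigr => j _.
have GmZ' (a : int) b : Gm (a *: b) = a *: Gm b.
  by case: a => n; rewrite ?NegzE ?scaleNr ?GmN GmZ.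
by rewrite GmZ' Gm_fb.
Qed.

Let pt_gen i : pt E (dom_cone t) (Gm (fb i)) (E1 (fb i)).
Proof.
have [/existsP [j /eqP ->]|] := boolP [exists j, i == uf nf j].
  by rewrite -[j](permKV sg) Gm_fb; apply: (sh_pt sh).
rewrite negb_exists => /forallP h.
have hu j : (fb i : G) (uf nf j) 0 = 0 by rewrite fbE eq_sym (negbTE (h j)).
by rewrite Gm_frozen // E1_frozen //; apply: pt_mon; apply: domc0.
Qed.

(** The variables of t1 quasi-commute with exponents given by Lambda(t1), and their leading degrees
    in t inherit these exponents by [pn_comm_lam]. *)
Lemma Gm_lam a b : lam t (Gm a) (Gm b) = lam t1 a b.
Proof.
have gen i j : lam t (Gm (fb i)) (Gm (fb j)) = lam t1 (fb i) (fb j).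
  by apply: (pn_comm_lam Ksf qt fE hC (pt_pn (pt_gen i)) (pt_pn (pt_gen j))); apply: (E_comm la1 fE1).
have h i : forall b, lam t (Gm (fb i)) (Gm b) = lam t1 (fb i) b.
  move=> b'; apply: (@cV_ind _ _ (fun b => lam t (Gm (fb i)) (Gm b) = lam t1 (fb i) b) xpredT) => //.
  - by rewrite Gm0 !lam0r.
  - by move=> x y hx hy; rewrite GmD (lamDr t (Gm (fb i))) (lamDr t1 (fb i)) hx hy.
  by move=> x hx; rewrite GmN (lmNr la) (lmNr la1) hx.
apply: (@cV_ind _ _ (fun a => lam t (Gm a) (Gm b) = lam t1 a b) xpredT) => //.
- by rewrite Gm0 !lam0l.
- by move=> x y hx hy; rewrite GmD (lamDl t (Gm x)) (lamDl t1 x) hx hy.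
by move=> x hx; rewrite GmN (lmNl la) (lmNl la1) hx.
Qed.

Lemma ufp_split m : exists u, m = \sum_j m (uf nf j) 0 *: fb (uf nf j) + u /\ forall j, u (uf nf j) 0 = 0.
Proof.
exists (m - ufp m); split; first by rewrite -/(ufp m) addrC subrK.
by move=> j; rewrite cvD cvN ufp_uf subrr.
Qed.

Lemma pt_E1 m : (forall j, 0 <= m (uf nf j) 0) -> pt E (dom_cone t) (Gm m) (E1 m).
Proof.
move=> hm; pose P m := pt E (dom_cone t) (Gm m) (E1 m).
have PD a b : P a -> P b -> P (a + b).
  rewrite /P => ha hb; rewrite GmD (E_add fE1) -Gm_lam; exact: (ptM fE hC).
have P0 : P 0 by rewrite /P Gm0 (_ : E1 0 = E 0); [apply/pt_mon/domc0|case: fE1 => ->; case: fE => ->].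
have Pn i (n : nat) : P (n%:Z *: fb i).
  elim: n => [|n IH]; first by rewrite scale0r.
  by rewrite intS scalerDl scale1r; apply: (PD) => //; apply: pt_gen.
have [u [e hu]] := ufp_split m; rewrite -/(P m) e; apply: (PD).
  by apply: (big_ind P P0 (PD)) => j _; rewrite -(gez0_abs (hm j)).
by rewrite /P Gm_frozen // E1_frozen //; apply/pt_mon/domc0.
Qed.

End Shift.

Section Core.
Context {R : vring} {K : unitAlgType R} {nu nf : nat}.
Notation G := 'cV[int]_(nu + nf).
Implicit Types (g h a m : G) (z : K).

(* tau is the map induced by the twist on degrees: tw X(t)^m = X(t1)^(tau m). *)
Record core (t : qseed nu nf) (E : G -> K) (t1 : qseed nu nf) (E1 : G -> K)
    (sg : {perm 'I_nu}) (gd : 'I_nu -> G) (Lg : G -> K) (tw : K -> K) (tau : G -> G) : Prop := Core {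
  c_tf : tfam t E Lg;
  c_sh : shiftd t E t1 E1 sg gd;
  c_B : forall i j, Bt t1 (uf nf (sg i)) (sg j) = Bt t (uf nf i) j;
  c_d : forall j, dprime t1 (sg j) = dprime t j;
  c_lp : forall js g, laurent (mutf_seq t E js) (Lg g);
  c_twl : linear tw;
  c_twM : {morph tw : x y / x * y};
  c_twi : injective tw;
  c_twL : forall g, exists h, tw (Lg g) = Lg h;
  c_twLs : forall h, exists g, tw (Lg g) = Lg h;
  c_tau : forall m, tw (E m) = E1 (tau m);
  c_tauD : forall a b, tau (a + b) = tau a + tau b;
  c_tauc : forall m j, tau m (uf nf (sg j)) 0 = m (uf nf j) 0;
  c_tauy : forall j, tau (yk t j) = yk t1 (sg j)
}.

Hypothesis Ksf : forall z : K, z != 0 -> z \is a GRing.unit.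
Variables (t : qseed nu nf) (E : G -> K) (t1 : qseed nu nf) (E1 : G -> K)
  (sg : {perm 'I_nu}) (gd : 'I_nu -> G) (Lg : G -> K) (tw : K -> K) (tau : G -> G).
Hypothesis co : core t E t1 E1 sg gd Lg tw tau.
Let tf := c_tf co.
Let qt : is_quantum_seed t := pf_qt tf.
Let fE : frame (lam t) E := pf_fr tf.
Let la := lam_alt qt.
Let hC := pcone_dom qt.
Let Lpt := pf_pt tf.

Let sh := c_sh co.
Let fE1 : frame (lam t1) E1 := sh_fE1 Ksf sh.
Notation Gm := (shift_deg sg gd).

(** The twist sends a cluster monomial of t, which lies in L, to X(t1)^m up to a frozen factor, and
    frozen factors only shift indices in L. *)
Lemma E1_L m : (forall j, 0 <= m (uf nf j) 0) -> E1 m = Lg (Gm m).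
Proof.
move=> hm; pose m' : G := \sum_j m (uf nf (sg j)) 0 *: fb (uf nf j).
have m'uf j : m' (uf nf j) 0 = m (uf nf (sg j)) 0.
  rewrite summxE (bigD1 j) //= cvZ fbE eqxx mulr1 big1 ?addr0 // => i ni.
  by rewrite cvZ fbE uf_eq eq_sym (negbTE ni) mulr0.
have m'0 i : 0 <= m' i 0.
  by rewrite summxE; apply: sumr_ge0 => j _; rewrite cvZ fbE mulr_ge0 // hm.
have [h eh] := c_twL co m'; rewrite -(tf_T4 tf m'0) (c_tau co) in eh.
pose u := m - tau m'.
have hu j : u (uf nf j) 0 = 0.
  by rewrite -[j](permKV sg) cvD cvN (c_tauc co) m'uf subrr.
have em : m = u + tau m' by rewrite subrK.
apply: (L_eq (h := u + h) (k := vp (- lam t1 u (tau m') + lam t u h)) Ksf tf (pt_E1 Ksf sh hm)).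
by rewrite {1}em (E_add fE1) (E1_frozen sh hu) eh (frozen_shift Ksf tf) // scalerA vpD.
Qed.

(* [Jm h] = v^? X(t)^(Ja h) * X(t1)^(Jmu h) is pointed at h: the negative unfrozen
   coordinates of h are supplied by the variables I_j of t1. *)
Definition Jmu h : G := locked (\sum_j posp (- h (uf nf j) 0) *: fb (uf nf (sg j))).
Definition Ja h : G := locked (h - Gm (Jmu h)).
Definition Jm h : K := vp (- lam t (Ja h) (Gm (Jmu h))) *: (E (Ja h) * E1 (Jmu h)).

Lemma Jmu_uf h j : Jmu h (uf nf (sg j)) 0 = posp (- h (uf nf j) 0).
Proof.
rewrite /Jmu -lock summxE (bigD1 j) //= cvZ fbE eqxx mulr1 big1 ?addr0 // => i ni.
by rewrite cvZ fbE uf_eq (inj_eq perm_inj) eq_sym (negbTE ni) mulr0.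
Qed.

Lemma Jmu_ge0 h j : 0 <= Jmu h (uf nf j) 0.
Proof. by rewrite -[j](permKV sg) Jmu_uf posp_ge0. Qed.

Lemma Ja_uf h j : Ja h (uf nf j) 0 = posp (h (uf nf j) 0).
Proof. by rewrite /Ja -lock cvD cvN (Gm_uf sh) Jmu_uf opprK pospN addrC subrK. Qed.

Lemma Ja_Gm h : Ja h + Gm (Jmu h) = h.
Proof. by rewrite /Ja -lock subrK. Qed.

Lemma Tri_EE1 a m : (forall j, 0 <= a (uf nf j) 0) -> (forall j, 0 <= m (uf nf j) 0) ->
  Tri t E Lg (a + Gm m) (vp (- lam t a (Gm m)) *: (E a * E1 m)).
Proof.
by move=> ha hm; rewrite (E1_L hm); apply: (Tri_mulE Ksf tf) => //; apply: (Tri_L tf).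
Qed.

Lemma Tri_J h : Tri t E Lg h (Jm h).
Proof.
rewrite -{1}(Ja_Gm h); apply: Tri_EE1; last exact: Jmu_ge0.
by move=> j; rewrite Ja_uf posp_ge0.
Qed.

(** Axiom (4) concerns left multiplication by X_i(t) only. Right multiplication by monomials of t1
    sends the products J_h to products of the same type, and [Tri_ind] transfers the statement to
    [Lg h]. *)
Lemma Tri_mulE1r (n h : G) : (forall j, 0 <= n (uf nf j) 0) ->
  Tri t E Lg (Gm n + h) (vp (- lam t h (Gm n)) *: (Lg h * E1 n)).
Proof.
move=> hn; move: h.
apply: (Tri_ind tf (Phi := fun z => z * E1 n) (c := Gm n) (e := fun h => lam t h (Gm n)) (lin_mulr _) Tri_J).
- move=> h h' dh; rewrite -[h'](subrK h) lamDl -subr_le0 addrK (lmC la) -(lmNl la).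
  by apply: lam_domc => // j; rewrite cvN (Gm_uf sh) opprK.
- move=> h; split; first by rewrite addrC; apply: (ptM fE hC) => //; apply: (pt_E1 Ksf sh).
  by rewrite (E1_L hn); apply: (tf_mul tf).
move=> h; have [_ EM1 _] := fE1.
have -> : vp (- lam t h (Gm n)) *: (Jm h * E1 n) =
   vp (- lam t (Ja h) (Gm (Jmu h + n))) *: (E (Ja h) * E1 (Jmu h + n)).
  rewrite /Jm -scalerAl -mulrA EM1 -scalerAr !scalerA -!vpD; apply: eq_scale => //; congr vp.
  have e := esym (Ja_Gm h).
  rewrite {1}e -(Gm_lam Ksf sh) GmD; move: (Ja h) (Gm (Jmu h)) (Gm n) => x y z.
  by rewrite lamDl lamDr; ring.
have -> : Gm n + h = Ja h + Gm (Jmu h + n) by rewrite GmD addrA Ja_Gm addrC.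
apply: Tri_EE1 => j; first by rewrite Ja_uf posp_ge0.
by rewrite cvD addr_ge0 ?Jmu_ge0.
Qed.

End Core.

Lemma big_two {V : nmodType} {T : eqType} (s : seq T) (F : T -> V) x y : uniq s -> x != y ->
  (x \notin s -> F x = 0) -> (y \notin s -> F y = 0) ->
  (forall h, h \in s -> h != x -> h != y -> F h = 0) -> \sum_(h <- s) F h = F x + F y.
Proof.
move=> us nxy hx hy h0.
have one z : (z \notin s -> F z = 0) -> \sum_(h <- s) (if h == z then F z else 0) = F z.
  move=> hz; have [zs|zs] := boolP (z \in s).
    rewrite (bigD1_seq z zs us) /= eqxx big1 ?addr0 // => h nh.
    by rewrite (negbTE nh).
  rewrite (hz zs) big1 // => h _; by case: ifP.
rewrite -(one x hx) -(one y hy) -big_split /= big_seq [RHS]big_seq.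
apply: eq_bigr => h hs; have [->|nx] := eqVneq h x; first by rewrite (negbTE nxy) addr0.
have [->|ny] := eqVneq h y; first by rewrite add0r.
by rewrite addr0 h0.
Qed.

(** * Strings in direction k and the opposite order along them *)

Section Strings.
Context {R : vring} {K : unitAlgType R} {nu nf : nat}.
Hypothesis Ksf : forall z : K, z != 0 -> z \is a GRing.unit.
Notation G := 'cV[int]_(nu + nf).
Variables (t : qseed nu nf) (k : 'I_nu) (E : G -> K).
Hypothesis qt : is_quantum_seed t.
Hypothesis fE : frame (lam t) E.
Implicit Types (a b m w : G).
Let y := yk t k.

Lemma yk_inj (p q : int) w : w + p *: y = w + q *: y -> p = q.
Proof.
move=> /addrI /eqP; rewrite -subr_eq0 -scalerBl => /eqP e; apply/eqP; rewrite -subr_eq0; apply/eqP.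
have := congr1 (fun x => lam t x (fb (uf nf k))) e.
rewrite lam0l lamZl lam_yk // fbE eqxx mulr1 => /eqP; rewrite mulf_eq0 => /orP[/eqP //|].
by rewrite gt_eqF // dprime_gt0.
Qed.

Lemma dom_string a b (n : nat) : dom_cone t a -> dom_cone t b -> a + b = n%:Z *: y ->
  exists p, (p <= n)%N /\ a = p%:Z *: y.
Proof.
move=> /domcE [u [-> hu]] /domcE [v [-> hv]]; rewrite -mulmxDr /y /yk scalemxAr => /(B_inj2 qt) e.
have ej j : u j 0 + v j 0 = n%:Z * (j == k)%:R.
  by have := congr1 (fun x : 'cV_nu => x j 0) e; rewrite cvD cvZ mxE andbT.
exists (absz (u k 0)); split; first by have := ej k; rewrite eqxx; have := hu k; have := hv k; lia.
rewrite scalemxAr; congr (_ *m _); apply/colP => j; rewrite cvZ mxE andbT gez0_abs //.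
have [->|nj] := eqVneq j k; first by rewrite mulr1.
by rewrite mulr0; have := ej j; rewrite (negbTE nj) mulr0 => e0; have := hu j; have := hv j; move: e0; move: (u j 0) (v j 0) => p q; lia.
Qed.

(* Dominance order, except that the degrees in direction k are compared first in
   the opposite sense; the leading term is the top of the k-string. *)
Definition lex_cone a : Prop := exists n : 'cV[int]_nu, [/\ a = Bt t *m n,
  forall j, j != k -> 0 <= n j 0 & (forall j, j != k -> n j 0 = 0) -> n k 0 <= 0].

Lemma pcone_lexm : pointed_cone lex_cone.
Proof.
split.
- by exists 0; split; [rewrite mulmx0|move=> j _; rewrite mxE|move=> _; rewrite mxE].
- move=> a b [u [-> hu uk]] [v [-> hv vk]]; exists (u + v); split; rewrite ?mulmxDr //.
    by move=> j nj; rewrite cvD addr_ge0 ?hu ?hv.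
  move=> h; have z j : j != k -> u j 0 = 0 /\ v j 0 = 0.
    by move=> nj; have := h j nj; rewrite cvD; have := hu j nj; have := hv j nj; lia.
  rewrite cvD; have := uk (fun j nj => (z j nj).1); have := vk (fun j nj => (z j nj).2); lia.
move=> a [u [-> hu uk]] [v []] /eqP; rewrite eqr_oppLR -mulmxN => /eqP /(B_inj2 qt) e hv vk.
have z j : j != k -> v j 0 = 0.
  by move=> nj; have := hu j nj; have := hv j nj; rewrite e cvN; lia.
have {}vk := vk z.
have {}uk : 0 <= v k 0.
  have := uk; rewrite e cvN => h; have : - v k 0 <= 0; last lia.
  by apply: h => j nj; rewrite cvN z // oppr0.
rewrite e (_ : v = 0) ?oppr0 ?mulmx0 //; apply/colP => j; rewrite mxE.
by have [->|nj] := eqVneq j k; [lia|apply: z].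
Qed.

Lemma lexm_yk (p : int) : p <= 0 -> lex_cone (p *: y).
Proof.
move=> hp; exists (p *: delta_mx k 0); split; first by rewrite -scalemxAr.
  by move=> j nj; rewrite cvZ mxE (negbTE nj) mulr0.
by move=> _; rewrite cvZ mxE !eqxx mulr1.
Qed.

(** The leading degree of [sbasis t k E m] for [lex_cone]: when m_k < 0 this element contains a
    power of the exchange binomial, and the order selects its other end. *)
Definition dlm m : G := m + posp (- m (uf nf k) 0) *: y.

Lemma dlm_k m : dlm m (uf nf k) 0 = m (uf nf k) 0.
Proof. by rewrite /dlm cvD cvZ yk_k // mulr0 addr0. Qed.

Lemma dlm_inj : injective dlm.
Proof.
move=> m m' e; have ek : m (uf nf k) 0 = m' (uf nf k) 0 by rewrite -dlm_k e dlm_k.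
by move: e; rewrite /dlm ek => /addIr.
Qed.

Lemma pt_Sb_lexm m : pt E lex_cone (dlm m) (sbasis t k E m).
Proof.
have C0 : lex_cone 0 by case: pcone_lexm.
have [h|h] := leP 0 (m (uf nf k) 0).
  by rewrite Sb_ge0 // /dlm (_ : posp _ = 0) ?scale0r ?addr0; [exact: pt_mon|rewrite /posp; lia].
rewrite Sb_le0 ?ltW // trop_le0 ?ltW //.
have hk : 0 <= (Pm t k m) (uf nf k) 0 by rewrite (PmE qt) eqxx; lia.
apply: pt_sub (_ : pt E (fun a => string_cone t k (- a)) (dlm m) _).
  move=> a [n e]; rewrite -[a]opprK e -scaleNr; apply: lexm_yk; lia.
have := pt_mutf_op qt fE hk; rewrite PmK // /dlm (_ : (Pm t k m) _ _ = posp (- m (uf nf k) 0)) //.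
by rewrite (PmE qt) eqxx /posp; lia.
Qed.

Lemma max_string (c : {malg R[G]}) w : c@_w != 0 -> exists n0 : nat,
  c@_(w + n0%:Z *: y) != 0 /\ forall n : nat, c@_(w + n%:Z *: y) != 0 -> (n <= n0)%N.
Proof.
move=> cw; pose P (m : G) := `[< exists n : nat, m = w + n%:Z *: y >].
(* Since lambda(y_k, f_k) = d'_k > 0, the minimum of l on the string is its top. *)
pose l (m : G) := - lam t m (fb (uf nf k)).
have ws : w \in [seq m <- msupp c | P m].
  by rewrite mem_filter mem_msupp cw andbT; apply/asboolP; exists 0%N; rewrite scale0r addr0.
have [m [ms hm]] := seq_min l ws; move: ms; rewrite mem_filter => /andP[/asboolP [n0 em] ms].
exists n0; rewrite -em -mem_msupp; split=> // n cn.
have := hm (w + n%:Z *: y); rewrite mem_filter mem_msupp cn andbT => h.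
have {h} : l m <= l (w + n%:Z *: y) by apply: h; apply/asboolP; exists n.
rewrite em /l !lamDl !lamZl lam_yk // fbE eqxx mulr1; have := dprime_gt0 qt k; nia.
Qed.

Lemma lexm_string w a (n0 : nat) : dom_cone t (a - w) ->
  (forall n : nat, a = w + n%:Z *: y -> (n <= n0)%N) -> lex_cone (a - (w + n0%:Z *: y)).
Proof.
move=> /domcE [n [e hn]] h; exists (n - n0%:Z *: delta_mx k 0).
split; first by rewrite opprD addrA e mulmxBr -scalemxAr.
  by move=> j nj; rewrite cvD cvN cvZ mxE (negbTE nj) mulr0 subr0.
move=> z; rewrite cvD cvN cvZ mxE !eqxx mulr1 subr_le0.
have := h (absz (n k 0)); have := hn k; suff -> : a = w + (absz (n k 0))%:Z *: y by move=> ? /(_ erefl); lia.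
rewrite gez0_abs // -[a](subrK w) e addrC; congr (_ + _); rewrite /y /yk scalemxAr; congr (_ *m _).
apply/colP => j; rewrite cvZ mxE andbT; have [->|nj] := eqVneq j k; first by rewrite mulr1.
by rewrite mulr0; have := z j nj; rewrite cvD cvN cvZ mxE (negbTE nj) mulr0 subr0.
Qed.

Lemma string_top w x : pn E (dom_cone t) w x -> exists n0 : nat, pn E lex_cone (w + n0%:Z *: y) x.
Proof.
case=> c [-> cw hc]; have [n0 [c0 h0]] := max_string cw.
exists n0; exists c; split=> // a ac; apply: (lexm_string (hc a ac)) => n e.
by apply: h0; rewrite -e -mem_msupp.
Qed.

Lemma Sb_string_top w (a : {malg R[G]}) : (forall m, m \in msupp a -> dom_cone t (m - w)) ->
  forall n0 : nat, (forall n : nat, a@_(w + n%:Z *: y) != 0 -> (n <= n0)%N) ->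
  forall m, m \in msupp a -> lex_cone (dlm m - dlm (w + n0%:Z *: y)).
Proof.
move=> ha n0 h0 m ms; have wk : (w + n0%:Z *: y) (uf nf k) 0 = w (uf nf k) 0.
  by rewrite cvD cvZ yk_k // mulr0 addr0.
have [] := lexm_string (n0 := n0) (ha m ms) _.
  by move=> n e; apply: h0; rewrite -e -mem_msupp.
move=> n [e h1 h2]; exists (n + (posp (- m (uf nf k) 0) - posp (- w (uf nf k) 0)) *: delta_mx k 0).
split.
- rewrite mulmxDr -scalemxAr -e /dlm wk [X in X - _]addrC -/y; set p := posp _; set q := posp _.
  rewrite scalerBl; move: (p *: y) (q *: y) (w + _) => y1 y2 z.
  by rewrite opprD [RHS]addrACA [m + y1]addrC.
- by move=> j nj; rewrite cvD cvZ mxE (negbTE nj) mulr0 addr0; apply: h1.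
move=> z; have z' j : j != k -> n j 0 = 0.
  by move=> nj; have := z j nj; rewrite cvD cvZ mxE (negbTE nj) mulr0 addr0.
rewrite cvD cvZ mxE !eqxx mulr1; suff -> : m (uf nf k) 0 = w (uf nf k) 0 by have := h2 z'; lia.
have -> : m = (w + n0%:Z *: y) + Bt t *m n by rewrite -e addrC subrK.
have -> : n = n k 0 *: delta_mx k 0.
  apply/colP => j; rewrite cvZ mxE andbT; have [->|nj] := eqVneq j k; first by rewrite mulr1.
  by rewrite mulr0 z'.
by rewrite -scalemxAr !cvD !cvZ -/(yk t k) yk_k // !mulr0 !addr0.
Qed.

End Strings.

Ltac zmx := apply/colP => ?; rewrite !mxE; ring.

(** * The new variable of the shifted seed *)

Section Top.
Context {R : vring} {K : unitAlgType R} {nu nf : nat}.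
Notation G := 'cV[int]_(nu + nf).
Implicit Types (g h a m : G) (z : K).
Hypothesis Ksf : forall z : K, z != 0 -> z \is a GRing.unit.
Variables (t : qseed nu nf) (E : G -> K) (t1 : qseed nu nf) (E1 : G -> K)
  (sg : {perm 'I_nu}) (gd : 'I_nu -> G) (Lg : G -> K) (tw : K -> K) (tau : G -> G).
Hypothesis co : core t E t1 E1 sg gd Lg tw tau.
Variable k : 'I_nu.
Let tf := c_tf co.
Let qt : is_quantum_seed t := pf_qt tf.
Let fE : frame (lam t) E := pf_fr tf.
Let hC := pcone_dom qt.
Let Lpt := pf_pt tf.
Let qt1 : is_quantum_seed t1 := sh_qt1 (c_sh co).
Let fE1 : frame (lam t1) E1 := sh_fE1 Ksf (c_sh co).
Let y := yk t k.
Let uk := uf nf k.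
Let kp := sg k.
Let t1' := mutate t1 kp.
Let E1' := mutf t1 kp E1.
Let qt1' : is_quantum_seed t1' := (mutate_quantum qt1 kp).1.
Let fE1' : frame (lam t1') E1' := frame_mutf Ksf kp qt1 fE1.
Notation S := (sbasis t k E).
Notation Gm := (shift_deg sg gd).

Lemma pn_pt (C : G -> Prop) g h x z : pointed_cone C -> pn E C g x -> pt E C h z ->
  pt E C (g + h) (vp (- lam t g h) *: (x * z)) -> pt E C g x.
Proof.
move=> pC [c [ec nc hc]] [d [ed d1 hd]] [e [ee e1 he]]; exists c; split=> //.
have [l1 _] := cone_lead (lam t) pC hc hd.
have e2 : e = vp (- lam t g h) *: tm (lam t) c d.
  by apply: (ev_inj fE); rewrite -ee evZ -(evM fE) ec ed.
by rewrite -e1 e2 mcoeffZ l1 d1 mulr1 mulrA vpNK mul1r.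
Qed.

(** These monomials lie trivially in the upper bound of t1', and the upper bound is carried back to
    t along the reversed mutation sequence. *)
Lemma uca_E1' m : (forall j, 0 <= m (uf nf j) 0) -> in_upper_bound t E (E1' m).
Proof.
move=> hm; have h : in_upper_bound t1' E1' (E1' m).
  by split=> [|j]; [exact: lpU|exact: (lp_mutf_ge0 Ksf qt1' fE1')].
have [ks [e1 e2]] := sh_conn (c_sh co).
have e3 : t1' = mutate_seq t (ks ++ [:: kp]) by rewrite mutate_seq_cat /= -e1.
have e4 : E1' = mutf_seq t E (ks ++ [:: kp]) by rewrite mutf_seq_cat /= -e1 -e2.
have := uca_mutf_seq Ksf (rev (ks ++ [:: kp])) qt1' fE1' h.
by rewrite e3 e4 mutate_seq_rev // mutf_seq_rev.
Qed.

Let Lsp g : laurent S (Lg g) := Sb_span Ksf qt fE (c_lp co [::] g) (c_lp co [:: k] g).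
Definition scoef g : {malg R[G]} := projT1 (cid (Lsp g)).
Let A g (n : nat) := (scoef g)@_(g + n%:Z *: y).

Lemma cf_E g : Lg g = ev S (scoef g).
Proof. exact: projT2 (cid (Lsp g)). Qed.

Let Sdom m : pt E (dom_cone t) m (S m).
Proof. by apply: pt_sub (pt_Sb k qt fE m) => a; apply: strc_dom. Qed.

Lemma S_inj (a b : {malg R[G]}) : ev S a = ev S b -> a = b.
Proof. exact: (ev_inj_pt fE hC Sdom (@inj_id G)). Qed.

Lemma cf_1 g : (scoef g)@_g = 1.
Proof.
have [c [e c1 hc]] := Lpt g.
by rewrite -(triang_coef fE hC Sdom (@inj_id G) (etrans (esym (cf_E g)) e) hc).
Qed.

Lemma cf_supp g m : m \in msupp (scoef g) -> dom_cone t (m - g).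
Proof.
have [c [e c1 hc]] := Lpt g.
exact: (triang_supp fE hC Sdom (@inj_id G) (etrans (esym (cf_E g)) e) hc).
Qed.

Lemma cf_bar g m : vbar (scoef g)@_m = (scoef g)@_m.
Proof.
apply: (barinv_coord fE (scoef g) hC Sdom (@inj_id G) (barinv_Sb Ksf k qt fE)).1.
by rewrite -cf_E; exact: (pf_bar tf).
Qed.

Let A0 g : A g 0 = 1. Proof. by rewrite /A scale0r addr0 cf_1. Qed.

(** Multiplication by X_i, i different from k, shifts [sbasis] and produces no v-power along the
    k-string. Inductively on the string, the change of a coefficient is one lower coefficient of X_i
    * L_g, which lies in m and is a difference of bar-invariant scalars, so it is 0. *)
Let A_step i n g : i != uk -> A (fb i + g) n = A g n.
Proof.
move=> ni; have f0 : (fb i : G) uk 0 = 0 by rewrite fbE eq_sym (negbTE ni).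
have [b [eb b1 hb sb]] := Tri_supp tf (tf_T3 tf i g).
pose l m : R := vp (lam t (fb i) m - lam t (fb i) g).
have ed : \sum_(m <- msupp (scoef g)) mkmalgU (m + fb i) (l m * (scoef g)@_m) =
          \sum_(h <- msupp b) b@_h *: scoef h.
  apply: S_inj; rewrite -(ev_coef (E := S) (P := Lg)); last by move=> h _; apply: cf_E.
  rewrite -eb cf_E ev_sum {2}/ev mulr_sumr scaler_sumr; apply: eq_bigr => m _.
  rewrite evU -scalerAr (Sb_mul Ksf qt fE m f0) !scalerA [fb i + m]addrC; apply: eq_scale => //.
  by rewrite /l [_ m - _]addrC vpD mulrAC.
pose M (p : nat) := fb i + g + p%:Z *: y.
have ly (p : nat) : lam t (fb i) (p%:Z *: y) = 0 by rewrite lamZr lamr_yk // f0 mulr0 oppr0 mulr0.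
have eA p : A g p = \sum_(h <- msupp b) b@_h * (scoef h)@_(M p).
  have := congr1 (fun x => x@_(M p)) ed.
  have -> : M p = g + p%:Z *: y + fb i by rewrite /M; move: (fb i) (p%:Z *: y) => x1 x2; zmx.
  rewrite mcoeff_shift mcoeff_sum /l lamDr ly addr0 subrr vp0 mul1r -/(A g p) => ->.
  by apply: eq_bigr => h _; rewrite mcoeffZ.
have M0 : M 0%N = fb i + g by rewrite /M scale0r addr0.
suff key p : A g p = A (fb i + g) p /\ ((0 < p)%N -> b@_(M p) = 0) by case: (key n).
elim: p {-2}p (leqnn p) => [|N IH] p hp.
  have -> : p = 0%N by lia.
  by rewrite !A0.
case: p hp => [|p] hp; first by rewrite !A0.
have nM : M 0%N != M p.+1.
  by apply/eqP => /(yk_inj qt).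
have eAp : A g p.+1 = A (fb i + g) p.+1 + b@_(M p.+1).
  rewrite eA (big_two (fset_uniq _) nM).
  - congr (_ + _); first by rewrite M0 b1 mul1r.
    by rewrite cf_1 mulr1.
  - by move=> h; rewrite (mcoeff_outdom h) mul0r.
  - by move=> h; rewrite (mcoeff_outdom h) mul0r.
  move=> h hs n0 np; have [hc|hc] := boolP (M p.+1 \in msupp (scoef h)); last first.
    by rewrite (mcoeff_outdom hc) mulr0.
  (* A degree h lying between the base and the point M p.+1 of the string is itself on the string,
     where b vanishes by induction. *)
  have [|q [hq eq]] := dom_string (k := k) (n := p.+1) qt (sb h hs) (cf_supp hc).
    by rewrite /M [LHS]addrC addrA subrK addrC addKr.
  have eh : h = M q by rewrite /M -eq addrC subrK.
  have q0 : (0 < q)%N by rewrite lt0n; apply: contra_neq n0 => e; rewrite eh e.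
  have qp : (q < p.+1)%N by rewrite ltn_neqAle hq andbT; apply: contra_neq np => <-.
  by rewrite eh ((IH q _).2 q0) ?mul0r //; lia.
have b0 : b@_(M p.+1) = 0.
  apply: vmm_bar; first by apply: hb; rewrite -M0 eq_sym.
  have -> : b@_(M p.+1) = A g p.+1 - A (fb i + g) p.+1 by rewrite eAp addrC addKr.
  by rewrite vbarD vbarN !cf_bar.
by split=> [|_ //]; rewrite eAp b0 addr0.
Qed.

Let A_dep n g h : g uk 0 = h uk 0 -> A g n = A h n.
Proof.
move=> e; have : forall m, (forall i, ~~ (i != uk) -> m i 0 = 0) -> forall g, A (m + g) n = A g n.
  apply: (@cV_ind _ _ (fun m => forall g, A (m + g) n = A g n) (fun i => i != uk)).
  - by move=> x; rewrite add0r.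
  - by move=> a b ha hb x; rewrite -addrA ha hb.
  - by move=> a ha x; rewrite -(ha (- a + x)) addrA addrN add0r.
  by move=> i ni x; apply: A_step.
move=> /(_ (g - h)) H; rewrite -[g](subrK h) H // => i; rewrite negbK => /eqP ->.
by rewrite cvD cvN e subrr.
Qed.

(** String coefficients depend only on g_k, so g may be replaced by g_k f_k, for which L contains
    the monomial X_k^(g_k). *)
Lemma top_ge0 n g : 0 <= g uk 0 -> (0 < n)%N -> A g n = 0.
Proof.
move=> hg hn; pose d := g uk 0 *: fb uk : G.
have dk : d uk 0 = g uk 0 by rewrite cvZ fbE eqxx mulr1.
rewrite -(A_dep n dk) /A.
have -> : scoef d = mkmalgU d 1.
  apply: S_inj; rewrite -cf_E evU scale1r Sb_ge0 ?dk //; symmetry; apply: (tf_T4 tf) => i.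
  by rewrite cvZ fbE mulr_ge0.
rewrite mcoeffU; case: eqP => // e; have := yk_inj (p := 0) (q := n%:Z) qt (k := k) (w := d).
by rewrite scale0r addr0 => /(_ e); lia.
Qed.

Let lxC := pcone_lexm k qt.
Let ptS m := pt_Sb_lexm k qt fE m.

Let dlm0 g : 0 <= g uk 0 -> dlm t k g = g.
Proof. by move=> h; rewrite /dlm (_ : posp _ = 0) ?scale0r ?addr0 // /posp -/uk; lia. Qed.

Lemma L_lexm g : 0 <= g uk 0 -> pt E (lex_cone t k) g (Lg g).
Proof.
move=> hg; rewrite cf_E -{1}(dlm0 hg); apply: (pt_ev fE lxC ptS (@dlm_inj _ _ t k qt)); first exact: cf_1.
have := Sb_string_top qt (@cf_supp g) (k := k) (n0 := 0%N); rewrite scale0r addr0; apply=> n.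
by case: n => // n; rewrite -/y -/(A g n.+1) top_ge0 // eqxx.
Qed.

Lemma L_top g : exists n0, (forall n, A g n != 0 -> (n <= n0)%N) /\
  pn E (lex_cone t k) (dlm t k (g + n0%:Z *: y)) (Lg g).
Proof.
have [|n0 [c0 h0]] := max_string k qt (c := scoef g) (w := g).
  by rewrite cf_1 oner_neq0.
exists n0; split=> //; rewrite cf_E; apply: (pn_ev fE lxC ptS (@dlm_inj _ _ t k qt)) => //.
exact: (Sb_string_top qt (@cf_supp g)).
Qed.

Let gam := gd k.
Let Ik := E1 (fb (uf nf kp)).
Let V := E1' (fb (uf nf kp)).
Let y1 := yk t1 kp.
Let g1 := gm t1 kp.
Let u1 := g1 + fb (uf nf kp).
Let al := lam t1 g1 (fb (uf nf kp)).
Let be := lam t1 (g1 + y1) (fb (uf nf kp)).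

Let VI : V * Ik = vp al *: E1 u1 + vp be *: E1 (u1 + y1).
Proof.
rewrite /V /Ik /E1' (mutf_fb _ fE1) /mutW mulrDl; have [_ -> _] := fE1; have [_ -> _] := fE1.
by rewrite /u1 (addrAC g1).
Qed.

Let gam_k : gam uk 0 = -1. Proof. by rewrite /gam (sh_uf (c_sh co)) eqxx. Qed.

Let GI : Gm (fb (uf nf kp)) = gam := Gm_fb sg gd k.

Let u1_ge j : 0 <= u1 (uf nf j) 0.
Proof.
rewrite cvD fbE /g1 /gm fmutE -/kp uf_eq; have := posp_ge0 (- Bt t1 (uf nf j) kp).
by case: (j == kp); lia.
Qed.

Let u1y_ge j : 0 <= (u1 + y1) (uf nf j) 0.
Proof.
rewrite cvD cvD fbE /g1 /gm fmutE -/kp uf_eq /y1 ykE pospN.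
by have := posp_ge0 (Bt t1 (uf nf j) kp); case: (j == kp); lia.
Qed.

Let p0 := Gm u1.
Let p1 := Gm (u1 + y1).

Let u1_k : u1 (uf nf kp) 0 = 0.
Proof. by rewrite cvD fbE eqxx (gm_k kp qt1) addNr. Qed.

Let p0_k : p0 uk 0 = 0.
Proof. by rewrite (Gm_uf (c_sh co)) u1_k oppr0. Qed.

Let p1_k : p1 uk 0 = 0.
Proof. by rewrite (Gm_uf (c_sh co)) cvD u1_k yk_k // addr0 oppr0. Qed.

Let Ipt : pt E (dom_cone t) gam Ik := sh_pt (c_sh co) k.
Let pt0 : pt E (dom_cone t) p0 (E1 u1) := pt_E1 Ksf (c_sh co) u1_ge.
Let pt1 : pt E (dom_cone t) p1 (E1 (u1 + y1)) := pt_E1 Ksf (c_sh co) u1y_ge.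

Let lx0 : pt E (lex_cone t k) p0 (E1 u1).
Proof. by rewrite (E1_L Ksf co u1_ge); apply: L_lexm; rewrite -/p0 p0_k. Qed.

Let lx1 : pt E (lex_cone t k) p1 (E1 (u1 + y1)).
Proof. by rewrite (E1_L Ksf co u1y_ge); apply: L_lexm; rewrite -/p1 p1_k. Qed.

Let fkp_ge j : 0 <= (fb (uf nf kp) : G) (uf nf j) 0.
Proof. by rewrite fbE. Qed.

(** I_k has k-degree -1, and [dlm] moves such a degree up by one further y; this is why q > 0. *)
Let Ik_top : exists q : nat, (0 < q)%N /\ pn E (lex_cone t k) (gam + q%:Z *: y) Ik.
Proof.
have [n0 [_ h]] := L_top gam; exists n0.+1; split=> //.
move: h; rewrite /Ik (E1_L Ksf co fkp_ge) GI /dlm cvD cvZ yk_k // mulr0 addr0 -/uk gam_k.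
by rewrite opprK -addrA -scalerDl -/gam /posp; congr (pn E _ (_ + _ *: _) _); rewrite -/uk; lia.
Qed.

Let V_lp : laurent E V := (uca_E1' fkp_ge).1.

Let r := Gm y1 + y.

Let r_ker x : lam t r x = 0.
Proof.
have [m <-] := Gm_surj (c_sh co) x; rewrite lamDl (Gm_lam Ksf (c_sh co)) lam_yk // lam_yk //.
by rewrite (Gm_uf (c_sh co)) -/kp (c_d co) mulrN subrr.
Qed.

Let r_B n : r = Bt t *m n -> r = 0.
Proof.
move=> e; rewrite e (_ : n = 0) ?mulmx0 //; apply/colP => j; rewrite mxE.
have := r_ker (fb (uf nf j)); rewrite e lamB // (bigD1 j) //= big1 => [|i ni].
  rewrite fbE eqxx mulr1 addr0 => /eqP.
  by rewrite mulf_eq0 gt_eqF ?dprime_gt0 // => /eqP.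
by rewrite fbE uf_eq (negbTE ni) mulr0.
Qed.

Let p1E : p1 = p0 + r - y.
Proof. by rewrite /p1 /p0 /r GmD; move: (Gm u1) (Gm y1) y => a b d; zmx. Qed.

Let coset_dom w x : pt E (dom_cone t) w x -> laurent_on E (fun m => exists n, m = w + Bt t *m n) x.
Proof.
move=> h; apply: lpl_sub (pt_lpl h) => m /domcE [n [e _]]; exists n.
by rewrite -e addrC subrK.
Qed.

(** If r were nonzero, the degrees of the two terms of V * I_k would lie in different cosets of the
    image of B. A coset component of V times I_k would then be a multiple of the single monomial
    [E1 u1]. The string tops p0 + (n0 + q) y and p0 would have to agree, contradicting q > 0. *)
Let r0 : r = 0.
Proof.
apply: contrapT => nr; have [c ec] := V_lp.
have [c1 [c2 [ecc h1 h2]]] := msplit (fun m => exists n, m = p0 - gam + Bt t *m n) c.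
pose Q m := exists n, m = p0 + Bt t *m n.
have q1 : laurent_on E Q (ev E c1 * Ik).
  apply: (lplM fE (Q1 := fun m => exists n, m = p0 - gam + Bt t *m n) _ _ (coset_dom Ipt)).
    move=> a b [n ->] [n' ->]; exists (n + n').
    by rewrite mulmxDr addrACA subrK.
  by apply: lpl_ev => m /h1 [_ h]; apply: lplU.
have q2 : laurent_on E (fun m => ~ Q m) (ev E c2 * Ik).
  apply: (lplM fE (Q1 := fun m => ~ exists n, m = p0 - gam + Bt t *m n) _ _ (coset_dom Ipt)).
    move=> a b na [n' ->] [n e]; apply: na; exists (n - n').
    rewrite mulmxBr -[a](addrK (gam + Bt t *m n')) e.
    by move: p0 gam (_ *m n) (_ *m n') => x1 x2 x3 x4; zmx.
  by apply: lpl_ev => m /h2 [_ h]; apply: lplU.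
have q3 : laurent_on E (fun m => ~ Q m) (E1 (u1 + y1)).
  apply: lpl_sub (coset_dom pt1) => m [n ->] [n']; rewrite p1E -!addrA => /addrI e.
  apply: nr; apply: (r_B (n := n' - n + delta_mx k 0)); rewrite mulmxDr mulmxBr -/(yk t k) -/y -e.
  by rewrite /r; move: (Gm y1) y (Bt t *m n) => a b d; zmx.
have e1 : ev E c1 * Ik = vp al *: E1 u1.
  apply/eqP; rewrite -subr_eq0; apply/eqP.
  apply: (lpl_disj fE (Q1 := Q) (Q2 := fun m => ~ Q m)) => [m // | |].
    by apply: lplB => //; apply/lplZ/coset_dom.
  have -> : ev E c1 * Ik - vp al *: E1 u1 = vp be *: E1 (u1 + y1) - ev E c2 * Ik.
    have := VI; rewrite ec ecc evD mulrDl; move: (ev E c1 * _) (ev E c2 * _) (_ *: E1 u1) => a b d e.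
    by apply/eqP; rewrite subr_eq addrAC eq_sym subr_eq addrC -e.
  by apply: lplB => //; apply: lplZ.
have [] := string_top k qt (w := p0 - gam) (x := ev E c1) (E := E).
  apply: (pt_divr Ksf fE hC _ Ipt); first by exists c1.
  by rewrite e1; apply: (pnZ Ksf fE (vp_neq0 _ _)); apply: pt_pn.
move=> n0 t1p; have [q [q0 hq]] := Ik_top.
have := pnM Ksf fE lxC t1p hq; rewrite e1 => /(pn_uniq fE lxC).
move=> /(_ _ (pnZ Ksf fE (vp_neq0 _ al) (pt_pn lx0))).
rewrite addrACA subrK -scalerDl -{2}[p0]addr0 -(scale0r y) => /(yk_inj qt).
by lia.
Qed.

Lemma Gm_yk : Gm (yk t1 (sg k)) = - yk t k.
Proof. by apply/eqP; rewrite -addr_eq0; apply/eqP/r0. Qed.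

Let p1E' : p1 = p0 - y. Proof. by rewrite p1E r0 addr0. Qed.

Let VI1 : pt E (dom_cone t) p1 (vp (- be) *: (V * Ik)).
Proof.
rewrite VI scalerDr !scalerA -!vpD addNr vp0 scale1r addrC.
apply: (ptD hC (h := p0)) => //; rewrite p1E'.
  by move/eqP; rewrite -subr_eq0 addrAC subrr add0r oppr_eq0 => /eqP; apply: yk_neq0.
rewrite opprB addrC subrK; exact: strc_dom (strc_yk t k).
Qed.

(* The degree in t of V, the new variable of mu_(sigma k) t[1]. *)
Definition V_deg : G := Gm (gm t1 kp + yk t1 kp).

Let zE : V_deg = p1 - gam.
Proof. by rewrite /V_deg /p1 /u1 addrAC [Gm (_ + fb _)]GmD GI addrK. Qed.

Let V_pn : pn E (dom_cone t) V_deg V.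
Proof.
rewrite zE; apply: (pt_divr Ksf fE hC V_lp Ipt).
have := pnZ Ksf fE (vp_neq0 _ be) (pt_pn VI1).
by rewrite scalerA vpKN scale1r.
Qed.

Lemma pt_V : pt E (dom_cone t) V_deg (mutf t1 kp E1 (fb (uf nf kp))).
Proof.
apply: (pn_pt hC V_pn Ipt).
have -> : lam t V_deg gam = be by rewrite -GI (Gm_lam Ksf (c_sh co)).
by rewrite zE subrK.
Qed.

(** The product V * I_k has its dominance degree at p0 - y and its [lex_cone] degree at p0, one step
    apart. The two factors share this step, and I_k already takes at least one. *)
Let lead_eq : exists n0 q : nat, [/\ pn E (lex_cone t k) (V_deg + n0%:Z *: y) V,
  pn E (lex_cone t k) (gam + q%:Z *: y) Ik, n0 = 0%N & q = 1%N].
Proof.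
have [n0 h1] := string_top k qt V_pn; have [q [q0 hq]] := Ik_top.
exists n0, q; suff : n0%:Z + q%:Z = 1 by split=> //; lia.
apply: (yk_inj qt (k := k) (w := p0 - y)); rewrite scale1r subrK.
have := pnM Ksf fE lxC h1 hq => /(pn_uniq fE lxC) H.
rewrite -[RHS](H p0); first by rewrite zE p1E' addrACA subrK -scalerDl.
have -> : V * Ik = vp al *: (E1 u1 + vp (- al + be) *: E1 (u1 + y1)).
  by rewrite VI scalerDr scalerA -vpD addrA addrN add0r.
apply: (pnZ Ksf fE (vp_neq0 _ _)); apply: pt_pn; apply: (ptD lxC (h := p1)) => //.
  by rewrite p1E' => /eqP; rewrite eq_sym subr_eq addrC -subr_eq subrr eq_sym => /eqP; apply: yk_neq0.
by rewrite p1E' addrAC subrr add0r -scaleN1r; apply: lexm_yk.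
Qed.

Lemma V_lexm : pn E (lex_cone t k) V_deg V.
Proof. by have [n0 [q [h _ e _]]] := lead_eq; move: h; rewrite e scale0r addr0. Qed.

(** For g_k < 0 the comparison element is a power of I_k: its string top is known from [lead_eq],
    and [dlm] alone already accounts for it, leaving no room for higher string coefficients. *)
Lemma cf_top n g : (0 < n)%N -> A g n = 0.
Proof.
have [h|h] := leP 0 (g uk 0); first exact: top_ge0.
have [n0 [q [_ hq _ q1]]] := lead_eq; rewrite q1 scale1r in hq.
pose d := absz (g uk 0); pose dg := d%:Z *: gam.
have dgk : dg uk 0 = g uk 0 by rewrite cvZ gam_k; lia.
have /(_ d) hd p : pn E (lex_cone t k) (p%:Z *: (gam + y)) (Ik ^+ p).
  elim: p => [|p IH]; last by rewrite exprS intS scalerDl scale1r; apply: (pnM Ksf fE lxC).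
  by rewrite scale0r expr0; have [<- _ _] := fE; apply/pt_pn/pt_mon; case: lxC.
have eI : Ik ^+ d = Lg dg.
  rewrite /Ik (E_exp _ _ qt1 fE1) (E1_L Ksf co); first by rewrite GmZ GI.
  by move=> j; rewrite cvZ mulr_ge0.
have [n1 [hn1 tp]] := L_top dg; rewrite eI in hd.
have := pn_uniq fE lxC hd tp.
have -> : dlm t k (dg + n1%:Z *: y) = dg + (n1 + d)%N%:Z *: y.
  rewrite /dlm -/uk (_ : (dg + _) uk 0 = g uk 0); last by rewrite (cvD dg) dgk cvZ /y yk_k // mulr0 addr0.
  rewrite -/y -addrA -scalerDl.
  by congr (_ + _ *: _); rewrite /posp /d; lia.
rewrite scalerDr => /(yk_inj qt) e hn; apply/eqP; apply: contraT.
by rewrite -(A_dep n dgk) => /hn1; lia.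
Qed.

End Top.

(** * Lexicographic slopes and dominance along a wall *)

Section Lex.
Context {nu : nat}.
Implicit Types u v p n : 'cV[int]_nu.

Definition lexpos v : Prop := exists i, 0 < v i 0 /\ forall j : 'I_nu, (j < i)%N -> v j 0 = 0.
Definition lexge0 v : Prop := v = 0 \/ lexpos v.

Lemma lexposD u v : lexpos u -> lexpos v -> lexpos (u + v).
Proof.
move=> [i [hi zi]] [j [hj zj]].
have [lij|lji|eij] := ltngtP (nat_of_ord i) j.
- exists i; split; first by rewrite cvD (zj i lij) addr0.
  by move=> l ll; rewrite cvD zi // zj ?addr0 //; apply: ltn_trans lij.
- exists j; split; first by rewrite cvD (zi j lji) add0r.
  by move=> l ll; rewrite cvD zj // zi ?addr0 //; apply: ltn_trans lji.
have {}eij : i = j by apply: val_inj.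
subst j; exists i; split; first by rewrite cvD addr_gt0.
by move=> l ll; rewrite cvD zi // zj ?addr0.
Qed.

Lemma lexge0D u v : lexge0 u -> lexge0 v -> lexge0 (u + v).
Proof.
move=> [->|hu] [->|hv]; rewrite ?addr0 ?add0r; [by left|by right|by right|].
by right; apply: lexposD.
Qed.

Lemma lexposN v : lexpos v -> lexpos (- v) -> False.
Proof.
by move=> h1 h2; have [i] := lexposD h1 h2; rewrite subrr mxE ltxx => -[].
Qed.

Lemma lexposZ (a : int) v : 0 < a -> (lexpos (a *: v) <-> lexpos v).
Proof.
move=> ha; split=> -[i [hi zi]]; exists i; split.
- by move: hi; rewrite cvZ pmulr_rgt0.
- by move=> j /zi /eqP; rewrite cvZ mulf_eq0 gt_eqF //= => /eqP.
- by rewrite cvZ pmulr_rgt0.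
by move=> j /zi e; rewrite cvZ e mulr0.
Qed.

Lemma cvZ_eq0 (a : int) v : a != 0 -> a *: v = 0 -> v = 0.
Proof.
move=> a0 /colP e; apply/colP => i; have /eqP := e i.
by rewrite cvZ [X in _ == X]mxE mulf_eq0 (negbTE a0) => /eqP ->; rewrite mxE.
Qed.

Lemma lexge0Z (a : int) v : 0 < a -> (lexge0 (a *: v) <-> lexge0 v).
Proof.
move=> ha; split=> -[h|h].
- by left; apply: cvZ_eq0 h; rewrite gt_eqF.
- by right; apply/(lexposZ _ ha).
- by left; rewrite h scaler0.
by right; apply/lexposZ.
Qed.

Lemma lex_total v : lexge0 v \/ lexpos (- v).
Proof.
have [->|nz] := eqVneq v 0; first by left; left.
have [i0 hi0] : exists i, v i 0 != 0.
  apply: contrapT => h; move/eqP: nz; apply; apply/colP => i; rewrite mxE; apply/eqP.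
  by apply: contraT => hi; case: h; exists i.
case: (@arg_minnP _ i0 (fun i => v i 0 != 0) (fun i => nat_of_ord i) hi0) => i hi mi.
have z (j : 'I_nu) : (j < i)%N -> v j 0 = 0.
  by move=> ji; apply/eqP; apply: contraT => /mi; rewrite leqNgt ji.
have [h|h] := ltP 0 (v i 0); first by left; right; exists i.
right; exists i; split; first by rewrite cvN oppr_gt0 lt_neqAle hi h.
by move=> j /z e; rewrite cvN e oppr0.
Qed.

Lemma lexge0_nneg v : (forall j, 0 <= v j 0) -> lexge0 v.
Proof.
move=> h; case: (lex_total v) => // -[i [hi _]].
by move: hi; rewrite cvN oppr_gt0 ltNge h.
Qed.

Variable k : 'I_nu.

(** A comparison of directions without denominators: for p_k, n_k < 0, lexicographic nonnegativity
    says that p / |p_k| is at most n / |n_k|. *)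
Definition slope p n : 'cV[int]_nu := n k 0 *: p - p k 0 *: n.

Lemma slopeD p n m : slope p (n + m) = slope p n + slope p m.
Proof. by rewrite /slope cvD scalerDl scalerDr opprD addrACA. Qed.

Lemma slopeN p n : slope p (- n) = - slope p n.
Proof. by apply/colP => i; rewrite /slope !(cvD, cvN, cvZ); ring. Qed.

Lemma slope_min (s : seq 'cV[int]_nu) x : (forall n, n \in s -> n k 0 < 0) -> x \in s ->
  exists p, p \in s /\ forall n, n \in s -> lexge0 (slope p n).
Proof.
move=> hs; elim: s x hs => // y s IH _ hs _.
have yk : y k 0 < 0 by apply: hs; rewrite mem_head.
have yy : slope y y = 0 by rewrite /slope subrr.
have [e|] := eqVneq s [::].
  exists y; split; first exact: mem_head.
  by move=> n; rewrite e inE => /eqP ->; rewrite yy; left.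
case: s IH hs => // z s IH hs _.
have [n hn|p [ps hp]] := IH z _ (mem_head _ _); first by apply: hs; rewrite inE hn orbT.
have pk : p k 0 < 0 by apply: hs; rewrite inE ps orbT.
case: (lex_total (slope p y)) => h.
  exists p; split; first by rewrite inE ps orbT.
  by move=> n; rewrite inE => /orP[/eqP -> //|]; apply: hp.
exists y; split; first exact: mem_head.
move=> n; rewrite inE => /orP[/eqP ->|ns]; first by rewrite yy; left.
have nk : n k 0 < 0 by apply: hs; rewrite inE ns orbT.
apply/(lexge0Z (a := - p k 0)); first by rewrite oppr_gt0.
have -> : - p k 0 *: slope y n = - n k 0 *: slope y p + - y k 0 *: slope p n.
  by rewrite /slope; apply/colP => i; rewrite !(cvD, cvN, cvZ); ring.
apply: lexge0D; apply/lexge0Z; rewrite ?oppr_gt0 //; last exact: hp.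
right; move: h; rewrite (_ : - slope p y = slope y p) // /slope opprB; congr (_ - _).
Qed.

End Lex.

Section Wall.
Context {R : vring} {K : unitAlgType R} {nu nf : nat}.
Notation G := 'cV[int]_(nu + nf).
Implicit Types (g h a m : G) (z : K).
Hypothesis Ksf : forall z : K, z != 0 -> z \is a GRing.unit.
Variables (t : qseed nu nf) (k : 'I_nu) (E : G -> K).
Hypothesis qt : is_quantum_seed t.
Hypothesis fE : frame (lam t) E.
Let la := lam_alt qt.

(** Dominance relaxed in direction k: n_k may be negative once another coordinate is positive. This
    is the form in which dominance at t reaches mu_k t, by [trop_B]. *)
Definition slope_cone a : Prop := exists n : 'cV[int]_nu, [/\ a = Bt t *m n,
  forall j, j != k -> 0 <= n j 0 & (forall j, j != k -> n j 0 = 0) -> 0 <= n k 0].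

Lemma pcone_lexp : pointed_cone slope_cone.
Proof.
split.
- by exists 0; split; [rewrite mulmx0|move=> j _; rewrite mxE|move=> _; rewrite mxE].
- move=> a b [u [-> hu uk]] [v [-> hv vk]]; exists (u + v); split; rewrite ?mulmxDr //.
    by move=> j nj; rewrite cvD addr_ge0 ?hu ?hv.
  move=> h; have z j : j != k -> u j 0 = 0 /\ v j 0 = 0.
    by move=> nj; have := h j nj; rewrite cvD; have := hu j nj; have := hv j nj; lia.
  rewrite cvD; have := uk (fun j nj => (z j nj).1); have := vk (fun j nj => (z j nj).2); lia.
move=> a [u [-> hu uk]] [v []] /eqP; rewrite eqr_oppLR -mulmxN => /eqP /(B_inj2 qt) e hv vk.
have z j : j != k -> v j 0 = 0.
  by move=> nj; have := hu j nj; have := hv j nj; rewrite e cvN; lia.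
have {}vk := vk z.
have {}uk : v k 0 <= 0.
  have := uk; rewrite e cvN => h; have : 0 <= - v k 0; last lia.
  by apply: h => j nj; rewrite cvN z // oppr0.
rewrite e (_ : v = 0) ?oppr0 ?mulmx0 //; apply/colP => j; rewrite mxE.
by have [->|nj] := eqVneq j k; [lia|apply: z].
Qed.

Variables (x : 'I_nu -> K) (w : 'I_nu -> G) (e : 'I_nu -> 'I_nu -> int).
Hypothesis hx : forall i, pt E slope_cone (w i) (x i).
Hypothesis hw : forall i j, w i (uf nf j) 0 = - (j == i)%:R.
Hypothesis hxx : forall i j, x i * x j = vp (2 * e i j) *: (x j * x i).

Let lamw n j : lam t (Bt t *m n) (w j) = - (dprime t j * n j 0).
Proof.
rewrite (lamB qt) (bigD1 j) //= big1 ?addr0; first by rewrite hw eqxx mulrN mulr1.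
by move=> i ni; rewrite hw (negbTE ni) oppr0 mulr0.
Qed.

(* A violation of dominance would be extremal for some slope; comparing the two
   ends of the extremal edges in the commutation relations is contradictory. *)
Lemma wall i : pt E (dom_cone t) (w i) (x i).
Proof.
have /choice [c hc] i' : exists c, [/\ x i' = ev E c, c@_(w i') = 1 &
  forall a, a \in msupp c -> slope_cone (a - w i')] := hx i'.
have /choice [nv hnv] a : exists n : 'cV[int]_nu, slope_cone a -> [/\ a = Bt t *m n,
  forall j, j != k -> 0 <= n j 0 & (forall j, j != k -> n j 0 = 0) -> 0 <= n k 0].
  by have [[n h]|nh] := pselect (slope_cone a); [exists n|exists 0].
pose N i a := nv (a - w i).
have hN i' a : a \in msupp (c i') -> [/\ a = w i' + Bt t *m N i' a,
  forall j, j != k -> 0 <= N i' a j 0 &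
  (forall j, j != k -> N i' a j 0 = 0) -> 0 <= N i' a k 0].
  by move=> /(let: And3 _ _ h := hc i' in h) /hnv [e1 e2 e3]; split=> //; rewrite /N -e1 addrC subrK.
have NB n : slope_cone (Bt t *m n) -> nv (Bt t *m n) = n.
  by move=> /hnv [/(B_inj2 qt) <-].
suff good i' a : a \in msupp (c i') -> 0 <= N i' a k 0.
  have [e1 e2 _] := hc i; exists (c i); split=> // a ac.
  have [ea hj _] := hN i a ac; apply: (@domcP _ _ _ _ (N i a)); first by rewrite {1}ea addrC addKr.
  by move=> j; have [->|nj] := eqVneq j k; [apply: good|apply: hj].
apply: contraPT; rewrite -ltNge => bad ac.
(* All violations, taken over all the x j together; a common extremal slope is needed to compare
   different x j. *)
pose s : seq 'cV[int]_nu := [seq n : 'cV[int]_nu <- [seq N j a' | j <- enum 'I_nu, a' <- (msupp (c j) : seq G)] | n k 0 < 0].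
have sP n : n \in s -> exists j a', [/\ a' \in msupp (c j), n = N j a' & n k 0 < 0].
  rewrite mem_filter => /andP[nk /allpairsPdep [j [a2 [_ ha en]]]].
  by exists j, a2; split.
have sI j a' : a' \in msupp (c j) -> N j a' k 0 < 0 -> N j a' \in s.
  move=> h1 h2; rewrite mem_filter h2.
  by apply/allpairsPdep; exists j, a'; rewrite mem_enum.
have [p [ps pmin]] : exists p, p \in s /\ forall n, n \in s -> lexge0 (slope k p n).
  by apply: (slope_min _ (sI _ _ ac bad)) => n /sP [j [a' [_ _ h]]].
have [i0 [a0 [ac0 ep pk]]] := sP p ps.
have [_ php phz] := hN i0 a0 ac0; rewrite -ep in php phz.
have pnz : ~ (forall j, j != k -> p j 0 = 0) by move=> h; move: (phz h); rewrite leNgt pk.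
(* F vanishes exactly on the line of p and, by extremality of p, is lexicographically nonnegative on
   every exponent that occurs. *)
pose F := slope k p.
have F_ge (n : 'cV[int]_nu) : (forall j, j != k -> 0 <= n j 0) -> 0 <= n k 0 ->
    lexge0 (F n) /\ (F n = 0 -> n k 0 = 0).
  move=> h1 h2; split.
    apply: lexge0_nneg => j; rewrite /F /slope cvD cvN !cvZ.
    have [->|nj] := eqVneq j k; first by rewrite mulrC subrr.
    by move: (h1 j nj) (php j nj) h2 pk; move: (n j 0) (p j 0) (n k 0) (p k 0) => a1 b1 d1 f1; nia.
  move=> F0; apply: contrapT => n0; apply: pnz => j nj.
  have := congr1 (fun x : 'cV_nu => x j 0) F0; rewrite /F /slope cvD cvN !cvZ mxE.
  by move: (h1 j nj) (php j nj) h2 pk n0; move: (n j 0) (p j 0) (n k 0) (p k 0) => a1 b1 d1 f1; nia.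
have FN j a' : a' \in msupp (c j) -> lexge0 (F (N j a')) /\ (F (N j a') = 0 -> N j a' k 0 <= 0).
  move=> h; have [_ h1 _] := hN j a' h.
  have [hk|hk] := leP 0 (N j a' k 0); first by have [u v] := F_ge _ h1 hk; split=> // /v ->.
  by split; [apply/pmin/sI|move=> _; apply: ltW].
(* Two orders that differ only on the face F = 0, where they orient direction k oppositely: w j
   leads x j for the first, and the far end [b j] of the face leads it for the second. *)
pose C (sg : int) a := exists n, a = Bt t *m n /\ (lexpos (F n) \/ (F n = 0 /\ 0 <= sg * n k 0)).
have pC sg : sg != 0 -> pointed_cone (C sg).
  move=> sg0; split.
  - exists 0; rewrite mulmx0; split=> //; right; rewrite /F /slope mxE scale0r scaler0 subrr.
    by rewrite mulr0.
  - move=> a1 a2 [n1 [-> h1]] [n2 [-> h2]]; exists (n1 + n2); rewrite mulmxDr; split=> //.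
    rewrite /F slopeD -/(F n1) -/(F n2) cvD mulrDr.
    case: h1 h2 => [h1|[-> h1]] [h2|[-> h2]]; rewrite ?addr0 ?add0r; [|by left|by left|].
      by left; apply: lexposD.
    by right; split=> //; apply: addr_ge0.
  move=> a1 [n1 [-> h1]] [n2 []] /eqP; rewrite eqr_oppLR -mulmxN => /eqP /(B_inj2 qt) en h2.
  move: h1; rewrite en /F slopeN -/(F n2) cvN => h1.
  case: h2 => [h2|[F2 h2]].
    case: h1 => [h1|[/eqP h1 _]]; first by case: (lexposN h2 h1).
    rewrite oppr_eq0 in h1; move: h2; rewrite (eqP h1) => -[l [hl _]].
    by move: hl; rewrite mxE ltxx.
  case: h1 => [|[_ h1]]; first by rewrite F2 oppr0 => -[l [hl _]]; move: hl; rewrite mxE ltxx.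
  have n2k : n2 k 0 = 0.
    have : sg * n2 k 0 = 0 by move: h1 h2; rewrite mulrN oppr_ge0 => h1 h2; apply/eqP; rewrite eq_le h1 h2.
    by move/eqP; rewrite mulf_eq0 (negbTE sg0) => /eqP.
  move: F2; rewrite /F /slope n2k scale0r sub0r => /eqP; rewrite oppr_eq0 => /eqP /cvZ_eq0 ->; rewrite ?oppr0 ?mulmx0 //.
  by rewrite lt_eqF.
have pt1 j : pt E (C (-1)) (w j) (x j).
  have [e1 e2 _] := hc j; exists (c j); split=> // a' ha; have [ea _ _] := hN j a' ha.
  exists (N j a'); split; first by rewrite {1}ea addrC addKr.
  have [[F0|Fp] Fk] := FN j a' ha; last by left.
  by right; split=> //; rewrite mulN1r oppr_ge0; apply: Fk.
have /choice [b hb] j : exists b, [/\ b \in msupp (c j), F (N j b) = 0 &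
   forall a', a' \in msupp (c j) -> F (N j a') = 0 -> N j b k 0 <= N j a' k 0].
  have w0 : w j \in [seq a' <- msupp (c j) | F (N j a') == 0].
    have [_ e2 h3] := hc j; rewrite mem_filter mem_msupp e2 oner_neq0 andbT /N subrr.
    rewrite -(mulmx0 _ (Bt t)) NB //; last by rewrite mulmx0; case: pcone_lexp.
    by rewrite /F /slope mxE scale0r scaler0 subrr.
  have [b [hb bmin]] := seq_min (fun a' => N j a' k 0) w0.
  move: hb; rewrite mem_filter => /andP[/eqP Fb bc]; exists b; split=> // a' ha Fa.
  by apply: bmin; rewrite mem_filter Fa eqxx.
have pn2 j : pn E (C 1) (b j) (x j).
  have [e1 e2 _] := hc j; have [bc Fb bm] := hb j; exists (c j); split=> //.
    by rewrite -mem_msupp.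
  move=> a' ha; have [ea _ _] := hN j a' ha; have [eb _ _] := hN j (b j) bc.
  exists (N j a' - N j (b j)); split.
    by rewrite {1}ea {1}eb mulmxBr opprD addrACA subrr add0r.
  rewrite /F slopeD slopeN -/(F (N j a')) -/(F (N j (b j))) Fb subr0.
  have [[F0|Fp] _] := FN j a' ha; last by left.
  by right; split=> //; rewrite mul1r cvD cvN subr_ge0; apply: bm.
(* Quasi-commutation gives lambda the same value on both pairs of leading degrees. Vectors of the
   face are proportional, so lambda vanishes between them and only the cross terms remain. *)
have iso j l : dprime t j * (N l (b l)) j 0 = dprime t l * (N j (b j)) l 0.
  have l1 := pn_comm_lam Ksf qt fE (pC (-1) isT) (pt_pn (pt1 j)) (pt_pn (pt1 l)) (hxx j l).
  have l2 := pn_comm_lam Ksf qt fE (pC 1 isT) (pn2 j) (pn2 l) (hxx j l).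
  have [bj Fj _] := hb j; have [bl Fl _] := hb l.
  have [ej _ _] := hN j _ bj; have [el _ _] := hN l _ bl.
  have par (n m : 'cV[int]_nu) : F n = 0 -> F m = 0 -> lam t (Bt t *m n) (Bt t *m m) = 0.
    move=> /eqP; rewrite subr_eq0 => /eqP Fn /eqP; rewrite subr_eq0 => /eqP Fm.
    have : p k 0 * p k 0 * lam t (Bt t *m n) (Bt t *m m) = 0.
      rewrite -mulrA -lamZr -lamZl !scalemxAr -Fn -Fm -!scalemxAr lamZl lamZr.
      by rewrite (lmxx la) !mulr0.
    by move/eqP; rewrite !mulf_eq0 (lt_eqF pk) => /eqP.
  have l3 : lam t (w j + Bt t *m N j (b j)) (w l + Bt t *m N l (b l)) = e j l by rewrite -ej -el.
  move: l3 Fj Fl; move: (N j (b j)) (N l (b l)) => nj nl l3 Fj Fl; move: l3.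
  rewrite !(lamDl, lamDr) l1 par // addr0 lamw (lmC la _ (w j)) lamw opprK.
  by move: (_ * nl j 0) (_ * nj l 0) => a1 b1; lia.
have bk : N i0 (b i0) k 0 < 0.
  have [_ _ bm] := hb i0; apply: le_lt_trans pk; rewrite ep; apply: bm => //.
  by rewrite /F -ep /slope subrr.
have hat j l : l != k -> 0 <= N j (b j) l 0.
  by have [bc _ _] := hb j; have [_ h _] := hN j _ bc; apply: h.
have nonpos j : N j (b j) k 0 <= 0.
  by have [bc Fb _] := hb j; have [_ h] := FN j _ bc; apply: h.
(* If i0 is not k, the two sides of [iso] have opposite signs. If i0 = k, [iso] kills all
   coordinates other than k, and then the last clause of [slope_cone] forces n_k >= 0. *)
have [ei|ni] := eqVneq i0 k; last first.
  move: (iso i0 k) (hat k i0 ni) bk (dprime_gt0 qt i0) (dprime_gt0 qt k).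
  by move: (dprime t i0) (dprime t k) (N k (b k) i0 0) (N i0 (b i0) k 0) => a1 b1 d1 f1; nia.
subst i0; have [bc _ _] := hb k; have [_ _ hz] := hN k _ bc.
suff : 0 <= N k (b k) k 0 by rewrite leNgt bk.
apply: hz => j nj; move: (iso j k) (hat k j nj) (nonpos j) (dprime_gt0 qt j) (dprime_gt0 qt k).
by move: (dprime t j) (dprime t k) (N k (b k) j 0) (N j (b j) k 0) => a1 b1 d1 f1; nia.
Qed.

End Wall.

(** * Compatibility of degrees with one mutation *)

Section Half.
Context {R : vring} {K : unitAlgType R} {nu nf : nat}.
Notation G := 'cV[int]_(nu + nf).
Implicit Types (g h a m : G) (z : K).
Hypothesis Ksf : forall z : K, z != 0 -> z \is a GRing.unit.
Variables (t : qseed nu nf) (E : G -> K) (t1 : qseed nu nf) (E1 : G -> K)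
  (sg : {perm 'I_nu}) (gd : 'I_nu -> G) (Lg : G -> K) (tw : K -> K) (tau : G -> G).
Hypothesis co : core t E t1 E1 sg gd Lg tw tau.
Variable k : 'I_nu.
Let tf := c_tf co.
Let sh := c_sh co.
Let qt : is_quantum_seed t := pf_qt tf.
Let fE : frame (lam t) E := pf_fr tf.
Let hC := pcone_dom qt.
Let Lpt := pf_pt tf.
Let qt1 : is_quantum_seed t1 := sh_qt1 sh.
Let fE1 : frame (lam t1) E1 := sh_fE1 Ksf sh.
Let y := yk t k.
Let uk := uf nf k.
Let kp := sg k.
Let t1' := mutate t1 kp.
Let E1' := mutf t1 kp E1.
Let qt1' : is_quantum_seed t1' := (mutate_quantum qt1 kp).1.
Let fE1' : frame (lam t1') E1' := frame_mutf Ksf kp qt1 fE1.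
Let t' := mutate t k.
Let E' := mutf t k E.
Let qt' : is_quantum_seed t' := (mutate_quantum qt k).1.
Let fE' : frame (lam t') E' := frame_mutf Ksf k qt fE.
Let hC' := pcone_dom qt'.
Notation S := (sbasis t k E).
Notation scoef := (scoef Ksf co k).
Notation Gm := (shift_deg sg gd).

Let Sdom m : pt E (dom_cone t) m (S m).
Proof. by apply: pt_sub (pt_Sb k qt fE m) => a; apply: strc_dom. Qed.

Let Sdom' m : pt E' (dom_cone t') (trop t k m) (S m).
Proof. by apply: pt_sub (pt_Sb' Ksf k qt fE m) => a; apply: strc_dom. Qed.

Let ti := @trop_inj nu nf t k qt.

Let Slexp m : pt E' (slope_cone t' k) (trop t k m) (S m).
Proof.
apply: pt_sub (pt_Sb' Ksf k qt fE m) => a [n ->]; exists (n%:Z *: delta_mx k 0).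
split; first by rewrite -scalemxAr.
  by move=> j nj; rewrite cvZ mxE (negbTE nj) mulr0.
by move=> _; rewrite cvZ mxE !eqxx mulr1.
Qed.

(** By [trop_B] only the k-th coordinate can turn negative, and terms on the k-string above g, where
    the other coordinates vanish, are excluded by hypothesis. *)
Lemma trop_lexp (a : {malg R[G]}) g : a@_g = 1 ->
  (forall m, m \in msupp a -> dom_cone t (m - g)) ->
  (forall n : nat, (0 < n)%N -> a@_(g + n%:Z *: y) = 0) ->
  pt E' (slope_cone t' k) (trop t k g) (ev S a).
Proof.
move=> a1 sa top; apply: (pt_ev fE' (pcone_lexp k qt') Slexp ti) => // m ms.
have /domcE [n [en hn]] := sa m ms.
have em : m = g + Bt t *m n by rewrite -en addrC subrK.
have [n' [en' hn']] := trop_B qt k g n.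
exists n'; split; first by rewrite em en' addrC addKr.
  by move=> j nj; rewrite hn'.
move=> z; have nk : n = n k 0 *: delta_mx k 0.
  apply/colP => j; rewrite cvZ mxE andbT; have [->|nj] := eqVneq j k; first by rewrite mulr1.
  by rewrite mulr0 -hn' // z.
have [n0|n0] := eqVneq (n k 0) 0.
  rewrite (_ : n' = 0) ?mxE //; apply: (B_inj qt').
  by apply: (addrI (trop t k g)); rewrite -en' nk n0 scale0r mulmx0 !addr0.
move: ms; rewrite mem_msupp em nk -scalemxAr -/(yk t k) -/y -(gez0_abs (hn k)) top ?eqxx //.
by rewrite absz_gt0.
Qed.

Definition mut_shift_deg i : G := trop t k (if i == k then V_deg t1 sg gd k else gd i).

Let gdk i : i != k -> gd i uk 0 = 0.
Proof. by move=> ni; rewrite (sh_uf sh) eq_sym (negbTE ni) oppr0. Qed.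

Let wdE i : i != k -> mut_shift_deg i = gd i.
Proof. by move=> ni; rewrite /mut_shift_deg (negbTE ni) trop_0 // gdk. Qed.

Let zV_uf j : V_deg t1 sg gd k (uf nf j) 0 = (j == k)%:R - posp (Bt t (uf nf j) k).
Proof.
rewrite /V_deg (Gm_uf sh) cvD /gm fmutE ykE uf_eq (inj_eq perm_inj) (c_B co) pospN.
by case: (j == k); rewrite /=; ring.
Qed.

Let zV_k : V_deg t1 sg gd k uk 0 = 1.
Proof. by rewrite zV_uf eqxx Bkk // posp0 subr0. Qed.

Let V := E1' (fb (uf nf kp)).
Let fb_ge (i : 'I_(nu + nf)) j : 0 <= (fb i : G) (uf nf j) 0.
Proof. by rewrite fbE. Qed.

Let Vlp : laurent E V /\ laurent E' V.
Proof. by have [h1 h2] := uca_E1' Ksf co k (fb_ge (uf nf kp)); split; last exact: (h2 k). Qed.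

(** The k-string above the degree of V is empty in its expansion because V has the same leading
    degree for dominance and for [lex_cone]. *)
Let V_lexp : pt E' (slope_cone t' k) (mut_shift_deg k) V.
Proof.
have [h1 h2] := Vlp; have [a ea] := Sb_span Ksf qt fE h1 h2.
have [c [ec c1 hc]] := pt_V Ksf co k; rewrite -/kp -/E1' -/V ea in ec.
rewrite /mut_shift_deg eqxx ea; apply: trop_lexp.
- by rewrite -(triang_coef fE hC Sdom (@inj_id G) ec hc).
- exact: (triang_supp fE hC Sdom (@inj_id G) ec hc).
move=> n n0; apply/eqP; apply: contraT; rewrite -mem_msupp => ms.
have [d [ed _ hd]] := V_lexm Ksf co k; rewrite -/kp -/E1' -/V ea in ed.
have := triang_supp fE (pcone_lexm k qt) (pt_Sb_lexm k qt fE) (@dlm_inj _ _ t k qt) ed hd ms.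
rewrite /dlm cvD cvZ /y yk_k // mulr0 addr0 -/uk zV_k (_ : posp (- 1) = 0) // scale0r addr0.
rewrite addrC addKr => -[n1 [e h3 h4]].
have {}e : n1 = n%:Z *: delta_mx k 0.
  by apply: (B_inj2 qt); rewrite -e -scalemxAr.
have := h4; rewrite e cvZ mxE !eqxx mulr1 => /(_ _); suff : True -> n%:Z <= 0 by move/(_ I); lia.
move=> _; have := h4; rewrite e cvZ mxE !eqxx mulr1; apply=> j nj.
by rewrite cvZ mxE (negbTE nj) mulr0.
Qed.

Let x i := E1' (fb (uf nf (sg i))).

Let xE i : i != k -> x i = E1 (fb (uf nf (sg i))).
Proof.
move=> ni; rewrite /x /E1' mutf_id // fbE uf_eq (inj_eq perm_inj) eq_sym (negbTE ni) //.
Qed.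

Lemma wd_uf i j : mut_shift_deg i (uf nf j) 0 = - (j == i)%:R.
Proof.
have [->|ni] := eqVneq i k; last by rewrite wdE // (sh_uf sh).
rewrite /mut_shift_deg eqxx; have [->|nj] := eqVneq j k; first by rewrite trop_k zV_k.
by rewrite mxE uf_eq (negbTE nj) zV_k /= mulr1 zV_uf (negbTE nj) sub0r addNr.
Qed.

(** The variables of t1' quasi-commute and have unfrozen degrees -f_i in t', so [wall] applies to
    all of them simultaneously. *)
Lemma pt_wd i : pt E' (dom_cone t') (mut_shift_deg i) (x i).
Proof.
apply: (@wall R K nu nf Ksf t' k E' qt' fE' x mut_shift_deg
  (fun i j => lam t1' (fb (uf nf (sg i))) (fb (uf nf (sg j))))); last first.
- by move=> i' j; apply: (E_comm (lam_alt qt1') fE1').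
- exact: wd_uf.
move=> i'; have [->|ni] := eqVneq i' k; first exact: V_lexp.
rewrite xE // (E1_L Ksf co (fb_ge _)) Gm_fb /mut_shift_deg (negbTE ni) (cf_E Ksf co k).
apply: trop_lexp; [exact: cf_1|exact: cf_supp|].
by move=> n n0; apply: (cf_top Ksf co k).
Qed.

Lemma sh_mutate : shiftd t' E' t1' E1' sg mut_shift_deg.
Proof.
split=> //.
- have [ks [e1 e2]] := sh_conn sh; exists (k :: (ks ++ [:: kp])).
  by rewrite /= mutateK // mutf_mutfK // mutate_seq_cat mutf_seq_cat -e1 -e2.
- exact: pt_wd.
by move=> i j; rewrite wd_uf.
Qed.

Let Gm' := shift_deg sg mut_shift_deg.

Let Gm'E m : m (uf nf kp) 0 = 0 -> Gm' m = Gm m.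
Proof.
move=> m0; rewrite /Gm' !GmE; congr (_ + _); apply: eq_bigr => j _.
by have [->|nj] := eqVneq j k; [rewrite m0 !scale0r|rewrite wdE].
Qed.

Let g1 := gm t1 kp.
Let y1 := yk t1 kp.
Let u1 := g1 + fb (uf nf kp).

Let VI : V * E1 (fb (uf nf kp)) = vp (lam t1 g1 (fb (uf nf kp))) *: E1 u1 +
   vp (lam t1 (g1 + y1) (fb (uf nf kp))) *: E1 (u1 + y1).
Proof.
rewrite /V /E1' (mutf_fb _ fE1) /mutW mulrDl; have [_ -> _] := fE1; have [_ -> _] := fE1.
by rewrite /u1 (addrAC g1).
Qed.

Let u1_k : u1 (uf nf kp) 0 = 0.
Proof. by rewrite cvD fbE eqxx (gm_k kp qt1) addNr. Qed.

Let u1y_k : (u1 + y1) (uf nf kp) 0 = 0.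
Proof. by rewrite cvD u1_k /y1 yk_k // addr0. Qed.

Let u1_ge j : 0 <= u1 (uf nf j) 0.
Proof.
rewrite cvD fbE /g1 /gm fmutE -/kp uf_eq; have := posp_ge0 (- Bt t1 (uf nf j) kp).
by case: (j == kp); lia.
Qed.

Let u1y_ge j : 0 <= (u1 + y1) (uf nf j) 0.
Proof.
rewrite cvD cvD fbE /g1 /gm fmutE -/kp uf_eq /y1 ykE pospN.
by have := posp_ge0 (Bt t1 (uf nf j) kp); case: (j == kp); lia.
Qed.

Let p0 := Gm u1.
Let pt0 : pt E' (dom_cone t') p0 (E1 u1).
Proof.
rewrite /p0 -Gm'E // -(mutf_id t1 E1 u1_k) -/E1'.
exact: (pt_E1 Ksf sh_mutate).
Qed.

Let pt1 : pt E' (dom_cone t') (p0 - y) (E1 (u1 + y1)).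
Proof.
have -> : p0 - y = Gm (u1 + y1) by rewrite GmD /y1 (Gm_yk Ksf co).
rewrite -Gm'E // -(mutf_id t1 E1 u1y_k) -/E1'.
exact: (pt_E1 Ksf sh_mutate).
Qed.

Let p0_k : p0 uk 0 = 0.
Proof. by rewrite (Gm_uf sh) u1_k oppr0. Qed.

Let gam_k : gd k uk 0 = -1. Proof. by rewrite (sh_uf sh) eqxx. Qed.

(* I_k is t'-pointed because V * I_k and V are. *)
Let Ik_pt : pt E' (dom_cone t') (trop t k (gd k)) (E1 (fb (uf nf kp))).
Proof.
have h1 : laurent E' (E1 (fb (uf nf kp))).
  by rewrite (E1_L Ksf co (fb_ge _)); apply: (c_lp co [:: k]).
have h2 : pn E' (dom_cone t') p0 (V * E1 (fb (uf nf kp))).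
  rewrite VI; set al := lam _ _ _; set be := lam _ _ _.
  rewrite -[vp be](mulr1) -(vpKN R al) mulrC -mulrA -scalerA -scalerDr.
  apply: (pnZ Ksf fE' (vp_neq0 _ _)); apply/pt_pn.
  apply: (ptD hC' (h := p0 - y)) => //.
    by move=> /eqP; rewrite eq_sym subr_eq addrC -subr_eq subrr eq_sym => /eqP; apply: yk_neq0.
  rewrite addrAC subrr add0r /y -yk_mutate //; exact: strc_dom (strc_yk t' k).
have h3 := pt_divl Ksf fE' hC' h1 (pt_wd k) h2.
have eg : p0 - mut_shift_deg k = trop t k (gd k).
  rewrite /mut_shift_deg eqxx trop_ge0 ?zV_k // scale1r trop_le0 ?gam_k //.
  have -> : V_deg t1 sg gd k = p0 - y - gd k.
    have e : gd k = Gm (fb (uf nf kp)) by rewrite Gm_fb.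
    rewrite /V_deg e /p0 /u1 !GmD (Gm_yk Ksf co) -/y.
    by move: (Gm _) (Gm _) => a b; zmx.
  have PN a : Pm t k (- a) = - Pm t k a by rewrite -scaleN1r PmZ // scaleN1r.
  rewrite !(PmD qt) !PN (Pm_id t p0_k) (Pm_id t (yk_k qt k)) -/y.
  by move: p0 y (Pm _ _ _) => a b d; zmx.
rewrite eg in h3; have [c [ec nc hc]] := h3; exists c; split=> //.
rewrite (E1_L Ksf co (fb_ge _)) Gm_fb (cf_E Ksf co k) in ec.
by rewrite (triang_coef fE' hC' Sdom' ti ec hc) cf_1.
Qed.

Let I_pt j : pt E' (dom_cone t') (trop t k (gd j)) (E1 (fb (uf nf (sg j)))).
Proof.
have [->|nj] := eqVneq j k; first exact: Ik_pt.
by rewrite -xE // trop_0 ?gdk // -wdE //; apply: pt_wd.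
Qed.

Let side (a b : G) : (forall j, 0 <= a (uf nf j) 0) -> (forall j, 0 <= b (uf nf j) 0) ->
  same_side k (Gm a) (Gm b).
Proof. by move=> ha hb; right; rewrite !(Gm_uf sh) !oppr_le0. Qed.

(** The degrees of these monomials have k-coordinate at most 0, a half-space where the tropical map
    is linear and isometric; it therefore suffices to treat the generators. *)
Lemma pt_E1_half m : (forall j, 0 <= m (uf nf j) 0) -> pt E' (dom_cone t') (trop t k (Gm m)) (E1 m).
Proof.
move=> hm; pose P m := (forall j, 0 <= m (uf nf j) 0) /\ pt E' (dom_cone t') (trop t k (Gm m)) (E1 m).
have PD a b : P a -> P b -> P (a + b).
  move=> [na ha] [nb hb]; split; first by move=> j; rewrite cvD addr_ge0.
  rewrite GmD (trop_add qt (side na nb)) (E_add fE1) -(Gm_lam Ksf sh) -(trop_lam qt (side na nb)).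
  exact: (ptM fE' hC').
have Pfr (u : G) : (forall j, u (uf nf j) 0 = 0) -> P u.
  move=> hu; split; first by move=> j; rewrite hu.
  rewrite (Gm_frozen sg gd hu) trop_0 // (E1_frozen sh hu) -(mutf_id t E (hu k)) -/E'.
  by apply: pt_mon; apply: domc0.
have P0 : P 0 by apply: Pfr => j; rewrite mxE.
have Pn j (n : nat) : P (n%:Z *: fb (uf nf j)).
  elim: n => [|n IH]; first by rewrite scale0r.
  rewrite intS scalerDl scale1r; apply: (PD) _ IH; split; first exact: fb_ge.
  by rewrite -[j](permKV sg) Gm_fb; apply: I_pt.
have [u [e hu]] := ufp_split m; suff [] : P m by [].
rewrite e; apply: (PD); last exact: Pfr.
by apply: (big_ind P P0 (PD)) => j _; rewrite -(gez0_abs (hm j)); exact: Pn.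
Qed.

(** The factors of J_h carry the positive and the negative part of h_k respectively, so their
    degrees lie on the same side of the wall and the tropical map adds up. *)
Lemma pt_J_half h : pt E' (dom_cone t') (trop t k h) (Jm t E E1 sg gd h).
Proof.
set a := Ja sg gd h; set mu := Jmu (nf := nf) sg h.
have ha j : 0 <= a (uf nf j) 0 by rewrite (Ja_uf co) posp_ge0.
have hs : same_side k a (Gm mu).
  rewrite /same_side (Ja_uf co) (Gm_uf sh) Jmu_uf /posp.
  by move: (h (uf nf k) 0) => b; lia.
have eh : a + Gm mu = h := Ja_Gm sg gd h.
rewrite -{1}eh (trop_add qt hs) /Jm -/a -/mu -(trop_lam qt hs).
apply: (ptM fE' hC'); last by apply: pt_E1_half; apply: Jmu_ge0.
rewrite -(Sb_ge0 t E (ha k)); exact: Sdom'.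
Qed.

(* The coefficient of a non-dominated S m in Lg g is cancelled by a coefficient
   in m, and is bar-invariant. *)
Lemma half_step g : pt E' (dom_cone t') (trop t k g) (Lg g).
Proof.
have /choice [b hb] h : exists b, [/\ Jm t E E1 sg gd h = ev Lg b, b@_h = 1,
    forall m, m != h -> vmm b@_m & forall m, m \in msupp b -> dom_cone t (m - h)].
  exact: (Tri_supp tf (Tri_J Ksf co h)).
pose good h m := dom_cone t' (trop t k m - trop t k h).
have good_tr h l m : good h l -> good l m -> good h m.
  move=> h1 h2; rewrite /good -[trop t k m](subrK (trop t k l)) -addrA.
  exact: (domcD qt').
suff key n h m : height t (m - h) n -> ~ good h m -> (scoef h)@_m = 0 /\ (b h)@_m = 0.
  rewrite (cf_E Ksf co k g); apply: (pt_ev fE' hC' Sdom' ti); first exact: cf_1.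
  move=> m ms; apply: contrapT => bad; have [n hn] := hgt_ex (cf_supp ms).
  by have [] := key _ _ _ hn bad => /eqP; rewrite mcoeff_eq0 ms.
elim: n {-2}n (leqnn n) h m => [|N IH] n hn h m hm bad.
  exfalso; apply: bad; have : m - h = 0.
    by apply: contrapT => /(hgt_gt0 hm); lia.
  by move=> /eqP; rewrite subr_eq0 => /eqP ->; rewrite /good subrr; apply: domc0.
have nmh : h != m.
  by apply/eqP => e; apply: bad; rewrite /good e subrr; apply: domc0.
have [e1 b1 bm bs] := hb h.
pose j := \sum_(l <- msupp (b h)) (b h)@_l *: scoef l.
have ej : Jm t E E1 sg gd h = ev S j.
  by rewrite e1; apply: ev_coef => l _; apply: (cf_E Ksf co k).
have jm : j@_m = 0.
  apply/eqP; apply: contraT; rewrite -mem_msupp => ms; case: bad.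
  have [c [ec _ hc]] := pt_J_half h; rewrite ej in ec.
  exact: (triang_supp fE' hC' Sdom' ti ec hc).
(* In the expansion of J_h every intermediate l contributes zero: the pair h, l or the pair l, m is
   bad, and of smaller height. *)
have sum0 : (scoef h)@_m + (b h)@_m = 0.
  have ejm : j@_m = \sum_(l <- msupp (b h)) (b h)@_l * (scoef l)@_m.
    by rewrite /j mcoeff_sum; apply: eq_bigr => l _; exact: mcoeffZ.
  rewrite -jm ejm (big_two (fset_uniq _) nmh).
  - by rewrite b1 cf_1 (mul1r (scoef h)@_m) (mulr1 (b h)@_m).
  - by move=> l; rewrite (mcoeff_outdom l) mul0r.
  - by move=> l; rewrite (mcoeff_outdom l) mul0r.
  move=> l ls nl nm.
  have [mc|mc] := boolP (m \in msupp (scoef l)); last by rewrite (mcoeff_outdom mc) mulr0.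
  have [q hq] := hgt_ex (cf_supp mc); have [r hr] := hgt_ex (bs l ls).
  have r0 : (0 < r)%N by apply: hgt_gt0 hr _; move/eqP; rewrite subr_eq0; apply/negP.
  have q0 : (0 < q)%N by apply: hgt_gt0 hq _; move/eqP; rewrite subr_eq0 eq_sym; apply/negP.
  have eqn : n = (q + r)%N by apply: (hgtD qt hq hr); rewrite addrA subrK.
  have [gl|ngl] := pselect (good h l).
    rewrite (IH q _ l m hq _).1 ?mulr0 //; first by lia.
    by move=> glm; apply: bad; apply: good_tr gl glm.
  by rewrite (IH r _ h l hr ngl).2 ?mul0r //; lia.
have bz : (b h)@_m = 0.
  apply: vmm_bar; first by apply: bm; rewrite eq_sym.
  have -> : (b h)@_m = - (scoef h)@_m by apply/eqP; rewrite -addr_eq0 addrC sum0.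
  by rewrite vbarN cf_bar.
by split=> //; rewrite -sum0 bz addr0.
Qed.

End Half.

(** * Transport of the triangular data along one mutation *)

Section Full.
Context {R : vring} {K : unitAlgType R} {nu nf : nat}.
Notation G := 'cV[int]_(nu + nf).
Implicit Types (g h a m : G) (z : K).
Hypothesis Ksf : forall z : K, z != 0 -> z \is a GRing.unit.
Variables (t : qseed nu nf) (E : G -> K) (t1 : qseed nu nf) (E1 : G -> K)
  (sg : {perm 'I_nu}) (gd : 'I_nu -> G) (Lg : G -> K) (tw : K -> K) (tau : G -> G).
Hypothesis co : core t E t1 E1 sg gd Lg tw tau.
Variable k : 'I_nu.
Let tf := c_tf co.
Let sh := c_sh co.
Let qt : is_quantum_seed t := pf_qt tf.
Let fE : frame (lam t) E := pf_fr tf.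
Let hC := pcone_dom qt.
Let Lpt := pf_pt tf.
Let qt1 : is_quantum_seed t1 := sh_qt1 sh.
Let fE1 : frame (lam t1) E1 := sh_fE1 Ksf sh.
Let y := yk t k.
Let uk := uf nf k.
Let kp := sg k.
Let t1' := mutate t1 kp.
Let E1' := mutf t1 kp E1.
Let fE1' : frame (lam t1') E1' := frame_mutf Ksf kp qt1 fE1.
Let t' := mutate t k.
Let E' := mutf t k E.
Let qt' : is_quantum_seed t' := (mutate_quantum qt k).1.
Let fE' : frame (lam t') E' := frame_mutf Ksf k qt fE.
Let la' := lam_alt qt'.
Let hC' := pcone_dom qt'.
Notation Gm := (shift_deg sg gd).

Let hs := half_step Ksf co k.

Definition mut_basis h : K := Lg (trop (mutate t k) k h).

Let tropK h : trop t k (trop t' k h) = h.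
Proof. by have := trop_mutateK k h qt'; rewrite /t' mutateK. Qed.

Let tropK' h : trop t' k (trop t k h) = h.
Proof. exact: trop_mutateK. Qed.

Lemma Lmut_trop g : mut_basis (trop t k g) = Lg g.
Proof. by rewrite /mut_basis tropK'. Qed.

Lemma Lmut_eq g m : pt E' (dom_cone t') m (Lg g) -> Lg g = mut_basis m.
Proof. by move=> /(pt_uniq fE' hC' (hs g)) <-; rewrite Lmut_trop. Qed.

Lemma pt_Lmut h : pt E' (dom_cone t') h (mut_basis h).
Proof. by rewrite -{1}(tropK h); apply: hs. Qed.

Lemma pf_mut : pfam t' E' mut_basis.
Proof.
split=> // [|h]; first exact: pt_Lmut.
apply: (barinv_transfer Ksf qt fE); first exact: (pf_bar tf).
exact: (c_lp co [:: k]).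
Qed.

Lemma lp_Lmut z : laurent Lg z -> laurent mut_basis z.
Proof. by case=> b ->; apply: lp_ev => g _; rewrite -Lmut_trop; apply: lpU. Qed.

Lemma ev_Lmut (b : {malg R[G]}) : exists b' : {malg R[G]}, ev Lg b = ev mut_basis b' /\ forall m, b'@_m = b@_(trop t' k m).
Proof.
exists (\sum_(a <- msupp b) mkmalgU (trop t k a) b@_a); split.
  by rewrite ev_sum; apply: eq_bigr => a _; rewrite evU Lmut_trop.
move=> m; rewrite mcoeff_sum.
have [mb|mb] := boolP (trop t' k m \in msupp b).
  rewrite (bigD1_seq _ mb (fset_uniq _)) /= tropK mcoeffUU big1 ?addr0 // => a na.
  by rewrite mcoeffU; case: eqP => // e; rewrite -e tropK' eqxx in na.
rewrite (mcoeff_outdom mb) big1_seq // => a /andP[_ ab].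
by rewrite mcoeffU; case: eqP => // e; rewrite -e tropK' ab in mb.
Qed.

(* Triangularity is a condition on coefficients only, once pointedness is known. *)
Lemma Tri_mut h z : pt E' (dom_cone t') h z ->
  (exists b, z = ev Lg b /\ forall m, m != trop t' k h -> vmm b@_m) ->
  Tri t' E' mut_basis h z.
Proof.
move=> hz [b [eb hb]]; split=> //; have [b' [e1 e2]] := ev_Lmut b.
exists b'; split; first by rewrite eb e1.
move=> m nm; rewrite e2; apply: hb; apply: contra_neq nm => e.
by rewrite -(tropK m) e tropK.
Qed.

Lemma pt_scale_eq s (F : G -> K) (C : G -> Prop) g h (c : R) x z : is_quantum_seed s -> frame (lam s) F ->
  pointed_cone C -> pt F C g x -> pt F C h z -> x = c *: z -> x = z.
Proof.
move=> qs fF pC px pz e; have [c0|nc] := eqVneq c 0.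
  by have := pn_neq0 fF (pt_pn px); rewrite e c0 scale0r eqxx.
have gh : g = h.
  by apply: (pn_uniq fF pC (pt_pn px)); rewrite e; apply: (pnZ Ksf fF nc (pt_pn pz)).
subst h; have [b [eb b1 _]] := px; have [d [ed d1 _]] := pz.
have ebd : b = c *: d by apply: (ev_inj fF); rewrite evZ -eb -ed.
by rewrite e (_ : c = 1) ?scale1r //; rewrite -b1 ebd mcoeffZ d1 mulr1.
Qed.

Hypothesis hX : forall d : nat, exists h, E' (d%:Z *: fb uk) = Lg h.

Let Edom m : pt E (dom_cone t) m (E m).
Proof. by apply: pt_mon; apply: domc0. Qed.

Let Edom' m : pt E' (dom_cone t') m (E' m).
Proof. by apply: pt_mon; apply: domc0. Qed.

(** X(t')^m is a monomial of t free of X_k times a power of X_k', which lies in L by hypothesis; the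
    product is triangular and bar-invariant. *)
Lemma E'_L m : (forall j, 0 <= m (uf nf j) 0) -> exists g, E' m = Lg g.
Proof.
move=> hm; have mk := hm k; rewrite -/uk in mk.
have [h eh] := hX (absz (m uk 0)); rewrite gez0_abs // in eh.
pose a := m0 k m; have ak : a uk 0 = 0 by apply: m0_k.
have ha j : 0 <= a (uf nf j) 0.
  have [->|nj] := eqVneq j k; first by rewrite -/uk ak.
  by rewrite /a m0_def cvD cvN cvZ fbE uf_eq (negbTE nj) mulr0 subr0.
have Z := Tri_mulE Ksf tf ha (Tri_L tf h); set z := _ *: _ in Z.
have em : E' m = z.
  have hp : pt E (dom_cone t) (Pm t k m) (E' m).
    by apply: pt_sub (pt_mutf qt fE mk) => b; apply: strc_dom.
  apply: (pt_scale_eq (c := vp (lam t a h - lam t' a (m uk 0 *: fb uk))) qt fE hC hp Z.1).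
  rewrite /z scalerA -vpD addrAC subrr add0r -eh -(mutf_id t E ak) -/E'.
  by rewrite -(E_add fE') /a m0_def subrK.
exists (a + h); rewrite em; apply: (Tri_bar tf) => //; rewrite -em.
exact: (barinv_mutf Ksf qt fE).
Qed.

Lemma E'_Lmut m : (forall j, 0 <= m (uf nf j) 0) -> E' m = mut_basis m.
Proof. by move=> hm; have [g eg] := E'_L hm; rewrite eg; apply: Lmut_eq; rewrite -eg. Qed.

Let fk : G := fb uk.
Let fk_k : fk uk 0 = 1. Proof. by rewrite fbE eqxx. Qed.
Let fk_ge j : 0 <= fk (uf nf j) 0. Proof. by rewrite fbE. Qed.

Let g0 := gm t k.

Let X_L : E' fk = Lg g0.
Proof.
rewrite (E'_Lmut fk_ge) /mut_basis trop_ge0 ?fk_k // scale1r Pm_fb gm_mutate // yk_mutate //.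
by rewrite addrK.
Qed.

Let g0_k : g0 uk 0 = -1. Proof. exact: gm_k. Qed.

Let Jh g := Jm t E E1 sg gd g.

(** Here J has no factor X_k, so X_k' moves past the monomial of t up to a power of v. What remains
    is a member of L between monomials of t and of t1. *)
Let TriX_neg h : 0 <= h uk 0 -> exists b,
  vp (- lam t' fk h) *: (E' fk * Jh (trop t' k h)) = ev Lg b /\
  forall m, m != trop t' k (fk + h) -> vmm b@_m.
Proof.
move=> hk; set g := trop t' k h.
have gk : g uk 0 <= 0 by rewrite /g trop_k oppr_le0.
have ss : same_side k fk h by left; rewrite -/uk fk_k.
have tfk : trop t' k fk = g0.
  by rewrite trop_ge0 ?fk_k // scale1r Pm_fb gm_mutate // yk_mutate // addrK.
have el : lam t' fk h = lam t g0 g.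
  by rewrite -(trop_lam qt' ss) /t' mutateK // -/t' tfk.
rewrite (trop_add qt' ss) tfk -/g el.
pose a := Ja sg gd g; pose mu := Jmu (nf := nf) sg g.
have ak : a uk 0 = 0 by rewrite (Ja_uf co) /posp -/uk; lia.
have ha j : 0 <= a (uf nf j) 0 by rewrite (Ja_uf co) posp_ge0.
have hmu : forall j, 0 <= mu (uf nf j) 0 by apply: Jmu_ge0.
have Z := Tri_mulE Ksf tf ha (Tri_mulE1r Ksf co g0 hmu); set z := _ *: _ in Z.
have eg : a + Gm mu = g by apply: Ja_Gm.
have XJ : pt E (dom_cone t) (g0 + g) (vp (- lam t g0 g) *: (E' fk * Jh g)).
  by apply: (ptM fE hC); [rewrite X_L|apply: (Tri_J Ksf co g).1].
have [_ [b [eb hb]]] := Z; exists b; rewrite -eb; split; last first.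
  by move=> m nm; apply: hb; rewrite addrA eg addrC.
apply: (pt_scale_eq (c := vp (- lam t g0 g - lam t a (Gm mu) + lam t' fk a *+ 2
   + lam t a (Gm mu + g0) + lam t g0 (Gm mu))) qt fE hC XJ Z.1).
rewrite /z /Jh /Jm -/a -/mu -X_L.
have comm : E' fk * E a = vp (lam t' fk a *+ 2) *: (E a * E' fk).
  by rewrite -(mutf_id t E ak) -/E' (E_comm la' fE') mulr_natl.
rewrite -!scalerAr (mulrA (E' fk)) comm -scalerAl -!mulrA !scalerA -!vpD.
by apply: eq_scale => //; congr vp; ring.
Qed.

(** Here J contains a positive power of X_k, so both exchange monomials multiply it into a product
    of the same type; the second one acquires a strictly negative power of v and so lies in m. *)
Let TriX_pos h : h uk 0 < 0 -> exists b,
  vp (- lam t' fk h) *: (E' fk * Jh (trop t' k h)) = ev Lg b /\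
  forall m, m != trop t' k (fk + h) -> vmm b@_m.
Proof.
move=> hk; set g := trop t' k h.
have gk : 0 < g uk 0 by rewrite /g trop_k oppr_gt0.
have e1 : trop t' k (fk + h) = g0 + y + g.
  rewrite (trop_le0 qt'); last by rewrite cvD fk_k; move: hk; move: (h uk 0) => c; lia.
  by rewrite (PmD qt') Pm_fb gm_mutate // /g (trop_le0 qt' (ltW hk)).
have el : lam t' fk h = lam t (g0 + y) g.
  rewrite lam_mutate Pm_fb -/g0.
  have -> : Pm t k h = g + g uk 0 *: y.
    rewrite /g trop_k (trop_le0 qt' (ltW hk)) Pm_mutate // -/y scaleNr addrK //.
  rewrite lamDr lamDl lamZr lam_yk // lamr_yk // -/uk g0_k; ring.
rewrite e1 el.
pose a := Ja sg gd g; pose mu := Jmu (nf := nf) sg g.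
have ak : a uk 0 = g uk 0 by rewrite (Ja_uf co) /posp -/uk; lia.
have ha j : 0 <= a (uf nf j) 0 by rewrite (Ja_uf co) posp_ge0.
have hmu : forall j, 0 <= mu (uf nf j) 0 by apply: Jmu_ge0.
have eg : a + Gm mu = g by apply: Ja_Gm.
have Gk : (Gm mu) uk 0 = 0.
  by rewrite (Gm_uf sh) Jmu_uf /posp -/uk; lia.
have h1 j : 0 <= (g0 + a) (uf nf j) 0.
  rewrite cvD; have [->|nj] := eqVneq j k; first by rewrite -/uk g0_k ak; lia.
  by rewrite addr_ge0 // /g0 /gm fmutE uf_eq (negbTE nj) oppr0 add0r posp_ge0.
have h2 j : 0 <= (g0 + y + a) (uf nf j) 0.
  rewrite 2!cvD; have [->|nj] := eqVneq j k.
    by rewrite -/uk g0_k ak /y yk_k //; lia.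
  rewrite addr_ge0 // /g0 /gm fmutE uf_eq (negbTE nj) oppr0 add0r /y ykE pospN subrK.
  exact: posp_ge0.
have [_ [b1 [eb1 hb1]]] := Tri_EE1 Ksf co h1 hmu.
have [_ [b2 [eb2 hb2]]] := Tri_EE1 Ksf co h2 hmu.
have [p1 _] := Tri_EE1 Ksf co h1 hmu.
exists (b2 + vp (- (dprime t k * g uk 0)) *: b1); split.
  have eX : E' fk = E g0 + E (g0 + y) := mutf_fb k fE.
  rewrite evD evZ -eb1 -eb2 /Jh /Jm -/a -/mu eX.
  have [_ EM _] := fE; rewrite -scalerAr mulrA mulrDl !EM mulrDl !scalerDr -!scalerAl !scalerA -!vpD addrC.
  by congr (_ + _); apply: eq_scale => //; congr vp; rewrite -eg !(lamDl, lamDr) ?lam_yk // -/uk ?cvD ?Gk ?ak; ring.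
move=> m nm; rewrite mcoeffD mcoeffZ; apply: vmmD; first by apply: hb2; rewrite -addrA eg.
have D0 := dprime_gt0 qt k; have neg : - (dprime t k * g uk 0) < 0 by rewrite oppr_lt0 mulr_gt0.
have [em|nm2] := eqVneq m (g0 + a + Gm mu); last first.
  by apply: vmm_vp (ltW neg) _; apply: hb1.
have -> : b1@_m = 1.
  have [b3 [e3 c3 _ _]] := Tri_supp tf (Tri_EE1 Ksf co h1 hmu).
  by rewrite em -c3; congr (mcoeff _ _); apply: (L_inj tf); rewrite -eb1 -e3.
by rewrite mulr1; apply: vmm_vp1.
Qed.

Let T3k h : Tri t' E' mut_basis (fk + h) (vp (- lam t' fk h) *: (E' fk * mut_basis h)).
Proof.
pose J h := Jh (trop t' k h).
have hJ h' : Tri t' E' mut_basis h' (J h').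
  apply: Tri_mut; first by rewrite -{1}(tropK h'); exact: (pt_J_half Ksf co k).
  by have [_ [b hb]] := Tri_J Ksf co (trop t' k h'); exists b.
apply: (Tri_ind (J := J) (e := fun h => lam t' fk h) pf_mut (lin_mull (E' fk)) hJ).
- move=> h1 h2 dh; rewrite -[h2](subrK h1) lamDr -subr_le0 addrK.
  exact: (lam_domc qt' dh).
- move=> h1; split; first by apply: (ptM fE' hC') => //; apply: pt_Lmut.
  by apply: lp_Lmut; rewrite X_L; apply: (tf_mul tf).
move=> h1; apply: Tri_mut.
  by apply: (ptM fE' hC') => //; rewrite -{1}(tropK h1); exact: (pt_J_half Ksf co k).
by have [hk|hk] := leP 0 (h1 uk 0); [apply: TriX_neg|apply: TriX_pos].
Qed.

Lemma tf_mut : tfam t' E' mut_basis.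
Proof.
split.
- exact: pf_mut.
- move=> i h; have [->|ni] := eqVneq i uk; first exact: T3k.
  have fi : (fb i : G) uk 0 = 0 by rewrite fbE eq_sym (negbTE ni).
  have ss : same_side k (fb i) h.
    by rewrite /same_side -/uk fi; move: (h uk 0) => c; lia.
  apply: Tri_mut; first by apply: (ptM fE' hC') => //; apply: pt_Lmut.
  have [_ [b [eb hb]]] := tf_T3 tf i (trop t' k h); exists b; split.
    rewrite -eb /E' (mutf_id t E fi); apply: eq_scale => //; congr (vp (- _)).
    by rewrite -(trop_lam qt' ss) /t' mutateK // -/t' (trop_0 qt' fi).
  by move=> m; rewrite (trop_add qt' ss) (trop_0 qt' fi); apply: hb.
- by move=> m hm; apply: E'_Lmut.
by move=> g h; apply: lp_Lmut; apply: (tf_mul tf).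
Qed.

(** tau conjugated by the linear maps [Pm], each given by a formula that is its own inverse. *)
Definition mut_tau m : G := Pm t1 (sg k) (tau (Pm t k m)).

Lemma Pm_yk (s : qseed nu nf) i j : is_quantum_seed s -> j != i ->
  Pm s i (yk (mutate s i) j) = yk s j + posp (Bt s (uf nf i) j) *: yk s i.
Proof.
move=> qs nj; rewrite /yk (Pm_Bt qs) scalemxAr -mulmxDr; congr (_ *m _).
apply/colP => l; rewrite FmE cvD cvZ !mxE !andbT.
have [->|nl] := eqVneq l i; last by rewrite mulr0 addr0.
rewrite mulr1 eq_sym (negbTE nj) add0r subr0 (bigD1 j) //= big1 ?addr0 => [|p np].
  by rewrite mxE !eqxx mulr1.
by rewrite mxE (negbTE np) mulr0.
Qed.

Let tau0 : tau 0 = 0.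
Proof. by apply: (addrI (tau 0)); rewrite -(c_tauD co) !addr0. Qed.

Let tauZ (n : nat) a : tau (n%:Z *: a) = n%:Z *: tau a.
Proof.
elim: n => [|n IH]; first by rewrite !scale0r tau0.
by rewrite intS !scalerDl !scale1r (c_tauD co) IH.
Qed.

Lemma tau_lam a m : lam t1 (tau a) (tau m) = lam t a m.
Proof.
have [_ EM _] := fE; have [_ EM1 _] := fE1.
have lZ (c : R) z : tw (c *: z) = c *: tw z.
  have tw0 : tw 0 = 0.
    by have := c_twl co (-1) 0 0; rewrite !scaleN1r oppr0 addr0 addNr.
  by have := c_twl co c z 0; rewrite !addr0 tw0 addr0.
apply: (vpow_scale_inj Ksf fE1 (E_neq0 fE1 (tau a + tau m))).
rewrite -EM1 -(c_tauD co) -!(c_tau co) -(c_twM co) EM lZ.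
by [].
Qed.

(** Both sides are multiplicative with the same form, so the variables suffice. The k-th is an
    exchange binomial, and the twist matches binomials because tau sends y_k to the corresponding
    vector of t1. *)
Lemma tw_mut m : tw (E' m) = E1' (mut_tau m).
Proof.
have [E10 EM1 _] := fE1'; have [E0 EM inj] := fE'.
have tw0 : tw 0 = 0.
  by have := c_twl co (-1) 0 0; rewrite !scaleN1r oppr0 addr0 addNr.
have lZ (c : R) z : tw (c *: z) = c *: tw z by have := c_twl co c z 0; rewrite !addr0 tw0 addr0.
have lD z1 z2 : tw (z1 + z2) = tw z1 + tw z2.
  by have := c_twl co 1 z1 z2; rewrite !scale1r.
have tw1 : tw 1 = 1.
  have [e0 _ _] := fE; rewrite -e0 (c_tau co) tau0; by case: fE1 => ->.
have f1 : frame (lam t') (tw \o E').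
  split=> [|a b|c]; first by rewrite /= E0.
    by rewrite /= -(c_twM co) EM lZ.
  by rewrite -(ev_lin _ _ (c_twl co)) -tw0 => /(c_twi co) /inj.
have taumD a b : mut_tau (a + b) = mut_tau a + mut_tau b.
  by rewrite /mut_tau (PmD qt) (c_tauD co) (PmD qt1).
have -> : tw (E' m) = (tw \o E') m by [].
have -> : E1' (mut_tau m) = (E1' \o mut_tau) m by [].
congr (_ m); apply: (frame_ext Ksf qt' f1).
- have t0 : mut_tau 0 = 0 by apply: (addrI (mut_tau 0)); rewrite -taumD !addr0.
  by rewrite /= t0.
- move=> a b; rewrite /= EM1 -taumD; apply: eq_scale => //; congr vp.
  by rewrite /mut_tau lam_mutate !(PmK qt1) tau_lam lam_mutate.
move=> i; have [->|ni] := eqVneq i uk.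
  have mk : mut_tau (fb uk) (uf nf kp) 0 = 1.
    rewrite /mut_tau (PmE qt1) eqxx (c_tauc co) Pm_fb -/uk.
    by rewrite (gm_k k qt) opprK.
  have eX : E' (fb uk) = mutW t k E := mutf_fb k fE.
  have e1 : E1' (mut_tau (fb uk)) = _ := mutf_1 qt1 fE1 mk.
  rewrite /= eX e1 /mut_tau (PmK qt1) /mutW lD !(c_tau co) (c_tauD co).
  by rewrite (c_tauy co) Pm_fb.
have fi : (fb i : G) uk 0 = 0 by rewrite fbE eq_sym (negbTE ni).
have fi2 : tau (fb i) (uf nf kp) 0 = 0 by rewrite (c_tauc co).
by rewrite /= /mut_tau (Pm_id t fi) (Pm_id t1 fi2) /E' /E1' !mutf_id // (c_tau co).
Qed.

Lemma full_step : core t' E' t1' E1' sg (mut_shift_deg t t1 sg gd k) mut_basis tw mut_tau.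
Proof.
split.
- exact: tf_mut.
- exact: (sh_mutate Ksf co k).
- move=> i j; rewrite !BtmE !uf_eq !(inj_eq perm_inj) !(c_B co).
  by [].
- by move=> j; rewrite !(mutate_quantum _ _).2 // (c_d co).
- by move=> js g; apply: (c_lp co (k :: js)).
- exact: (c_twl co).
- exact: (c_twM co).
- exact: (c_twi co).
- by move=> g; have [h ->] := c_twL co (trop t' k g); exists (trop t k h); rewrite Lmut_trop.
- move=> h; have [g e] := c_twLs co (trop t' k h); exists (trop t k g).
  by rewrite Lmut_trop e.
- exact: tw_mut.
- by move=> a b; rewrite /mut_tau (PmD qt) (c_tauD co) (PmD qt1).
- move=> m j; rewrite /mut_tau (PmE qt1) uf_eq (inj_eq perm_inj) !(c_tauc co) !(c_B co).
  have := PmE qt k (Pm t k m) (uf nf j); rewrite (PmK qt) uf_eq => ->.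
  by [].
move=> j; have [->|nj] := eqVneq j k.
  have y0 := yk_k qt k; have y10 := yk_k qt1 kp.
  have tN : tau (- yk t k) = - yk t1 kp.
    by apply/eqP; rewrite -addr_eq0 -(c_tauy co) -(c_tauD co) addNr tau0.
  rewrite /mut_tau !yk_mutate // (Pm_id t) ?cvN ?y0 ?oppr0 // tN (Pm_id t1) // cvN.
  by rewrite y10 oppr0.
rewrite /mut_tau (Pm_yk qt nj) (c_tauD co) -(gez0_abs (posp_ge0 _)) tauZ !(c_tauy co) gez0_abs ?posp_ge0 //.
have nj' : sg j != sg k by rewrite (inj_eq perm_inj).
by rewrite -(c_B co) -(Pm_yk qt1 nj') (PmK qt1).
Qed.

End Full.

(** * Mutation in an arbitrary direction *)

Section Chains.
Context {nu nf : nat}.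
Notation G := 'cV[int]_(nu + nf).
Implicit Types (t : qseed nu nf) (k : 'I_nu) (js : seq 'I_nu) (p q x y z : G).

Lemma trop_seq_cat t js ks p :
  trop_seq t (js ++ ks) p = trop_seq (mutate_seq t js) ks (trop_seq t js p).
Proof. by elim: js t p => //= j js IH t p. Qed.

Lemma trop_seq_rev t js p : is_quantum_seed t ->
  trop_seq (mutate_seq t js) (rev js) (trop_seq t js p) = p.
Proof.
elim: js t p => //= j js IH t p qt; have [qt' _] := mutate_quantum qt j.
by rewrite rev_cons -cats1 trop_seq_cat IH // mutate_seq_rev //= trop_mutateK.
Qed.

Lemma trop_seq_revK t js p : is_quantum_seed t ->
  trop_seq t js (trop_seq (mutate_seq t js) (rev js) p) = p.
Proof.
move=> qt; have qt1 := mutate_seq_quantum js qt.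
by have := trop_seq_rev (rev js) p qt1; rewrite mutate_seq_rev // revK.
Qed.

(** No wall separates the two degrees at any step, so the composite tropical map preserves lambda on
    the pair. *)
Fixpoint coherent t js p q : Prop :=
  if js is k :: js' then same_side k p q /\ coherent (mutate t k) js' (trop t k p) (trop t k q)
  else True.

Lemma coherent_lam t js p q : is_quantum_seed t -> coherent t js p q ->
  lam (mutate_seq t js) (trop_seq t js p) (trop_seq t js q) = lam t p q.
Proof.
elim: js t p q => //= k js IH t p q qt [h1 h2]; have [qt' _] := mutate_quantum qt k.
by rewrite IH // trop_lam.
Qed.

Lemma same_side_comb k x y (a b c d : int) : same_side k x y ->
  0 <= a -> 0 <= b -> 0 <= c -> 0 <= d -> same_side k (a *: x + b *: y) (c *: x + d *: y).
Proof.
rewrite /same_side !cvD !cvZ; move: (x _ _) (y _ _) => u v [[hu hv]|[hu hv]] ha hb hc hd.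
  by left; split; apply: addr_ge0; apply: mulr_ge0.
by right; split; nia.
Qed.

Lemma trop_comb t k x y (a b : int) : is_quantum_seed t -> same_side k x y ->
  0 <= a -> 0 <= b -> trop t k (a *: x + b *: y) = a *: trop t k x + b *: trop t k y.
Proof.
move=> qt hs ha hb; rewrite trop_add // ?trop_scale //.
have := same_side_comb hs ha (lexx 0) (lexx 0) hb.
by rewrite !scale0r addr0 add0r.
Qed.

(* Propagation of a property along the segment from y to x, cut at the walls of
   the tropical transformation. *)
Lemma seg_ind js t x y (Q : G -> Prop) : is_quantum_seed t ->
  (forall a b c d : int, 0 <= a -> 0 < b -> 0 <= c -> 0 <= d ->
     coherent t js (a *: x + b *: y) (c *: x + d *: y) ->
     Q (a *: x + b *: y) -> Q (c *: x + d *: y)) ->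
  Q y -> Q x.
Proof.
elim: js t x y Q => [|k js IH] t x y Q qt step Qy.
  have := step 0 1 1 0; rewrite !scale0r !scale1r add0r addr0.
  by apply.
have [qt' _] := mutate_quantum qt k.
have seg1 u v : same_side k u v ->
    (forall a b c d : int, 0 <= a -> 0 < b -> 0 <= c -> 0 <= d ->
     coherent t (k :: js) (a *: u + b *: v) (c *: u + d *: v) ->
     Q (a *: u + b *: v) -> Q (c *: u + d *: v)) -> Q v -> Q u.
  move=> hs st Qv.
  have := IH (mutate t k) (trop t k u) (trop t k v) (fun p => Q (trop (mutate t k) k p)) qt'.
  rewrite !trop_mutateK //; apply=> // a b c d ha hb hc hd.
  have hb' := ltW hb; rewrite -!trop_comb // !trop_mutateK // => co.
  by apply: st => //; split=> //; apply: same_side_comb.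
have [hs|hs] := pselect (same_side k x y); first exact: (seg1 x y hs step Qy).
pose xa := `|x (uf nf k) 0|; pose ya := `|y (uf nf k) 0|.
(* A positive multiple of the point where the segment meets the wall; it lies on the same side as
   either end. *)
pose z := ya *: x + xa *: y.
have [xy0 z0] : (0 < xa) /\ z (uf nf k) 0 = 0.
  rewrite /z cvD !cvZ; move: hs; rewrite /same_side /xa /ya; move: (x _ _) (y _ _) => u v; nia.
have ya0 : 0 <= ya by apply: normr_ge0.
have ss0 w : same_side k w z /\ same_side k z w.
  by rewrite /same_side z0; move: (w _ _) => c; lia.
have Qz : Q z.
  apply: (seg1 z y (ss0 y).2 _ Qy) => a b c d ha hb hc hd.
  have e (r s : int) : r *: z + s *: y = (r * ya) *: x + (r * xa + s) *: y.
    by rewrite /z scalerDr !scalerA [(r * xa + s) *: _]scalerDl addrA.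
  rewrite !e; apply: step; rewrite ?mulr_ge0 ?addr_ge0 ?mulr_ge0 ?(ltW xy0) //.
  by apply: ltr_wpDl => //; rewrite mulr_ge0 // ltW.
apply: (seg1 x z (ss0 x).1 _ Qz) => a b c d ha hb hc hd.
have e (r s : int) : r *: x + s *: z = (r + s * ya) *: x + (s * xa) *: y.
  by rewrite /z scalerDr !scalerA [(r + _) *: _]scalerDl addrA.
rewrite !e; apply: step; rewrite ?addr_ge0 ?mulr_ge0 ?mulr_gt0 ?(ltW xy0) ?(ltW hb) //.
Qed.

End Chains.

Section Rotate.
Context {R : vring} {K : unitAlgType R} {nu nf : nat}.
Notation G := 'cV[int]_(nu + nf).
Hypothesis Ksf : forall z : K, z != 0 -> z \is a GRing.unit.
Implicit Types (t : qseed nu nf) (E Lg : G -> K) (ks : seq 'I_nu).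

(* Hypothesis (2) of the theorem, read in terms of the initial frame. *)
Fixpoint powers_in t E ks Lg : Prop :=
  if ks is k :: ks' then
    (forall d : nat, exists h, mutf t k E (d%:Z *: fb (uf nf k)) = Lg h) /\
    powers_in (mutate t k) (mutf t k E) ks' Lg
  else True.

Lemma powers_in_range t E ks Lg Lg' : (forall h, exists h', Lg h = Lg' h') ->
  powers_in t E ks Lg -> powers_in t E ks Lg'.
Proof.
move=> hL; elim: ks t E => //= k ks IH t E [h1 h2]; split; last exact: IH.
by move=> d; have [h ->] := h1 d; apply: hL.
Qed.

Lemma powers_in_cat t E ks js Lg : powers_in t E ks Lg ->
  powers_in (mutate_seq t ks) (mutf_seq t E ks) js Lg -> powers_in t E (ks ++ js) Lg.
Proof. by elim: ks t E => //= k ks IH t E [h1 h2] h3; split=> //; apply: IH. Qed.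

(** Each step of ks meets the hypothesis of [full_step] through [powers_in]. When ks joins t to t1,
    the outcome is the full data at t1, with the sigma-image of ks leading to its shift. *)
Lemma rotate ks t E t1 E1 sg gd Lg tw tau : core t E t1 E1 sg gd Lg tw tau ->
  powers_in t E ks Lg -> exists gd' Lg' tau',
  core (mutate_seq t ks) (mutf_seq t E ks) (mutate_seq t1 (map sg ks)) (mutf_seq t1 E1 (map sg ks))
     sg gd' Lg' tw tau' /\ forall g, Lg' (trop_seq t ks g) = Lg g.
Proof.
elim: ks t E t1 E1 gd Lg tau => [|k ks IH] t E t1 E1 gd Lg tau co.
  by move=> _; exists gd, Lg, tau.
move=> /= [h1 h2]; have qt := pf_qt (c_tf co).
have co' := full_step Ksf co h1.
have [|gd' [Lg' [tau' [c1 c2]]]] := IH _ _ _ _ _ _ _ co'.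
  apply: powers_in_range h2 => h; exists (trop t k h).
  by rewrite /mut_basis trop_mutateK.
by exists gd', Lg', tau'; split=> // g; rewrite c2 /mut_basis trop_mutateK.
Qed.

End Rotate.

Section Arbitrary.
Context {R : vring} {K : unitAlgType R} {nu nf : nat}.
Notation G := 'cV[int]_(nu + nf).
Implicit Types (g h a m x y : G) (z : K).
Hypothesis Ksf : forall z : K, z != 0 -> z \is a GRing.unit.
Variables (t : qseed nu nf) (E : G -> K) (ks : seq 'I_nu)
  (sg : {perm 'I_nu}) (gd : 'I_nu -> G) (Lg : G -> K) (tw : K -> K) (tau : G -> G).
Let t1 := mutate_seq t ks.
Let E1 := mutf_seq t E ks.
Hypothesis co : core t E t1 E1 sg gd Lg tw tau.
Hypothesis sc : powers_in t E ks Lg.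
Variable k : 'I_nu.
Let tf := c_tf co.
Let sh := c_sh co.
Let qt : is_quantum_seed t := pf_qt tf.
Let fE : frame (lam t) E := pf_fr tf.
Let hC := pcone_dom qt.
Let Lpt := pf_pt tf.
Let qt1 : is_quantum_seed t1 := sh_qt1 sh.
Let fE1 : frame (lam t1) E1 := sh_fE1 Ksf sh.
Let uk := uf nf k.
Let kp := sg k.
Let t1' := mutate t1 kp.
Let E1' := mutf t1 kp E1.
Let qt1' : is_quantum_seed t1' := (mutate_quantum qt1 kp).1.
Let fE1' : frame (lam t1') E1' := frame_mutf Ksf kp qt1 fE1.
Let hC1' := pcone_dom qt1'.
Let t' := mutate t k.
Let E' := mutf t k E.
Let qt' : is_quantum_seed t' := (mutate_quantum qt k).1.
Let fE' : frame (lam t') E' := frame_mutf Ksf k qt fE.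
Let la' := lam_alt qt'.
Let hC' := pcone_dom qt'.
Let w := mut_shift_deg t t1 sg gd k.
Let sh' : shiftd t' E' t1' E1' sg w := sh_mutate Ksf co k.
Notation Gm := (shift_deg sg gd).
Notation Gm' := (shift_deg sg w).

Let Gm'_split m : Gm' m = Gm (m - m (uf nf kp) 0 *: fb (uf nf kp)) + m (uf nf kp) 0 *: w k.
Proof.
have GN (a b : G) : Gm' (a - b) = Gm' a - Gm' b by rewrite GmD GmN.
have GZ (c : int) (a : G) : Gm' (c *: a) = c *: Gm' a.
  by case: c => n; rewrite ?NegzE ?scaleNr ?GmN GmZ.
have {1}-> : m = m - m (uf nf kp) 0 *: fb (uf nf kp) + m (uf nf kp) 0 *: fb (uf nf kp).
  by rewrite subrK.
rewrite GmD GZ Gm_fb; congr (_ + _); set a := m - _.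
have a0 : a (uf nf kp) 0 = 0 by rewrite cvD cvN cvZ fbE eqxx mulr1 subrr.
rewrite !GmE; congr (_ + _); apply: eq_bigr => j _.
have [->|nj] := eqVneq j k; first by rewrite a0 !scale0r.
by rewrite /w /mut_shift_deg (negbTE nj) trop_0 // (sh_uf sh) eq_sym (negbTE nj) oppr0.
Qed.

(** The analogue of [Gm_yk] for t' and t1'. The data of [core] are not yet known at t', so it is
    computed from the mutation formulas. *)
Lemma Gm'_yk j : Gm' (yk t1' (sg j)) = - yk t' j.
Proof.
have zk : V_deg t1 sg gd k uk 0 = 1.
  by rewrite /V_deg (Gm_uf sh) cvD (gm_k kp qt1) yk_k // addr0 opprK.
have wk : w k = Pm t k (Gm (gm t1 kp + yk t1 kp)) + yk t k.
  by rewrite /w /mut_shift_deg eqxx trop_ge0 ?zk ?scale1r.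
have PN a : Pm t k (- a) = - Pm t k a by rewrite -scaleN1r (PmZ qt) scaleN1r.
have PG a : a (uf nf kp) 0 = 0 -> Pm t k (Gm a) = Gm a.
  by move=> a0; rewrite Pm_id // (Gm_uf sh) a0 oppr0.
have Pyk := Pm_id t (yk_k qt k).
rewrite Gm'_split.
have [->|nj] := eqVneq j k.
  rewrite yk_mutate // cvN yk_k // oppr0 !scale0r addr0 subr0 GmN (Gm_yk Ksf co) opprK.
  by rewrite yk_mutate // opprK.
set b := Bt t uk j; have bE : Bt t1 (uf nf kp) (sg j) = b by apply: (c_B co).
have yE : yk t1' (sg j) (uf nf kp) 0 = - b by rewrite ykE BtmE eqxx /= bE.
have nj' : sg j != kp by rewrite (inj_eq perm_inj).
have e1 : yk t1' (sg j) - (- b) *: fb (uf nf kp) =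
   yk t1 (sg j) + posp b *: yk t1 kp + b *: gm t1 kp.
  have := Pm_yk qt1 nj'; rewrite -/kp -/t1' bE (m0_Pm t1) m0_def yE => <-.
  by move: (yk t1' _) (gm _ _) (fb _) => u1 u2 u3; zmx.
have GZ (c : int) (a : G) : Gm (c *: a) = c *: Gm a.
  by case: c => n; rewrite ?NegzE ?scaleNr ?GmN GmZ.
rewrite yE e1 wk !GmD !GZ !(Gm_yk Ksf co).
have y'E : yk t' j = Pm t k (yk t j) + posp b *: yk t k.
  have := congr1 (Pm t k) (Pm_yk qt nj); rewrite (PmK qt) (PmD qt) (PmZ qt) Pyk; exact.
rewrite y'E !(PmD qt) PN Pyk.
have -> : Pm t k (Gm (gm t1 kp)) = Gm (gm t1 kp) - fb uk + gm t k.
  have gk : Gm (gm t1 kp) (uf nf k) 0 = 1 by rewrite (Gm_uf sh) (gm_k kp qt1) opprK.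
  by rewrite (m0_Pm t) m0_def gk !scale1r.
have -> : Pm t k (yk t j) = yk t j + b *: (gm t k - fb uk).
  by rewrite (m0_Pm t) m0_def ykE -/uk -/b scalerBr; move: (_ *: _) (_ *: _) (yk t j) => u1 u2 u3; zmx.
move: (Gm _) (yk t j) (yk t k) (gm t k) (fb uk) (posp b) => u1 u3 u4 u5 u6 c.
zmx.
Qed.

Lemma Gm'_B (n : 'cV[int]_nu) : (forall l, 0 <= n l 0) ->
  Gm' (Bt t1' *m n) = - (Bt t' *m (\col_j n (sg j) 0)).
Proof.
move=> hn; have colE s (v : 'cV[int]_nu) : Bt s *m v = \sum_l v l 0 *: yk s l :> G.
  apply/colP => i; rewrite BmE summxE; apply: eq_bigr => l _.
  by rewrite cvZ ykE mulrC.
rewrite !colE (big_morph Gm' (GmD sg w) (Gm0 sg w)) (reindex_inj (@perm_inj _ sg)) -sumrN.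
apply: eq_bigr => j _; rewrite mxE -(gez0_abs (hn (sg j))) GmZ Gm'_yk scalerN.
by [].
Qed.

Lemma Gm'_inj : injective Gm'.
Proof.
move=> a b e; apply/eqP; rewrite -subr_eq0; apply/eqP.
have e0 : Gm' (a - b) = 0 by rewrite GmD GmN e subrr.
have u j : (a - b) (uf nf j) 0 = 0.
  rewrite -[j](permKV sg); have := Gm_uf sh' (a - b) ((sg^-1)%g j).
  by rewrite e0 mxE => /eqP; rewrite eq_sym oppr_eq0 => /eqP.
by rewrite -(Gm_frozen sg w u).
Qed.

Let allge a := [forall j : 'I_nu, 0 <= a (uf nf j) 0].

(* The t'-degree of an element pointed at h for t1' is Gm' h - B n*, with n*
   bounding the support. *)
Lemma degree_bound (c : {malg R[G]}) h (z' : G) : (forall m, m \in msupp c -> dom_cone t1' (m - h)) ->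
  c@_h = 1 -> pt E' (dom_cone t') z' (ev E1' c) ->
  exists n : 'cV[int]_nu, [/\ z' = Gm' h - Bt t' *m n, forall j, 0 <= n j 0 &
    forall m, m \in msupp c -> exists v : 'cV[int]_nu,
      [/\ m = h + Bt t1' *m v, forall l, 0 <= v l 0 & forall j, v (sg j) 0 <= n j 0]].
Proof.
move=> hc ch hz.
have [N hN] : exists N : nat, forall m, m \in msupp c -> forall j, 0 <= m (uf nf j) 0 + N%:Z.
  have /choice [N hN] j := malg_bound c (fun m => m (uf nf j) 0).
  exists (\sum_j N j)%N => m mc j; have := hN j m mc.
  by rewrite (bigD1 j) //=; lia.
(* Multiplication by this monomial turns all terms into cluster monomials of t1', whose degrees in
   t' are known. *)
pose M : G := \sum_j N%:Z *: fb (uf nf j).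
have MN j : M (uf nf j) 0 = N%:Z.
  rewrite summxE (bigD1 j) //= cvZ fbE eqxx mulr1 big1 ?addr0 // => i ni.
  by rewrite cvZ fbE uf_eq eq_sym (negbTE ni) mulr0.
(* Outside the cluster monomials, P is an arbitrary element of the right degree. *)
pose P a : K := if allge a then E1' a else E' (Gm' a).
have hP a : pt E' (dom_cone t') (Gm' a) (P a).
  rewrite /P; case: ifP => [/forallP ha|_]; first exact: (pt_E1 Ksf sh').
  by apply: pt_mon; apply: domc0.
pose d : {malg R[G]} := \sum_(m <- msupp c) mkmalgU (m + M) (vp (lam t1' m M) * c@_m).
have dE m : d@_(m + M) = vp (lam t1' m M) * c@_m by apply: mcoeff_shift.
have ed : ev E1' c * E1' M = ev P d.
  rewrite ev_sum {1}/ev mulr_suml big_seq [RHS]big_seq; apply: eq_bigr => m mc.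
  rewrite evU -scalerAl; have [_ -> _] := fE1'; rewrite scalerA mulrC; apply: eq_scale => //.
  rewrite /P; case: ifP => // /negP []; apply/forallP => j.
  by rewrite cvD MN hN.
have Mge j : 0 <= M (uf nf j) 0 by rewrite MN.
have hpn : pn E' (dom_cone t') (z' + Gm' M) (ev P d).
  rewrite -ed; apply: (pnM Ksf fE' hC' (pt_pn hz)); apply: pt_pn.
  exact: (pt_E1 Ksf sh').
have [b [eb _ hb]] := hpn.
have sup m : m \in msupp c -> dom_cone t' (Gm' m - z').
  move=> mc; have := triang_supp fE' hC' hP Gm'_inj eb hb (m := m + M).
  rewrite mem_msupp dE (kk_domain Ksf fE') ?vp_neq0 -?mem_msupp // => /(_ isT).
  by rewrite GmD [z' + _]addrC opprD addrA addrK.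
have hh : h \in msupp c by rewrite mem_msupp ch oner_neq0.
have /domcE [n [en hn]] := sup h hh.
exists n; split=> //; first by rewrite -en opprB addrC subrK.
move=> m mc; have /domcE [v [ev hv]] := hc m mc.
exists v; split=> //; first by rewrite -ev addrC subrK.
have em : m = h + Bt t1' *m v by rewrite -ev addrC subrK.
have /domcE [u [eu hu]] := sup m mc.
have : Bt t' *m (n - \col_j v (sg j) 0) = Bt t' *m u.
  by rewrite -eu em GmD (Gm'_B hv) mulmxBr -en; move: (Gm' h) => x1; move: (_ *m _) => x2; zmx.
move=> /(B_inj2 qt') e j; have := hu j; rewrite -e cvD cvN [(\col__ _) _ _]mxE subr_ge0.
by [].
Qed.

(** [Zh] is L indexed by degrees in t1'. Pointedness at t1' is [half_step] for the data carried to
    t1, at t' it is [half_step] for t. In the last clause a support on the kp-string of t1' becomes,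
    in t1, a string leading away from the dominance cone, so a single term survives. *)
Lemma coherence_step : exists (js : seq 'I_nu) (Zh : G -> K), [/\
  mutate_seq t1' js = t', forall h, exists g, Zh h = Lg g,
  forall h, pt E1' (dom_cone t1') h (Zh h),
  forall h, pt E' (dom_cone t') (trop_seq t1' js h) (Zh h) &
  forall (h : G) (c : {malg R[G]}), 0 <= h (uf nf kp) 0 -> c@_h = 1 -> Zh h = ev E1' c ->
    (forall m, m \in msupp c -> exists p : nat, m = h + p%:Z *: yk t1' kp) -> Zh h = E1' h].
Proof.
have [gd1 [L1 [tau1 [co1 hL1]]]] := rotate Ksf co sc; rewrite -/t1 -/E1 in co1.
(* From t1' back to t1, back along ks to t, then to t'. *)
pose js := kp :: (rev ks ++ [:: k]).
have e1 : trop_seq t1' js = fun h => trop t k (trop_seq t1 (rev ks) (trop t1' kp h)).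
  apply/funext => h; rewrite /js /= /t1' mutateK // trop_seq_cat /=.
  by rewrite /t1 mutate_seq_rev.
have et : mutate_seq t1' js = t'.
  by rewrite /js /= /t1' mutateK // mutate_seq_cat /= /t1 mutate_seq_rev.
have LL h : L1 (trop t1' kp h) = Lg (trop_seq t1 (rev ks) (trop t1' kp h)).
  by rewrite -hL1 trop_seq_revK.
have tk h : trop t1 kp (trop t1' kp h) = h.
  by have := trop_mutateK kp h qt1'; rewrite /t1' mutateK.
exists js, (fun h => L1 (trop t1' kp h)); split=> //.
- by move=> h; exists (trop_seq t1 (rev ks) (trop t1' kp h)); rewrite LL.
- by move=> h; rewrite -{1}(tk h); apply: (half_step Ksf co1).
- by move=> h; rewrite e1 LL; apply: (half_step Ksf co).
move=> h c hk ch ec hc; set g1 := trop t1' kp h in ec *.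
pose y := yk t1 kp.
have tE (p : nat) : trop t1' kp (h + p%:Z *: yk t1' kp) = g1 - p%:Z *: y.
  have yy := yk_k qt1' kp.
  have hk2 : (h + p%:Z *: yk t1' kp) (uf nf kp) 0 = h (uf nf kp) 0.
    by rewrite cvD cvZ yy mulr0 addr0.
  rewrite trop_ge0 ?hk2 // (PmD qt1') (PmZ qt1') (Pm_id t1' yy) /g1 trop_ge0 //.
  rewrite yk_mutate // -/y !scalerN; move: (Pm _ _ _) (_ *: y) (_ *: y) => u1 u2 u3; zmx.
have Spt m : pt E1 (dom_cone t1) m (sbasis t1 kp E1 m).
  by apply: pt_sub (pt_Sb kp qt1 fE1 m) => a; apply: strc_dom.
pose d : {malg R[G]} := \sum_(m <- msupp c) mkmalgU (trop t1' kp m) c@_m.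
have ed : ev E1' c = ev (sbasis t1 kp E1) d.
  rewrite ev_sum {1}/ev big_seq [RHS]big_seq; apply: eq_bigr => m mc; rewrite evU.
  congr (_ *: _); have [p ->] := hc m mc; rewrite Sb_le0 //; first by rewrite tk.
  by rewrite trop_k cvD cvZ yk_k // mulr0 addr0 oppr_le0.
have dsupp m : m \in msupp d -> exists2 m', m' \in msupp c & m = trop t1' kp m'.
  rewrite mem_msupp; apply: contraNP => nm; rewrite mcoeff_sum big1_seq // => a /andP[_ ac].
  by rewrite mcoeffU; case: eqP => // e; case: nm; exists a.
have ds m : m \in msupp d -> m = g1.
  move=> md; have [m' mc em] := dsupp m md; have [p ep] := hc m' mc.
  have emp : m = g1 - p%:Z *: y by rewrite em ep tE.
  have [b [eb _ hb]] := pf_pt (c_tf co1) g1.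
  have e2 : ev (sbasis t1 kp E1) d = ev E1 b by rewrite -ed -ec.
  have := triang_supp fE1 (pcone_dom qt1) Spt (@inj_id G) e2 hb md.
  rewrite emp addrAC subrr add0r => h1.
  have h2 : dom_cone t1 (p%:Z *: y) by apply: (strc_dom (k := kp)); exists p.
  case: (pcone_dom qt1) => _ _ an; have := an _ h2 h1 => e3.
  by rewrite e3 subr0.
have d1 : d = mkmalgU g1 1.
  apply/malgP => m; rewrite mcoeffU; have [<-|nm] := eqVneq g1 m.
    have [b [eb b1 hb]] := pf_pt (c_tf co1) g1.
    have e2 : ev (sbasis t1 kp E1) d = ev E1 b by rewrite -ed -ec.
    by rewrite -(triang_coef fE1 (pcone_dom qt1) Spt (@inj_id G) e2 hb) b1.
  rewrite mulr0n; apply/eqP; rewrite mcoeff_eq0; apply/negP => /ds e.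
  by rewrite e eqxx in nm.
rewrite ec ed d1 evU scale1r Sb_le0 ?tk // trop_k oppr_le0.
by [].
Qed.

(** Let p be a degree where the claim holds and q one never separated from it. The isometry gives
    lambda(Gm' p, B n) = 0 for the defect n of q from [degree_bound]. As Gm' p is negative in the
    unfrozen directions other than k, n is concentrated in k, and the last clause of
    [coherence_step] applies. *)
Lemma var_in_L (d : nat) : exists g, E1' (d%:Z *: fb (uf nf kp)) = Lg g.
Proof.
have [js [Zh [ejs hZL hZ1 hZ' hstr]]] := coherence_step.
pose T h := trop_seq t1' js h.
(* The monomial of [y0] is free of the k-th new variable, so it belongs to t1 and lies in L; any
   positive share of [y0] makes all the other unfrozen exponents positive. *)
pose y0 : G := \sum_(j | j != k) fb (uf nf (sg j)).
pose x0 : G := d%:Z *: fb (uf nf kp).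
have y0E j : y0 (uf nf (sg j)) 0 = (j != k)%:R.
  rewrite summxE; have [->|nj] := eqVneq j k.
    by rewrite big1 // => i ni; rewrite fbE uf_eq (inj_eq perm_inj) eq_sym (negbTE ni).
  rewrite (bigD1 j) //= fbE eqxx big1 ?addr0 // => i /andP[_ ni].
  by rewrite fbE uf_eq (inj_eq perm_inj) eq_sym (negbTE ni).
have x0E j : x0 (uf nf (sg j)) 0 = d%:Z * (j == k)%:R.
  by rewrite cvZ fbE uf_eq (inj_eq perm_inj).
have cE (a b : int) j : (a *: x0 + b *: y0) (uf nf (sg j)) 0 = a * (d%:Z * (j == k)%:R) + b * (j != k)%:R.
  by rewrite cvD (cvZ a x0) (cvZ b y0) x0E y0E.
have Gpt h : (forall j, 0 <= h (uf nf j) 0) -> pt E' (dom_cone t') (Gm' h) (E1' h).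
  exact: (pt_E1 Ksf sh').
suff : Zh x0 = E1' x0 by move=> <-; apply: hZL.
apply: (@seg_ind nu nf js t1' x0 y0 (fun h => Zh h = E1' h) qt1'); last first.
  have y0k : y0 (uf nf kp) 0 = 0 by rewrite y0E eqxx.
  have e : E1' y0 = Lg (Gm y0).
    rewrite /E1' mutf_id //; apply: (E1_L Ksf co) => j.
    by rewrite -[j](permKV sg) y0E.
  have qg := pt_uniq fE1' hC1'.
  have [h eh] : exists h, Lg (Gm y0) = Zh h.
    pose h := trop_seq t' (rev js) (trop t k (Gm y0)); exists h.
    have hT : T h = trop t k (Gm y0).
      by rewrite /T /h -ejs trop_seq_revK.
    have [g eg] := hZL h; rewrite eg; congr Lg.
    have := hZ' h; rewrite eg -/(T h) hT => p1.
    by have := pt_uniq fE' hC' p1 (half_step Ksf co k g) => /(trop_inj qt).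
  rewrite e eh; congr Zh; apply: (qg _ _ (E1' y0)); last by rewrite e eh; apply: hZ1.
  by apply: pt_mon; apply: domc0.
move=> a b c e ha hb hc he coh; set p := a *: x0 + b *: y0 in coh *; set q := c *: x0 + e *: y0 in coh *.
move=> Zp.
have pge j : 0 <= p (uf nf j) 0.
  by rewrite -[j](permKV sg) cE addr_ge0 ?mulr_ge0 ?(ltW hb).
have qge j : 0 <= q (uf nf j) 0.
  by rewrite -[j](permKV sg) cE addr_ge0 ?mulr_ge0.
have Tp : T p = Gm' p.
  by apply: (pt_uniq fE' hC' (hZ' p)); rewrite Zp; apply: Gpt.
have [c1 [ec c1h hc1]] := hZ1 q.
have := hZ' q; rewrite ec -/(T q) => /(degree_bound hc1 c1h) [n [en hn hsup]].
have iso := coherent_lam qt1' coh; rewrite ejs -/(T p) -/(T q) Tp en in iso.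
have nz j : j != k -> n j 0 = 0.
  have : lam t' (Gm' p) (Bt t' *m n) = 0.
    move: iso; rewrite lamDr (lmNr la') (Gm_lam Ksf sh'); move: (lam t1' p q) => u.
    by move=> /eqP; rewrite -subr_eq0 addrAC subrr add0r oppr_eq0 => /eqP.
  rewrite (lamBr qt') => /eqP; rewrite oppr_eq0 -oppr_eq0 -sumrN.
  rewrite psumr_eq0 => [/allP H nj|j' _]; last first.
    rewrite (Gm_uf sh') mulrN opprK mulr_ge0 ?mulr_ge0 //; exact/ltW/dprime_gt0.
  have := H j (mem_index_enum j); rewrite (Gm_uf sh') mulrN opprK cE (negbTE nj) !mulr0 add0r mulr1 !mulf_eq0.
  by rewrite (gt_eqF (dprime_gt0 qt' j)) (gt_eqF hb) orbF => /eqP.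
rewrite -ec; apply: (hstr q c1) => //.
move=> m /hsup [v [-> hv hle]]; exists (absz (v kp 0)); congr (_ + _).
rewrite gez0_abs // /yk scalemxAr; congr (_ *m _); apply/colP => l; rewrite cvZ mxE andbT.
have [->|nl] := eqVneq l kp; first by rewrite mulr1.
rewrite mulr0 -[l](permKV sg); apply/eqP; rewrite eq_le hv andbT.
have nk : ((sg^-1)%g l) != k by apply: contra_neq nl => el; rewrite /kp -el permKV.
by rewrite -(nz _ nk) hle.
Qed.

(** The twist sends powers of X_k' to powers of the new variable of t1' up to frozen factors, and it
    permutes L; its injectivity brings membership back. *)
Lemma var_in_L' (d : nat) : exists g, E' (d%:Z *: fb uk) = Lg g.
Proof.
pose m : G := d%:Z *: fb uk; pose m1 : G := d%:Z *: fb (uf nf kp).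
pose tm := mut_tau t t1 sg tau k m.
have etw : tw (E' m) = E1' tm := tw_mut Ksf co k m.
have mk : 0 <= m (uf nf k) 0 by rewrite cvZ fbE eqxx mulr1.
have tmc j : tm (uf nf (sg j)) 0 = m (uf nf j) 0.
  rewrite /tm /mut_tau (PmE qt1) uf_eq (inj_eq perm_inj) !(c_tauc co) !(c_B co).
  by have := PmE qt k (Pm t k m) (uf nf j); rewrite (PmK qt) uf_eq => ->.
pose u := tm - m1.
have hu j : u (uf nf j) 0 = 0.
  rewrite -[j](permKV sg) cvD cvN tmc !cvZ !fbE !uf_eq (inj_eq perm_inj).
  by rewrite subrr.
have etm : tm = u + m1 by rewrite subrK.
have [g eg] := var_in_L d; rewrite -/m1 in eg.
have uE : E1' u = E u by rewrite /E1' mutf_id // (E1_frozen sh hu).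
have e2 : tw (E' m) = vp (- lam t1' u m1 + lam t u g) *: Lg (u + g).
  by rewrite etw etm (E_add fE1') uE eg (frozen_shift Ksf tf) // scalerA vpD.
have [g' eg'] := c_twLs co (u + g).
have tw0 : tw 0 = 0.
  by have := c_twl co (-1) 0 0; rewrite !scaleN1r oppr0 addr0 addNr.
have e3 : E' m = vp (- lam t1' u m1 + lam t u g) *: Lg g'.
  have inj : injective tw := c_twi co.
  apply: inj; rewrite e2 -eg'.
  by have := c_twl co (vp (- lam t1' u m1 + lam t u g)) (Lg g') 0; rewrite !addr0 tw0 addr0.
exists (Pm t k m); apply: (L_eq Ksf tf _ e3).
by apply: pt_sub (pt_mutf qt fE mk) => b; apply: strc_dom.
Qed.

End Arbitrary.

Section AllSeeds.
Context {R : vring} {K : unitAlgType R} {nu nf : nat}.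
Notation G := 'cV[int]_(nu + nf).
Hypothesis Ksf : forall z : K, z != 0 -> z \is a GRing.unit.
Variables (sg : {perm 'I_nu}) (tw : K -> K).

Definition DT_data (t : qseed nu nf) (E : G -> K) (ks : seq 'I_nu) (Lg : G -> K) : Prop :=
  (exists gd tau, core t E (mutate_seq t ks) (mutf_seq t E ks) sg gd Lg tw tau) /\ powers_in t E ks Lg.

(** The shift of mu_k t is reached by undoing k, following ks and mutating at sigma k. The powers
    met on the way are cluster monomials of t, those of the old hypothesis, and cluster monomials of
    the new shifted seed. *)
Lemma DT_data_mutate t E ks Lg k : DT_data t E ks Lg ->
  DT_data (mutate t k) (mutf t k E) (k :: ks ++ [:: sg k]) (mut_basis t Lg k).
Proof.
case=> [[gd [tau co]] sc]; have qt := pf_qt (c_tf co); have fE := pf_fr (c_tf co).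
have hX := var_in_L' Ksf co sc k.
have co' := full_step Ksf co hX.
have hL h : exists h', Lg h = mut_basis t Lg k h' by exists (trop t k h); rewrite /mut_basis trop_mutateK.
split.
  exists (mut_shift_deg t (mutate_seq t ks) sg gd k), (mut_tau t (mutate_seq t ks) sg tau k).
  by rewrite /= mutateK // mutf_mutfK // mutate_seq_cat mutf_seq_cat.
rewrite /= mutateK // mutf_mutfK //; split.
  move=> d; rewrite (tf_T4 (c_tf co)); first exact: hL.
  by move=> j; rewrite cvZ fbE mulr_ge0.
apply: powers_in_cat; first by apply: (powers_in_range hL).
split=> // d; eexists; apply: (E1_L Ksf co') => j.
by rewrite cvZ fbE mulr_ge0.
Qed.

End AllSeeds.

Lemma alg_iso_comp (K1 K2 K3 : unitAlgType kk) (f : K2 -> K3) (g : K1 -> K2) :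
  alg_iso f -> alg_iso g -> alg_iso (f \o g).
Proof.
case=> lf [f1 fM] bf [lg [g1 gM] bg]; split; last exact: bij_comp.
  by move=> c x y /=; rewrite lg lf.
by split=> [|x y] /=; rewrite ?gM ?fM ?g1 ?f1.
Qed.

Lemma alg_iso_id (K : unitAlgType kk) : alg_iso (@id K).
Proof. by split=> //; exists id. Qed.

(** * Seeds in their skew-fields of fractions *)

Section Realization.
Context {nu nf : nat} (F : fraction_fields nu nf) {K : unitAlgType kk_vring}.
Notation G := 'cV[int]_(nu + nf).
Hypothesis Ksf : forall z : K, z != 0 -> z \is a GRing.unit.
Implicit Types (t : qseed nu nf) (g m : G).

Definition vars t (phi : F t -> K) m : K := phi (emb F (Xm t m)).

Lemma ev_vars t (phi : F t -> K) (x : LP t) : linear phi ->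
  ev (vars phi) x = phi (emb F x).
Proof.
move=> lphi.
have p0 : phi 0 = 0 by have := lphi (-1) 0 0; rewrite !scaleN1r oppr0 addr0 addNr.
have pD y z : phi (y + z) = phi y + phi z by have := lphi 1 y z; rewrite !scale1r.
have pZ c y : phi (c *: y) = c *: phi y by have := lphi c y 0; rewrite !addr0 p0 addr0.
have -> : x = \sum_(m <- msupp x) (x@_m *: Xm t m : LP t).
  rewrite {1}[x]monalgE; apply: eq_bigr => m _.
  by rewrite [RHS]scale_mkmalgU mulr1.
rewrite ev_sum linear_sum (big_morph phi pD p0); apply: eq_bigr => m _.
by rewrite linearZ pZ evZ evU scale1r.
Qed.

Lemma frame_vars t (phi : F t -> K) : alg_iso phi -> frame (lam t) (vars phi).
Proof.
case=> lphi [p1 pM] bp; have [_ inj _] := embP F t.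
have p0 : phi 0 = 0 by have := lphi (-1) 0 0; rewrite !scaleN1r oppr0 addr0 addNr.
have pZ c y : phi (c *: y) = c *: phi y by have := lphi c y 0; rewrite !addr0 p0 addr0.
split=> [|a b|c].
- by rewrite /vars -[Xm t 0]/(1 : LP t) rmorph1.
- rewrite /vars -pM; have := congr1 phi (rmorphM (@emb _ _ F t) (Xm t a) (Xm t b)) => <-.
  by rewrite (XmM t a b) -pZ; congr phi; apply: (linearZ_LR (@emb _ _ F t)).
by rewrite (ev_vars c lphi) -p0 => /(bij_inj bp); rewrite -(raddf0 (@emb _ _ F t)) => /inj.
Qed.

Lemma vars_mustar t (phi : F t -> K) k : is_quantum_seed t -> alg_iso phi ->
  vars (phi \o mustar F k) = mutf t k (vars phi).
Proof.
move=> qt ip; have fE := frame_vars ip; have [qt' _] := mutate_quantum qt k.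
have im := alg_iso_comp ip (mustar_iso F k qt); have fE' := frame_vars im.
have [E0 EM _] := frame_mutf Ksf k qt fE.
apply: (frame_ext Ksf qt' fE') => // i.
have [lphi _ _] := ip.
have pD y z : phi (y + z) = phi y + phi z by have := lphi 1 y z; rewrite !scale1r.
have [->|ni] := eqVneq i (uf nf k); last first.
  rewrite mutf_id; last by rewrite fbE eq_sym (negbTE ni).
  by rewrite /vars /= mustarX.
have ge : - fb (uf nf k) + \sum_j posp (Bt t j k) *: fb j = gm t k + yk t k.
  rewrite -gm_mutate // /gm /fmut eqxx; congr (_ + _); apply: eq_bigr => j _.
  by rewrite BtmE eqxx orbT opprK.
apply: etrans _ (esym (mutf_fb k fE)); apply: etrans (congr1 phi (mustarXk F k qt)) _.
have gg : - fb (uf nf k) + \sum_j posp (- Bt t j k) *: fb j = gm t k.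
  by rewrite /gm /fmut eqxx.
rewrite gg ge; exact: pD.
Qed.

Lemma mustar_seq_iso t js : is_quantum_seed t -> alg_iso (mustar_seq F t js).
Proof.
elim: js t => [|k js IH] t qt; first exact: alg_iso_id.
have [qt' _] := mutate_quantum qt k.
exact: (alg_iso_comp (mustar_iso F k qt) (IH _ qt')).
Qed.

Lemma vars_mustar_seq t (phi : F t -> K) js : is_quantum_seed t -> alg_iso phi ->
  vars (phi \o mustar_seq F t js) = mutf_seq t (vars phi) js.
Proof.
elim: js t phi => // k js IH t phi qt ip; have [qt' _] := mutate_quantum qt k.
by rewrite /= -vars_mustar // -IH //; apply: alg_iso_comp => //; apply: mustar_iso.
Qed.

Lemma mustar_seq_ev t (phi : F t -> K) js (x : LP (mutate_seq t js)) :
  is_quantum_seed t -> alg_iso phi ->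
  phi (mustar_seq F t js (emb F x)) = ev (mutf_seq t (vars phi) js) x.
Proof.
move=> qt ip; rewrite -vars_mustar_seq // ev_vars //.
by have [] := alg_iso_comp ip (mustar_seq_iso js qt).
Qed.

Lemma pointed_pt t (phi : F t -> K) g z : is_quantum_seed t -> alg_iso phi ->
  pointed g z <-> pt (vars phi) (dom_cone t) g (phi z).
Proof.
move=> qt ip; have [lphi _ bp] := ip.
have xE (s : seq 'cV[nat]_nu) (c : 'cV[nat]_nu -> kk) :
    cmul (Xm t g) (1 + \sum_(n <- s) c n *: Ym t (nvec n))
    = mkmalgU g 1 + \sum_(n <- s) mkmalgU (g + Bt t *m nvec n) (c n) :> {malg kk[G]}.
  rewrite /cmul [LHS]twmulDr twmul_sumr; congr (_ + _).
    by apply: etrans (twmulUU _ _ _ _ _) _; rewrite addr0 !mulr1.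
  apply: eq_bigr => n _; rewrite -[LHS]twmulZr twmulUU [LHS]scale_mkmalgU.
  by rewrite !mulr1.
have nv (n : 'cV[nat]_nu) j : nvec n j 0 = n j 0 by rewrite nvecE.
have nI : injective (@nvec nu).
  by move=> n n' e; apply/colP => j; have := congr1 (fun v : 'cV[int]_nu => v j 0) e; rewrite !nv => -[].
split.
  case=> x [-> [s [c [us s0 ex]]]]; exists x; split; first by rewrite ev_vars.
    rewrite ex xE mcoeffD mcoeffUU mcoeff_sum big1_seq ?addr0 // => n /andP[_ ns].
    rewrite mcoeffU; case: eqP => // e; case/negP: s0; rewrite (_ : 0 = n) //.
    apply/nI/(B_inj2 qt)/(addrI g); rewrite e.
    rewrite (_ : nvec 0 = 0) ?mulmx0 ?addr0 //.
    by apply/colP => j; rewrite nv !mxE.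
  move=> a; rewrite ex xE mem_msupp mcoeffD mcoeffU mcoeff_sum => h.
  have [->|na] := eqVneq a g; first by rewrite subrr; apply: domc0.
  apply: contrapT => nd; case/negP: h; rewrite [g == a]eq_sym (negbTE na) add0r.
  rewrite big1 // => n _; rewrite mcoeffU; case: eqP => // e; case: nd.
  by exists n; rewrite -e addrC addKr.
case=> c [e c1 hc].
have ez : z = emb F (c : LP t).
  by apply: (bij_inj bp); rewrite e ev_vars.
exists (c : LP t); split=> //.
(* The value 0 outside the support is a mere default. *)
have /choice [nn hn] : forall m, exists n : 'cV[nat]_nu, m \in msupp c -> m = g + Bt t *m nvec n.
  move=> m; have [/hc [n en]|_] := boolP (m \in msupp c); last by exists 0.
  by exists n => _; rewrite -en addrC subrK.
pose r := rem g (msupp c); have ur : uniq r by apply/rem_uniq/fset_uniq.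
have rE m : m \in r -> m != g /\ m \in msupp c by rewrite (mem_rem_uniq _ (fset_uniq _)) !inE => /andP.
exists (map nn r), (fun n => c@_(g + Bt t *m nvec n)); split.
- rewrite map_inj_in_uniq // => m m' /rE [_ /hn e1] /rE [_ /hn e2] e3.
  by rewrite e1 e2 e3.
- apply/mapP => -[m /rE [nm /hn e1] e2]; case/eqP: nm; rewrite e1 -e2.
  rewrite (_ : nvec 0 = 0) ?mulmx0 ?addr0 //.
  by apply/colP => j; rewrite nv !mxE.
rewrite xE big_map [LHS]monalgE (big_rem g) /=; last by rewrite mem_msupp c1 oner_neq0.
rewrite c1; congr (_ + _); rewrite big_seq [RHS]big_seq; apply: eq_bigr => m /rE [_ /hn e1].
by rewrite -e1.
Qed.

Lemma bar_barinv t (phi : F t -> K) z : alg_iso phi ->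
  bar_invariant z <-> barinv (vars phi) (phi z).
Proof.
case=> lphi _ bp; split.
  by case=> x [-> bx]; exists x; split; [rewrite ev_vars|apply/barmP].
case=> c [e /barmP hc]; exists (c : LP t); split=> //.
by apply: (bij_inj bp); rewrite e ev_vars.
Qed.

End Realization.

Local Open Scope classical_set_scope.

Section AlgIso.
Context {K1 K2 : unitAlgType kk} (phi : K1 -> K2).
Hypothesis ip : alg_iso phi.

Lemma alg_iso0 : phi 0 = 0.
Proof. by have [l _ _] := ip; have := l (-1) 0 0; rewrite !scaleN1r oppr0 addr0 addNr. Qed.

Lemma alg_isoD x y : phi (x + y) = phi x + phi y.
Proof. by have [l _ _] := ip; have := l 1 x y; rewrite !scale1r. Qed.

Lemma alg_isoZ c x : phi (c *: x) = c *: phi x.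
Proof. by have [l _ _] := ip; have := l c x 0; rewrite !addr0 alg_iso0 addr0. Qed.

Lemma alg_iso_sum (I : Type) (s : seq I) (f : I -> K1) :
  phi (\sum_(i <- s) f i) = \sum_(i <- s) phi (f i).
Proof. exact: (big_morph phi alg_isoD alg_iso0). Qed.

Lemma alg_iso_inj : injective phi.
Proof. by have [_ _ b] := ip; apply: bij_inj. Qed.

Lemma alg_isoM : {morph phi : x y / x * y}.
Proof. by have [_ [_ M] _] := ip. Qed.

Lemma preimage_subalgebra (A : set K2) : is_subalgebra A -> is_subalgebra (phi @^-1` A).
Proof.
have [l [p1 pM] _] := ip; case=> A1 AD AM; split=> [|c x y hx hy|x y hx hy].
- by rewrite /preimage /= p1.
- by rewrite /preimage /= l; apply: AD.
by rewrite /preimage /= pM; apply: AM.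
Qed.

Lemma preimage_basis (A L : set K2) : is_basis A L -> is_basis (phi @^-1` A) (phi @^-1` L).
Proof.
have [_ _ [psi pK Kp]] := ip; case=> LA sp fr; split; first by move=> z /LA.
  move=> z /sp [s [c [hs ez]]]; exists (map psi s), (fun y => c (phi y)); split.
    by move=> x /mapP [y /hs hy ->]; rewrite /preimage /= Kp.
  apply: alg_iso_inj; rewrite ez alg_iso_sum big_map; apply: eq_bigr => x _.
  by rewrite alg_isoZ Kp.
move=> s c us hs e x xs.
rewrite -[x]pK; apply: (fr (map phi s) (fun y => c (psi y))).
- by rewrite (map_inj_uniq alg_iso_inj).
- by move=> y /mapP [w /hs hw ->].
- apply: etrans _ (etrans (congr1 phi e) alg_iso0); rewrite alg_iso_sum big_map.
  apply: eq_bigr => y _.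
  by rewrite alg_isoZ pK.
by rewrite map_f.
Qed.

End AlgIso.

Section Seed.
Context {nu nf : nat} (F : fraction_fields nu nf) {K : unitAlgType kk_vring}.
Notation G := 'cV[int]_(nu + nf).
Hypothesis Ksf : forall z : K, z != 0 -> z \is a GRing.unit.
Variables (t : qseed nu nf) (phi : F t -> K).
Hypothesis qt : is_quantum_seed t.
Hypothesis ip : alg_iso phi.
Let E := vars phi.
Let fE : frame (lam t) E := frame_vars ip.
Let hC := pcone_dom qt.
Let lphi : linear phi. Proof. by have [] := ip. Qed.

Lemma unique_maximal_degree (x : LP t) (p : G) : x@_p != 0 ->
  (forall m, m \in msupp x -> dom_cone t (m - p)) -> unique (maximal_degree x) p.
Proof.
move=> xp hx; have px : p \in msupp x by rewrite mem_msupp.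
split.
  split=> // g /hx d1 [[n en] ne].
  have d2 : dom_cone t (p - g) by exists n; rewrite en addrC addKr.
  case: hC => _ _ an; apply: ne; apply/eqP; rewrite -subr_eq0; apply/eqP.
  by apply: an => //; rewrite opprB.
move=> g [gx hg]; apply: contrapT => ne; apply: (hg p px); split=> [|e].
  by have [n en] := hx g gx; exists n; rewrite -en addrC subrK.
by apply: ne; rewrite e.
Qed.

Section Products.
Variable Lg : G -> F t.
Let L' := phi \o Lg.
Hypothesis Lpt : forall g, pt E (dom_cone t) g (L' g).

Let pt_prod i g : pt E (dom_cone t) (fb i + g) (vp (- lam t (fb i) g) *: (E (fb i) * L' g)).
Proof. by apply: (ptM fE hC) => //; apply: pt_mon; apply: domc0. Qed.

Let phi_prod i g : phi (emb F (Xv t i) * Lg g) = E (fb i) * L' g.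
Proof. exact: alg_isoM. Qed.

Let phi_comb p (s : seq G) (b : G -> kk) : phi (Lg p + \sum_(g <- s) b g *: Lg g) =
  ev L' (mkmalgU p 1 + \sum_(g <- s) mkmalgU g (b g)).
Proof.
rewrite (alg_isoD ip) (alg_iso_sum ip) evD evU scale1r ev_sum; congr (_ + _).
by apply: eq_bigr => g _; rewrite evU (alg_isoZ ip).
Qed.

(** The product is pointed once its v-power is removed, so the scalar in [normalizes_to] is forced
    by the leading coefficients. *)
Lemma Tri_of_products : triangular_products Lg ->
  forall i g, Tri t E L' (fb i + g) (vp (- lam t (fb i) g) *: (E (fb i) * L' g)).
Proof.
move=> H i g; have [s [b [us hs [x [h [ex um ez]]]]]] := H i g.
have hp := pt_prod i g; split=> //; have [c [ec c1 hc]] := hp.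
rewrite (addrC g) in hs ez; set p := fb i + g in hs ez c1 hc *.
pose b' : {malg kk[G]} := mkmalgU p 1 + \sum_(g' <- s) mkmalgU g' (b g').
pose k : kk := vpow (- lam t (fb i) g) * x@_h.
have e : vp (- lam t (fb i) g) *: (E (fb i) * L' g) = ev L' (k *: b').
  by rewrite -phi_prod ez (alg_isoZ ip) phi_comb scalerA evZ.
have b'E m : b'@_m = (p == m)%:R + \sum_(g' <- s) (mkmalgU g' (b g'))@_m.
  by rewrite mcoeffD mcoeffU mcoeff_sum.
have b'p : b'@_p = 1.
  rewrite b'E eqxx big1_seq ?addr0 // => g' /andP[_ gs].
  rewrite mcoeffU; case: eqP => // eg; have [[_ ne] _] := hs g' gs.
  by case: ne.
have k1 : k = 1.
  have := triang_coef fE hC Lpt (@inj_id G) (etrans (esym e) ec) hc (m := p).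
  by rewrite c1 mcoeffZ b'p mulr1.
exists b'; split; first by rewrite e k1 scale1r.
move=> m nm; rewrite b'E eq_sym (negbTE nm) add0r.
apply: vmm_sum => g' gs _; rewrite mcoeffU; case: eqP => _; last exact: vmm0.
by have [_] := hs g' gs.
Qed.

Lemma products_of_Tri : (forall g, barinv E (L' g)) ->
  (forall i g, Tri t E L' (fb i + g) (vp (- lam t (fb i) g) *: (E (fb i) * L' g))) ->
  triangular_products Lg.
Proof.
move=> Lbar H i g; have pf : pfam t E L' by split.
have hT := H i g; have [c [ec c1 hc]] := hT.1.
rewrite (addrC g); set p := fb i + g in hT c1 hc *.
have [b [eb b1 hm hs]] := Tri_supp pf hT.
have ur : uniq (rem p (msupp b)) by apply/rem_uniq/fset_uniq.
have rE m : m \in rem p (msupp b) -> m != p /\ m \in msupp b.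
  by rewrite (mem_rem_uniq _ (fset_uniq _)) !inE => /andP.
exists (rem p (msupp b)), (fun m => b@_m); split=> //.
  move=> g' /rE [ne gs]; split; last exact: hm.
  split; last exact/eqP.
  by have [n en] := hs g' gs; exists n; rewrite -en addrC subrK.
have [cl [ecl _ _]] := Lpt g.
have el : Lg g = emb F (cl : LP t) by apply: (alg_iso_inj ip); rewrite -(ev_vars _ lphi).
pose x : LP t := Xv t i * (cl : LP t).
have ez : emb F (Xv t i) * Lg g = emb F x by rewrite el -rmorphM.
have kz : E (fb i) * L' g = vp (lam t (fb i) g) *: (vp (- lam t (fb i) g) *: (E (fb i) * L' g)).
  by rewrite scalerA -vpD addrN vp0 scale1r.
have xE : x = vp (lam t (fb i) g) *: c :> {malg kk[G]}.
  apply: (ev_inj fE); rewrite [RHS]evZ -ec -kz -phi_prod ez.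
  exact: ev_vars lphi.
have xp : x@_p = vpow (lam t (fb i) g).
  by rewrite xE; apply: etrans (mcoeffZ _ _ _) _; rewrite c1 mulr1.
exists x, p; split=> //.
  apply: unique_maximal_degree; first by rewrite xp (vp_neq0 kk_vring).
  move=> m mx; apply: hc; move: mx; rewrite !mem_msupp xE.
  by apply: contraNneq => c0; apply/eqP; apply: etrans (mcoeffZ _ _ _) _; rewrite c0 mulr0.
apply: (alg_iso_inj ip); rewrite phi_prod (alg_isoZ ip) phi_comb xp kz eb.
congr (_ *: ev _ _); rewrite [LHS]monalgE (big_rem p) /=; first by rewrite b1.
by rewrite mem_msupp b1 oner_neq0.
Qed.

End Products.

Lemma preimage_pointed_family (Lg : G -> K) : (forall g, pt E (dom_cone t) g (Lg g)) ->
  exists Lt, phi \o Lt = Lg /\ pointed_family (phi @^-1` range Lg) Lt.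
Proof.
have [_ _ [psi pK Kp]] := ip; move=> Lpt; exists (psi \o Lg).
have e : phi \o (psi \o Lg) = Lg by apply/funext => g /=; rewrite Kp.
split=> //; split; last by move=> g; apply/(pointed_pt _ _ qt ip); rewrite /= Kp.
apply/seteqP; split=> z; first by case=> g _ eg; exists g => //=; rewrite eg pK.
by case=> g _ <-; exists g => //=; rewrite Kp.
Qed.

(** The cluster monomials of all seeds are assumed to lie in L, so the axiom on t and its shift
    holds for whatever sequence realizes the shift. *)
Lemma seed_triangular_basis (Lg : G -> K) (A : set K) :
  tfam t E Lg -> is_subalgebra A -> is_basis A (range Lg) ->
  (forall js g, laurent (mutf_seq t E js) (Lg g)) ->
  (forall js (m : 'cV[nat]_(nu + nf)), exists g, mutf_seq t E js (nvec m) = Lg g) ->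
  forall ks, is_triangular_basis F t ks (phi @^-1` A) (phi @^-1` range Lg).
Proof.
move=> tf sA bA hlp hcm ks; have [LA sp _] := bA.
have cm js : cluster_monomials F t js `<=` phi @^-1` range Lg.
  move=> z [m ->]; have [g eg] := hcm js m; exists g => //.
  by rewrite (mustar_seq_ev Ksf _ qt ip) evU scale1r.
split.
- split; first exact: preimage_subalgebra.
  move=> z /sp [s [c [hs ez]]] js.
  have [x ex] : laurent (mutf_seq t E js) (phi z).
    rewrite ez big_seq; elim/big_ind: _ => [|x y|x /hs [g _ <-]]; [exact: lp0|exact: lpD|].
    exact: lpZ.
  exists x; apply: (alg_iso_inj ip).
  by rewrite ex (mustar_seq_ev Ksf _ qt ip).
- exact: preimage_basis.
- by move=> z [g _ eg]; apply/(bar_barinv _ ip); rewrite -eg; apply: (pf_bar tf).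
- by split; apply: cm.
have [Lt [eL hL]] := preimage_pointed_family (pf_pt tf).
exists Lt; split=> //; apply: products_of_Tri; rewrite eL.
- exact: (pf_pt tf).
- exact: (pf_bar tf).
exact: (tf_T3 tf).
Qed.

End Seed.

Section Compatible.
Context {nu nf : nat} (F : fraction_fields nu nf) {K : unitAlgType kk_vring}.
Notation G := 'cV[int]_(nu + nf).
Hypothesis Ksf : forall z : K, z != 0 -> z \is a GRing.unit.
Variables (t : qseed nu nf) (phi : F t -> K).
Hypothesis qt : is_quantum_seed t.
Hypothesis ip : alg_iso phi.
Let E := vars phi.

Lemma seed_compatible (Lg Lg' : G -> K) js :
  (forall g, pt E (dom_cone t) g (Lg g)) ->
  (forall g, pt (mutf_seq t E js) (dom_cone (mutate_seq t js)) g (Lg' g)) ->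
  (forall g, Lg' (trop_seq t js g) = Lg g) ->
  compatible F t js (phi @^-1` range Lg) (transport F t js (phi @^-1` range Lg)).
Proof.
move=> Lpt Lpt' hL; have ip' := alg_iso_comp ip (mustar_seq_iso F js qt).
have eR : range Lg = range Lg'.
  apply/seteqP; split=> z [g _ <-]; first by exists (trop_seq t js g).
  by exists (trop_seq (mutate_seq t js) (rev js) g) => //; rewrite -hL trop_seq_revK.
have [Lt [eL fL]] := preimage_pointed_family qt ip Lpt.
have e' : vars (phi \o mustar_seq F t js) = mutf_seq t E js by apply: vars_mustar_seq.
move: Lpt'; rewrite -e' => Lpt'.
have qt' := mutate_seq_quantum js qt.
have [Lt' [eL' fL']] := preimage_pointed_family qt' ip' Lpt'.
exists Lt, Lt'; split; first exact: fL.
  by rewrite eR; exact: fL'.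
move=> g; apply: (alg_iso_inj ip).
have e1 : phi (Lt g) = Lg g by rewrite -eL.
have e2 h : phi (mustar_seq F t js (Lt' h)) = Lg' h by rewrite -eL'.
by rewrite e1 e2 hL.
Qed.

End Compatible.

Section Shifts.
Context {nu nf : nat} (F : fraction_fields nu nf) {K : unitAlgType kk_vring}.
Notation G := 'cV[int]_(nu + nf).
Hypothesis Ksf : forall z : K, z != 0 -> z \is a GRing.unit.
Variables (t : qseed nu nf) (phi : F t -> K).
Hypothesis qt : is_quantum_seed t.
Hypothesis ip : alg_iso phi.
Let E := vars phi.

Lemma is_shift_shiftd ks sg : is_shift F t ks sg <->
  exists gd, shiftd t E (mutate_seq t ks) (mutf_seq t E ks) sg gd.
Proof.
have mE j : phi (mustar_seq F t ks (emb F (Xv (mutate_seq t ks) j))) = mutf_seq t E ks (fb j).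
  by rewrite (mustar_seq_ev Ksf _ qt ip) evU scale1r.
have uE (g : G) k : usubmx g = - delta_mx k 0 <-> forall i, g (uf nf i) 0 = - (i == k)%:R.
  split=> [e i|h]; first by have := congr1 (fun v : 'cV[int]_nu => v i 0) e; rewrite !mxE andbT.
  by apply/colP => i; rewrite !mxE andbT; apply: h.
split.
  move=> /choice [gd hgd]; exists gd; split.
  - exact: qt.
  - exact: frame_vars.
  - by exists ks.
  - by move=> j; have [_ /(pointed_pt _ _ qt ip)] := hgd j; rewrite mE.
  by move=> i j; have [/uE h _] := hgd j; apply: h.
case=> gd sh k; exists (gd k); split; first by apply/uE => i; apply: (sh_uf sh).
by apply/(pointed_pt _ _ qt ip); rewrite mE; apply: (sh_pt sh).
Qed.

End Shifts.

(** * From the hypotheses of the theorem to the data at the initial seed *)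

Section FromHypotheses.
Context {nu nf : nat} (F : fraction_fields nu nf).
Notation G := 'cV[int]_(nu + nf).
Variables (t : qseed nu nf) (ks : seq 'I_nu) (sg : {perm 'I_nu}).
Hypothesis qt : is_quantum_seed t.
Let K : unitAlgType kk_vring := F t.
Let Ksf : forall z : K, z != 0 -> z \is a GRing.unit.
Proof. by have [] := embP F t. Qed.
Let ip : alg_iso (@id K) := alg_iso_id (F t).
Let E : G -> K := vars (@id K).
Let t1 := mutate_seq t ks.
Let E1 := mutf_seq t E ks.
Let fE : frame (lam t) E := frame_vars ip.
Let qt1 : is_quantum_seed t1 := mutate_seq_quantum ks qt.
Let fE1 : frame (lam t1) E1 := frame_mutf_seq Ksf ks qt fE.
Let hC := pcone_dom qt.

Lemma mustar_seq_Xm m : mustar_seq F t ks (emb F (Xm t1 m)) = E1 m.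
Proof.
by apply: etrans (mustar_seq_ev Ksf (Xm t1 m) qt ip) _; rewrite evU scale1r.
Qed.

Lemma tfam_of_basis (A L : set K) : is_triangular_basis F t ks A L ->
  exists Lg : G -> K, [/\ L = range Lg, tfam t E Lg & forall js g, laurent (mutf_seq t E js) (Lg g)].
Proof.
case=> [[sA AU] bA Lbar [Lcm _] [Lg [[eL Lpt] Ltri]]]; exists Lg.
have [LA sp _] := bA; have [_ _ AM] := sA.
have inL g : L (Lg g) by rewrite eL; exists g.
have Lpt' g : pt E (dom_cone t) g (Lg g) := (pointed_pt g (Lg g) qt ip).1 (Lpt g).
split=> // [|js g].
  split.
  - split=> // g; exact: (bar_barinv (Lg g) ip).1 (Lbar _ (inL g)).
  - exact: (Tri_of_products qt ip Lpt' Ltri).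
  - move=> m hm; have : L (E m).
      apply: Lcm; exists (\col_i absz (m i 0)); rewrite /E /vars /=; congr (emb F (Xm t _)).
      by apply/colP => i; rewrite nvecE mxE gez0_abs.
    rewrite eL => -[h _ eh]; rewrite -eh; congr Lg.
    apply: (pt_uniq fE hC (Lpt' h)); rewrite eh.
    by apply: pt_mon; apply: domc0.
  move=> g h; have [s [c [hs ->]]] := sp _ (AM _ _ (LA _ (inL g)) (LA _ (inL h))).
  rewrite big_seq; elim/big_ind: _ => [|x y|x /hs]; [exact: lp0|exact: lpD|].
  by rewrite eL => -[m _ <-]; apply/lpZ/lpU.
have [x ex] := AU _ (LA _ (inL g)) js; exists x; rewrite ex.
exact: (mustar_seq_ev Ksf x qt ip).
Qed.

(** A variation map prescribes images of generators only; tau is the linear extension of the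
    exponents found there. It preserves lambda because the twist preserves quasi-commutation, and
    [frame_ext] then extends the formula to all monomials. *)
Lemma core_of_twist (Lg : G -> K) (gd : 'I_nu -> G) (tw : K -> K) :
  tfam t E Lg -> (forall js g, laurent (mutf_seq t E js) (Lg g)) ->
  shiftd t E t1 E1 sg gd -> is_twist F t ks sg tw ->
  set_bij (range Lg) (range Lg) tw ->
  exists tau, core t E t1 E1 sg gd Lg tw tau.
Proof.
move=> tf hlp sh [var [[sB sd] iv vX vY vP] etw] [twL _ twLs].
have iw : alg_iso tw by rewrite etw; apply: alg_iso_comp => //; apply: mustar_seq_iso.
have /choice [a ha] : forall i, exists a : G, tw (E (fb i)) = E1 a /\
    forall j, a (uf nf (sg j)) 0 = fb i (uf nf j) 0.
  move=> i; case: (split_ordP i) => k ->.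
    have [u eu] := vX k; exists (col_mx 0 u + fb (uf nf (sg k))); split.
      rewrite etw /E /vars /= eu /Xfr /Xv cmulX.
      exact: mustar_seq_Xm.
    move=> j; rewrite cvD col_mxEu mxE add0r !fbE !uf_eq (inj_eq perm_inj).
    by [].
  have ef : fb (rshift nu k) = col_mx 0 (delta_mx k 0) :> G.
    apply/colP => i'; rewrite fbE; case: (split_ordP i') => l ->.
      by rewrite col_mxEu mxE eq_lrshift.
    by rewrite col_mxEd mxE eq_rshift andbT.
  have : (var @` frozen_factors F t) (var (E (fb (rshift nu k)))).
    by exists (E (fb (rshift nu k))) => //; exists (delta_mx k 0); rewrite /E /vars /= ef.
  rewrite vP => -[u eu]; exists (col_mx 0 u); split.
    by rewrite etw /= eu; apply: mustar_seq_Xm.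
  by move=> j; rewrite col_mxEu mxE fbE /uf eq_lrshift.
pose tau (m : G) : G := \sum_i m i 0 *: a i.
have tauD b c : tau (b + c) = tau b + tau c.
  by rewrite -big_split; apply: eq_bigr => i _; rewrite cvD scalerDl.
have tau0 : tau 0 = 0 by rewrite /tau big1 // => i _; rewrite mxE scale0r.
have tauN b : tau (- b) = - tau b.
  by rewrite -sumrN; apply: eq_bigr => i _; rewrite cvN scaleNr.
have tau_fb i : tau (fb i) = a i.
  rewrite /tau (bigD1 i) //= fbE eqxx scale1r big1 ?addr0 // => j nj.
  by rewrite fbE (negbTE nj) scale0r.
have la := lam_alt qt; have la1 := lam_alt qt1.
have lam_a i j : lam t1 (a i) (a j) = lam t (fb i) (fb j).
  have e : E1 (a i) * E1 (a j) = vp (2 * lam t (fb i) (fb j)) *: (E1 (a j) * E1 (a i)).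
    rewrite -(ha i).1 -(ha j).1 -!(alg_isoM iw) -(alg_isoZ iw).
    congr tw; exact: E_comm la fE (fb i) (fb j).
  have n0 : E1 (a j) * E1 (a i) != 0.
    by apply: (K_domain Ksf); apply: (E_neq0 fE1).
  rewrite (E_comm la1 fE1) in e; have := vpow_scale_inj Ksf fE1 n0 e; lia.
have lam_tau b c : lam t1 (tau b) (tau c) = lam t b c.
  apply: (@cV_ind _ _ (fun b => lam t1 (tau b) (tau c) = lam t b c) xpredT) => //.
  - by rewrite tau0 !lam0l.
  - by move=> x y ex ey; rewrite tauD !lamDl ex ey.
  - by move=> x ex; rewrite tauN !(lmNl la, lmNl la1) ex.
  move=> i _; apply: (@cV_ind _ _ (fun c => lam t1 (tau (fb i)) (tau c) = lam t (fb i) c) xpredT) => //.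
  - by rewrite tau0 !lam0r.
  - by move=> x y ex ey; rewrite tauD !lamDr ex ey.
  - by move=> x ex; rewrite tauN !(lmNr la, lmNr la1) ex.
  by move=> j _; rewrite !tau_fb.
have [E10 EM1 inj1] := fE1; have [E0 EM inj] := fE.
have [lw [w1 wM] bw] := iw.
have fw : frame (lam t) (tw \o E).
  split=> [|b c|c]; first by rewrite /= E0.
    by rewrite /= -(alg_isoM iw) EM (alg_isoZ iw).
  by rewrite -(ev_lin _ _ lw) -(alg_iso0 iw) => /(alg_iso_inj iw) /inj.
have etau m : tw (E m) = E1 (tau m).
  have -> : tw (E m) = (tw \o E) m by [].
  have -> : E1 (tau m) = (E1 \o tau) m by [].
  congr (_ m); apply: (frame_ext Ksf qt fw).
  - by rewrite /= tau0.
  - by move=> b c; rewrite /= EM1 -tauD lam_tau.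
  by move=> i; rewrite /= (ha i).1 tau_fb.
exists tau; split=> //.
- exact: (alg_iso_inj iw).
- by move=> g; have [h _ eh] := twL _ (imageT Lg g); exists h.
- by move=> h; have [_ [g _ <-] eg] := twLs _ (imageT Lg h); exists g.
- move=> m j; rewrite summxE [in RHS](sum_fb m) summxE; apply: eq_bigr => i _.
  by rewrite !cvZ (ha i).2.
move=> j; apply/eqP; rewrite -subr_eq0; apply/eqP.
(* The condition on Y_k gives an equality of monomials of t1; linear independence of monomials turns
   it into one of exponents. *)
have e : E1 (tau (yk t j)) = E1 (yk t1 (sg j)).
  rewrite -etau -mustar_seq_Xm etw /=; congr (mustar_seq F t ks _).
  exact: vY.
have := inj1 (mkmalgU (tau (yk t j)) 1 - mkmalgU (yk t1 (sg j)) 1).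
rewrite evB !evU e subrr => /(_ erefl) /eqP; rewrite subr_eq0 => /eqP h.
have := congr1 (fun c : {malg kk[G]} => c@_(tau (yk t j))) h.
rewrite mcoeffUU mcoeffU; case: eqP => [->|_]; first by rewrite subrr.
by move=> /eqP; rewrite oner_eq0.
Qed.

Lemma powers_in_of_nth (Lg : G -> K) (s : qseed nu nf) (e : G -> K) (js : seq 'I_nu) :
  (forall (i : 'I_(size js)) (d : nat), exists g,
     mutf_seq s e (take i.+1 js) (d%:Z *: fb (uf nf (tnth (in_tuple js) i))) = Lg g) ->
  powers_in s e js Lg.
Proof.
elim: js s e => //= j js IH s e H; split.
  move=> d; have [g eg] := H ord0 d; exists g; rewrite -eg take0 /=.
  by rewrite (tnth_nth j).
apply: IH => i d; have [g eg] := H (lift ord0 i) d; exists g; rewrite -eg.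
by rewrite !(tnth_nth j).
Qed.

End FromHypotheses.

Lemma DT_data_seq {R : vring} {K : unitAlgType R} {nu nf : nat} (sg : {perm 'I_nu}) (tw : K -> K)
    (t : qseed nu nf) E ks Lg js : (forall z : K, z != 0 -> z \is a GRing.unit) ->
  DT_data sg tw t E ks Lg -> exists ks' Lg',
  DT_data sg tw (mutate_seq t js) (mutf_seq t E js) ks' Lg' /\
  forall g, Lg' (trop_seq t js g) = Lg g.
Proof.
move=> Ksf; elim: js t E ks Lg => [|j js IH] t E ks Lg td; first by exists ks, Lg.
have qt : is_quantum_seed t by have [[gd [tau co]] _] := td; apply: (pf_qt (c_tf co)).
have [ks' [Lg' [td' hL]]] := IH _ _ _ _ (DT_data_mutate Ksf j td).
by exists ks', Lg'; split=> // g; rewrite /= hL /mut_basis trop_mutateK.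
Qed.

Theorem theorem1p2p3 (nu nf : nat) (F : fraction_fields nu nf)
    (t : qseed nu nf) (ks : seq 'I_nu) (sigma : {perm 'I_nu})
    (A L : set (F t)) :
  is_quantum_seed t ->
  is_shift F t ks sigma ->
  is_triangular_basis F t ks A L ->
  (exists tw : F t -> F t, is_DT_twist F t ks sigma tw /\ set_bij L L tw) ->
  (forall (s : 'I_(size ks)) (d : nat),
     let ks_le := take s.+1 ks in let k := tnth (in_tuple ks) s in
     L (mustar_seq F t ks_le
          (emb F (Xv (mutate_seq t ks_le) (uf nf k))) ^+ d)) ->
  is_common_triangular_basis F t A L /\
  (forall (ks' : seq 'I_nu) (z : F t), cluster_monomials F t ks' z -> L z).
Proof.
move=> qt shf tb [tw [[_ itw] bij]] hseq.
pose K : unitAlgType kk_vring := F t.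
have Ksf : forall z : K, z != 0 -> z \is a GRing.unit by have [] := embP F t.
pose E := vars (@id K).
have ip : alg_iso (@id K) := alg_iso_id (F t).
have fE : frame (lam t) E := frame_vars ip.
have [[sA _] bA _ _ _] := tb.
have [Lg [eL tf hlp]] := tfam_of_basis qt tb.
rewrite eL in bij bA hseq *.
have [gd sh] := (is_shift_shiftd Ksf qt ip ks sigma).1 shf.
have [tau co] := core_of_twist qt tf hlp sh itw bij.
have td : @DT_data kk_vring K nu nf sigma tw t E ks Lg.
  split; first by exists gd, tau.
  apply: powers_in_of_nth => i d; have [g _ eg] := hseq i d; exists g; rewrite eg.
  set js := take i.+1 ks.
  have qs : is_quantum_seed (mutate_seq t js) := mutate_seq_quantum js qt.
  have fs : frame (lam (mutate_seq t js)) (mutf_seq t E js) := frame_mutf_seq Ksf js qt fE.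
  rewrite -(E_exp _ _ qs fs); congr (_ ^+ d); apply/esym.
  exact: mustar_seq_Xm.
have onto (s : qseed nu nf) js (Lg1 Lg2 : 'cV[int]_(nu + nf) -> K) : is_quantum_seed s ->
    (forall g, Lg2 (trop_seq s js g) = Lg1 g) -> range Lg2 = range Lg1.
  move=> qs h; apply/seteqP; split=> z [g _ <-]; last by exists (trop_seq s js g).
  by exists (trop_seq (mutate_seq s js) (rev js) g) => //; rewrite -h trop_seq_revK.
(* The family carried to the seed at the end of js is a re-indexing of L, and [tf_T4] at that seed
   supplies its cluster monomials. *)
have hcm js (m : 'cV[nat]_(nu + nf)) : range Lg (mutf_seq t E js (nvec m)).
  have [ks' [Lg' [[[gd' [tau' co']] _] hL]]] := DT_data_seq js Ksf td.
  rewrite -(onto _ _ _ _ qt hL) (tf_T4 (c_tf co')); first exact: imageT.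
  by move=> i; rewrite nvecE.
split; last first.
  move=> js z [m ->]; rewrite mustar_seq_Xm //.
split=> [js t'|js js' t' L'].
  have [ks' [Lg' [[[gd' [tau' co']] _] hL]]] := DT_data_seq js Ksf td.
  have qt' : is_quantum_seed t' := mutate_seq_quantum js qt.
  have ip' := mustar_seq_iso F js qt.
  have e' : vars (mustar_seq F t js : F t' -> K) = mutf_seq t E js := vars_mustar_seq Ksf js qt ip.
  have eR := onto _ _ _ _ qt hL.
  split.
    exists ks', sigma; apply/(is_shift_shiftd Ksf qt' ip'); exists gd'.
    by rewrite e'; apply: (c_sh co').
  move=> ks'' sigma'' _; rewrite /transport -eR.
  apply: (seed_triangular_basis Ksf qt' ip'); rewrite ?e' ?eR //.
  - exact: (c_tf co').
  - exact: (c_lp co').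
  move=> js' m; rewrite -mutf_seq_cat; have := hcm (js ++ js') m.
  by rewrite -eR => -[g _ <-]; exists g.
have [ks1 [Lg1 [td1 hL1]]] := DT_data_seq js Ksf td.
have [ks2 [Lg2 [td2 hL2]]] := DT_data_seq js' Ksf td1.
have [[gd1 [tau1 co1]] _] := td1; have [[gd2 [tau2 co2]] _] := td2.
have qt' : is_quantum_seed t' := mutate_seq_quantum js qt.
have ip' := mustar_seq_iso F js qt.
have e' : vars (mustar_seq F t js : F t' -> K) = mutf_seq t E js := vars_mustar_seq Ksf js qt ip.
rewrite /L' /transport -(onto _ _ _ _ qt hL1).
apply: (seed_compatible Ksf qt' ip' (Lg' := Lg2)); rewrite ?e' //.
- exact: (pf_pt (c_tf co1)).
exact: (pf_pt (c_tf co2)).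
Qed.
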